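(* Let $R_N=\mathbb C[k_1,\dots,k_N]/I_N$ and let $\mathfrak P_N$ be the set of prime ideals of $R_N$ that are minimal over a principal ideal $(Q_J)$ for some internal $J$. For $N=4$, $|\mathfrak P_4|=8$: they are $\mathfrak p_{++++}$, generated by the maximal minors of the $2\times8$ matrix $(k_1\,k_2\,k_3\,k_4)$, and $\mathfrak p_{----}$, generated by the maximal minors of $(k_1^T\,k_2^T\,k_3^T\,k_4^T)$, each of which is minimal over all three ideals $(Q_{12}),(Q_{13}),(Q_{14})$; and the six ideals $\mathfrak p_{++--}$ and its inequivalent permutations, where $\mathfrak p_{++--}$ is generated by the maximal minors of $(k_1\,k_2)$ and of $(k_3^T\,k_4^T)$ and is minimal over $(Q_{12})=(Q_{34})$. For $N\ge5$, every $\mathfrak p\in\mathfrak P_N$ lies over a unique $(Q_J)$ (up to $J\leftrightarrow J^c$); if $|J|\ge3$ and $|J^c|\ge3$ then $(Q_J)$ is itself prime; and for $i\ne j$ there are exactly two minimal primes over $(Q_{\{i,j\}})$, namely $\mathfrak p^+_{ij}$ and $\mathfrak p^-_{ij}$, generated by the maximal minors of the $2\times4$ matrix $(k_i\,k_j)$ resp. $(k_i^T\,k_j^T)$.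
   Context: $k_i=\begin{pmatrix}a_i&b_i\\c_i&d_i\end{pmatrix}$, $Q_i=a_id_i-b_ic_i$, $I_N$ generated by the entries of $k_1+\dots+k_N$ and $Q_1,\dots,Q_N$. For $N\ge4$ an internal momentum is a subset $J\subset\{1,\dots,N\}$ with $2\le|J|\le N-2$; $k_J=\sum_{i\in J}k_i$, $Q_J=\det k_J\in R_N$ (so $Q_J=Q_{J^c}$); $Q_{ij}=Q_{\{i,j\}}$. *)

(* Defs.v *)
From HB Require Import structures.
From mathcomp Require Import all_boot all_order all_algebra.
From mathcomp Require Import Rstruct.
From mathcomp Require Import complex.
From mathcomp Require Import mpoly.
Set Implicit Arguments.
Unset Strict Implicit.
Unset Printing Implicit Defensive.
Import GRing.Theory.
Local Open Scope ring_scope.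

Definition CC : closedFieldType := Rdefinitions.R[i].

(** The polynomial ring C[k_1,...,k_N] in the 4N entries of N 2x2 matrices.
    The entry (r,c) of k_i is the variable with index mxvec_index i (mxvec_index r c).
    Momenta are indexed by 'I_N = {0,...,N-1} (paper: 1..N). *)
Definition Pol (N : nat) := {mpoly CC[N * (2 * 2)]}.

Definition kmat (N : nat) (i : 'I_N) : 'M[Pol N]_2 :=
  \matrix_(r < 2, c < 2) 'X_(mxvec_index i (mxvec_index r c)).

Definition Qi (N : nat) (i : 'I_N) : Pol N := \det (kmat i).

Definition kJ (N : nat) (J : {set 'I_N}) : 'M[Pol N]_2 := \sum_(i in J) kmat i.
Definition QJ (N : nat) (J : {set 'I_N}) : Pol N := \det (kJ J).

Definition internal (N : nat) (J : {set 'I_N}) : bool := (2 <= #|J| <= N - 2)%N.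

Section Ideals.
Variable P : comNzRingType.

Definition ideal_gen (G : P -> Prop) : P -> Prop :=
  fun p => exists s : seq (P * P),
    (forall x, List.In x s -> G x.2) /\ p = \sum_(x <- s) x.1 * x.2.

Definition is_ideal (I : P -> Prop) : Prop :=
  [/\ I 0, (forall a b, I a -> I b -> I (a + b)) & (forall a b, I b -> I (a * b))].

Definition prime_ideal (I : P -> Prop) : Prop :=
  [/\ is_ideal I, ~ I 1 & (forall a b, I (a * b) -> I a \/ I b)].

Definition isub (I J : P -> Prop) : Prop := forall x, I x -> J x.
Definition ieq (I J : P -> Prop) : Prop := forall x, I x <-> J x.

Definition gunion (G H : P -> Prop) : P -> Prop := fun p => G p \/ H p.
End Ideals.

Definition IN_gens (N : nat) : Pol N -> Prop :=
  fun p => (exists r c : 'I_2, p = (\sum_(i < N) kmat i) r c) \/ (exists i : 'I_N, p = Qi i).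

(** Ideals of R_N are represented (via the correspondence theorem) by their
    preimages in C[k], i.e. ideals of C[k] containing I_N.  The ideal of R_N
    generated by the images of a set G of polynomials has preimage the ideal
    of C[k] generated by G together with the generators of I_N. *)
Definition Rgen (N : nat) (G : Pol N -> Prop) : Pol N -> Prop :=
  ideal_gen (gunion (@IN_gens N) G).

Definition Rprime (N : nat) (p : Pol N -> Prop) : Prop :=
  prime_ideal p /\ isub (Rgen (fun _ => False)) p.

Definition minprime_over (N : nat) (p : Pol N -> Prop) (G : Pol N -> Prop) : Prop :=
  [/\ Rprime p, isub (Rgen G) p &
      forall q, Rprime q -> isub (Rgen G) q -> isub q p -> ieq q p].

Definition single (N : nat) (f : Pol N) : Pol N -> Prop := fun p => p = f.

Definition frakP (N : nat) (p : Pol N -> Prop) : Prop :=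
  exists J : {set 'I_N}, internal J /\ minprime_over p (single (QJ J)).

Definition max_minors (N m : nat) (A : 'M[Pol N]_(2, m)) : Pol N -> Prop :=
  fun p => exists c c' : 'I_m, (c < c')%N /\
    p = A 0 c * A 1 c' - A 0 c' * A 1 c.

Definition k4 (i : nat) : 'M[Pol 4]_2 := kmat (@inord 3 i).

Definition p_pppp : Pol 4 -> Prop :=
  Rgen (max_minors (row_mx (row_mx (k4 0) (k4 1)) (row_mx (k4 2) (k4 3)))).
Definition p_mmmm : Pol 4 -> Prop :=
  Rgen (max_minors (row_mx (row_mx (k4 0)^T (k4 1)^T) (row_mx (k4 2)^T (k4 3)^T))).
Definition p_ppmm (i j l m : 'I_4) : Pol 4 -> Prop :=
  Rgen (gunion (max_minors (row_mx (kmat i) (kmat j)))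
               (max_minors (row_mx (kmat l)^T (kmat m)^T))).

Definition p_plus (N : nat) (i j : 'I_N) : Pol N -> Prop :=
  Rgen (max_minors (row_mx (kmat i) (kmat j))).
Definition p_minus (N : nat) (i j : 'I_N) : Pol N -> Prop :=
  Rgen (max_minors (row_mx (kmat i)^T (kmat j)^T)).

(* Main.v *)
Require Import Defs.
From HB Require Import structures.
From mathcomp Require Import all_boot all_order all_algebra.
From mathcomp Require Import mpoly.
From mathcomp Require Import ring zify.
From Stdlib Require Import Classical.

(** Write k_i = lambda_i x_i^T, so that Q_ij = <ij> [ij] modulo Q_i and Q_j. A prime of R_N that
    contains Q_ij then contains all row minors or all column minors of (k_i, k_j); for N = 4,
    Q_12 = Q_34 gives four combinations, and when both pairs are of the same type, either all four
    k_i are parallel on that side or k_1 + k_2 vanishes, which puts the prime over a mixed one.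
    Explicit points exclude further inclusions and distinguish the ideals (Q_J).

    The substance is the primality of the ideals. For N = 4 they are, after a linear change of
    coordinates, ideals of 2-minors of a generic matrix or of a ladder, hence toric: kernels of
    monomial maps. For N >= 5 the ideal is the contraction of the ideal E of the spinor ring
    C[lambda, x] generated by the four entries of sum_i lambda_i x_i^T and by <ij>, resp. Q_J,
    because R_N is the ring of torus invariants. The generators of E have, for suitable weights,
    leading monomials with disjoint supports, so certain elements <ab>, etc. are nonzerodivisors
    modulo E; inverting them, the relations can be solved for some of the variables and the quotient
    becomes a localization of a polynomial ring. *)

Set Implicit Arguments.
Unset Strict Implicit.
Unset Printing Implicit Defensive.
Import GRing.Theory.
Local Open Scope ring_scope.

(** * Ideals *)

(** A preimage of a prime is prime, so after the spinor computation it remains to show that the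
    preimage of E under [phi] is no larger than the given ideal. The generator <ij> of E is not
    torus invariant, so the descent has to treat its invariant multiples instead. The bound N >= 5
    leaves three particles besides i and j. For N = 4 the row minors of (k_1, k_2) force Q_34 = 0,
    which splits again, so they do not generate a prime; there the conditions on both pairs have to
    be imposed together. The weights must serve every N and every J: five or six distinguished
    particles get rows of their own and all others share one row, so that dominance of a monomial
    becomes a finite check. Cramer's rule uses different pairs of particles for the two columns.
    With one pair (a, b) for both, disjoint leading monomials would make one term of <ab> dominate
    because of the first column and the other term because of the second. *)

Section IdealTheory.
Variable P : comNzRingType.
Implicit Types (I : P -> Prop) (G H : P -> Prop).

Lemma ideal0 I : is_ideal I -> I 0. Proof. by case. Qed.
Lemma idealD I a b : is_ideal I -> I a -> I b -> I (a + b).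
Proof. by case=> _ h _; apply: h. Qed.
Lemma idealMl I a b : is_ideal I -> I b -> I (a * b).
Proof. by case=> _ _ h; apply: h. Qed.
Lemma idealMr I a b : is_ideal I -> I a -> I (a * b).
Proof. by rewrite mulrC; apply: idealMl. Qed.
Lemma idealN I a : is_ideal I -> I a -> I (- a).
Proof. by move=> Ii Ia; rewrite -mulN1r; apply: idealMl. Qed.
Lemma idealB I a b : is_ideal I -> I a -> I b -> I (a - b).
Proof. by move=> Ii Ia Ib; apply: idealD => //; apply: idealN. Qed.
Lemma idealBr I a b : is_ideal I -> I (a - b) -> I b -> I a.
Proof. by move=> Ii Iab Ib; rewrite -(subrK b a); apply: idealD. Qed.
Lemma ideal_sum I (T : Type) (r : seq T) (Q : pred T) (F : T -> P) :
  is_ideal I -> (forall i, Q i -> I (F i)) -> I (\sum_(i <- r | Q i) F i).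
Proof.
by move=> Ii h; apply: (big_ind I) => //; [exact: ideal0|move=> x y; exact: idealD].
Qed.

Lemma ideal_gen_ideal G : is_ideal (ideal_gen G).
Proof.
split.
- by exists [::]; rewrite big_nil.
- move=> a b [s [hs ->]] [t [ht ->]]; exists (s ++ t); split; last by rewrite big_cat.
  by move=> x xi; case: (List.in_app_or _ _ _ xi) => [/hs|/ht].
- move=> a b [s [hs ->]]; exists [seq (a * x.1, x.2) | x <- s]; split.
    by move=> x xi; case: (proj1 (List.in_map_iff _ _ _) xi) => y [<- /hs].
  by rewrite big_map mulr_sumr; apply: eq_bigr => x _; rewrite mulrA.
Qed.

Lemma ideal_gen_incl G x : G x -> ideal_gen G x.
Proof.
move=> Gx; exists [:: (1, x)]; rewrite big_seq1 mul1r; split=> //.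
by move=> y [<-|].
Qed.

Lemma ideal_gen_sub G I : is_ideal I -> (forall x, G x -> I x) -> isub (ideal_gen G) I.
Proof.
move=> Ii GI _ [s [hs ->]]; elim: s hs => [|x s IHs] hs.
  by rewrite big_nil; apply: ideal0.
rewrite big_cons; apply: idealD => //.
  by apply: idealMl => //; apply/GI/hs; left.
by apply: IHs => y ys; apply: hs; right.
Qed.

Definition idadd I f : P -> Prop := fun p => exists u, I (p - u * f).

Lemma idadd_ideal I f : is_ideal I -> is_ideal (idadd I f).
Proof.
move=> Ii; split.
- by exists 0; rewrite mul0r subrr; apply: ideal0.
- move=> a b [u Iu] [v Iv]; exists (u + v).
  rewrite (_ : _ - _ = (a - u * f) + (b - v * f)); last by ring.
  exact: idealD.
- move=> a b [u Iu]; exists (a * u).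
  rewrite (_ : _ - _ = a * (b - u * f)); last by ring.
  exact: idealMl.
Qed.

Lemma idadd_incl I f x : is_ideal I -> I x -> idadd I f x.
Proof. by move=> Ii Ix; exists 0; rewrite mul0r subr0. Qed.

Lemma idadd_gen I f : is_ideal I -> idadd I f f.
Proof. by move=> Ii; exists 1; rewrite mul1r subrr; apply: ideal0. Qed.

Lemma idadd_sub I f J : is_ideal J -> isub I J -> J f -> isub (idadd I f) J.
Proof. by move=> Ji IJ Jf x [u /IJ h]; apply: idealBr h _ => //; apply: idealMl. Qed.

Definition nzdiv I f := forall h, I (f * h) -> I h.

Lemma nzdivM I f g : nzdiv I f -> nzdiv I g -> nzdiv I (f * g).
Proof. by move=> hf hg h; rewrite -mulrA => /hf/hg. Qed.

Lemma nzdivX I f n : nzdiv I f -> nzdiv I (f ^+ n).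
Proof.
move=> hf; elim: n => [|n IHn]; first by move=> h; rewrite mul1r.
by rewrite exprS; apply: nzdivM.
Qed.
End IdealTheory.

Lemma prime_preim (P Q : comNzRingType) (f : {rmorphism P -> Q}) (I : Q -> Prop) :
  prime_ideal I -> prime_ideal (fun p => I (f p)).
Proof.
move=> [Ii I1 Ip]; split.
- split; first by rewrite rmorph0; apply: ideal0.
    by move=> a b ha hb; rewrite rmorphD; apply: idealD.
  by move=> a b h; rewrite rmorphM; apply: idealMl.
- by rewrite rmorph1.
- by move=> a b; rewrite rmorphM; apply: Ip.
Qed.

(** * Standard bases for a weight *)

Section Weights.
Variables (K : fieldType) (n : nat) (w : 'I_n -> nat).
Implicit Types (p q f g h u : {mpoly K[n]}) (m mu nu : 'X_{1..n}).

Definition wt m := (\sum_i m i * w i)%N.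

Lemma wtD m1 m2 : wt (m1 + m2) = (wt m1 + wt m2)%N.
Proof. by rewrite /wt -big_split; apply: eq_bigr => i _; rewrite mnmDE mulnDl. Qed.

Lemma wtU i : wt U_(i) = w i.
Proof.
rewrite /wt (bigD1 i) //= mnm1E eqxx mul1n big1 ?addn0 // => j ne.
by rewrite mnm1E eq_sym (negbTE ne).
Qed.

(** The strict bound makes [wlt 0] mean zero, so inductions on d need no convention for the weight
    of the zero polynomial. *)
Definition wlt d p := forall m, m \in msupp p -> (wt m < d)%N.

Lemma wlt_coef d p m : wlt d p -> (d <= wt m)%N -> p@_m = 0.
Proof. by move=> h le; apply/memN_msupp_eq0/negP => /h; rewrite ltnNge le. Qed.

Lemma wlt_leq d e p : (d <= e)%N -> wlt d p -> wlt e p.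
Proof. by move=> le h m /h lt; apply: leq_trans le. Qed.

Lemma wlt0 d : wlt d 0. Proof. by move=> m; rewrite msupp0. Qed.

Lemma wltD d p q : wlt d p -> wlt d q -> wlt d (p + q).
Proof. by move=> hp hq m /msuppD_le; rewrite mem_cat => /orP[/hp|/hq]. Qed.

Lemma wltN d p : wlt d p -> wlt d (- p).
Proof. by move=> hp m; rewrite (perm_mem (msuppN p)) => /hp. Qed.

Lemma wltB d p q : wlt d p -> wlt d q -> wlt d (p - q).
Proof. by move=> hp hq; apply/wltD/wltN. Qed.

Lemma wltZ d c p : wlt d p -> wlt d (c *: p).
Proof. by move=> hp m /msuppZ_le/hp. Qed.

Lemma wlt_sum d (T : Type) (r : seq T) (Q : pred T) F :
  (forall i, Q i -> wlt d (F i)) -> wlt d (\sum_(i <- r | Q i) F i).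
Proof. by move=> h; apply: (big_ind (wlt d)) => //; [exact: wlt0 | move=> x y; exact: wltD]. Qed.

Lemma wltX d m : (wt m < d)%N -> wlt d 'X_[m].
Proof. by move=> h m'; rewrite msuppX inE => /eqP ->. Qed.

Lemma wltM d e p q : wlt d.+1 p -> wlt e q -> wlt (d + e) (p * q).
Proof.
move=> hp hq m /msuppM_le /allpairsP [[m1 m2] /= [/hp h1 /hq h2 ->]].
by rewrite wtD -addnS leq_add.
Qed.

Lemma wlt0_eq0 p : wlt 0 p -> p = 0.
Proof. move=> hp; apply: msuppnil0; case e: (msupp p) => [//|m s].
by have := hp m; rewrite e mem_head => /(_ isT). Qed.

Lemma wlt_ex p : exists d, wlt d p.
Proof.
exists (\sum_(m <- msupp p) (wt m).+1)%N => m hm.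
by rewrite (big_rem m) //= leq_addr.
Qed.

Definition islead f mu := exists2 c, c != 0 & exists2 r, f = c *: 'X_[mu] + r & wlt (wt mu) r.

Lemma islead_wlt f mu : islead f mu -> wlt (wt mu).+1 f.
Proof.
move=> [c c0 [r -> hr]]; apply: wltD; first exact/wltZ/wltX.
exact: wlt_leq hr.
Qed.

Definition coprimem mu nu := forall i, mu i = 0%N \/ nu i = 0%N.

Lemma coprimem_le mu nu m : coprimem mu nu -> (nu <= m + mu)%MM -> (nu <= m)%MM.
Proof.
move=> cop /mnm_lepP h; apply/mnm_lepP => i; have := h i; rewrite mnmDE.
by case: (cop i) => ->; rewrite ?addn0.
Qed.

(* A weight is only a preorder on monomials, but [L] plays the role of the leading monomials of a
   Groebner basis of [I]: the leading monomials in use are unique of their weight. *)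
Definition std (I : {mpoly K[n]} -> Prop) (L : seq 'X_{1..n}) :=
  [/\ is_ideal I,
      forall mu, mu \in L -> exists2 f, I f & islead f mu &
      forall p d, I p -> wlt d.+1 p ->
        forall m, m \in msupp p -> wt m = d -> has (fun mu => (mu <= m)%MM) L].

Lemma std0 : std (fun p => p = 0) [::].
Proof.
split=> //; first by split=> // [a b -> ->|a b ->]; rewrite ?addr0 ?mulr0.
by move=> p d -> _ m; rewrite msupp0.
Qed.

(** One round of division: each monomial of top weight is cancelled by a multiple of an element of I
    whose leading monomial divides it, which leaves only terms of smaller weight. *)
Lemma std_reduce I L p d : std I L -> wlt d.+1 p ->
  (forall m, m \in msupp p -> wt m = d -> has (fun mu => (mu <= m)%MM) L) ->
  exists2 q, I q & wlt d (p - q).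
Proof.
move=> [Ii hL _] hp hm; rewrite (mpolyE p).
have: forall m, m \in msupp p -> (wt m < d.+1)%N /\
   (wt m = d -> has (fun mu => (mu <= m)%MM) L) by move=> m mp; split; [exact: hp|exact: hm].
elim: (msupp p) => [|m s IHs] hs.
  by exists 0; [exact: ideal0 | rewrite big_nil subrr; exact: wlt0].
have [|q Iq hq] := IHs; first by move=> m' ms; apply: hs; rewrite inE ms orbT.
have [lt hh] := hs m (mem_head _ _); rewrite ltnS leq_eqVlt in lt.
rewrite big_cons; case/orP: lt => [/eqP e | lt]; last first.
  by exists q => //; rewrite -addrA; apply: wltD => //; apply/wltZ/wltX.
case/hasP: (hh e) => mu /hL [f If [c c0 [r def_f hr]]] le.
exists ((p@_m / c) *: 'X_[m - mu] * f + q).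
  by apply: idealD => //; apply: idealMl.
rewrite opprD addrACA; apply: wltD => //.
have -> : p@_m *: 'X_[m] - (p@_m / c) *: 'X_[m - mu] * f = - (p@_m / c) *: ('X_[m - mu] * r).
  rewrite def_f mulrDr opprD addrA -!scalerAl -!scalerAr -mpolyXD submK //.
  by rewrite scalerA divfK // subrr sub0r scaleNr.
apply: wltZ; have <- : (wt (m - mu) + wt mu = d)%N by rewrite -wtD submK.
by apply: wltM => //; apply: wltX.
Qed.

(** Only products with the leading term of f reach weight d + wt mu, so multiplication by f shifts
    the top layer of u by mu, up to a nonzero constant. *)
Lemma lead_coefM f mu u d m : islead f mu -> wlt d.+1 u -> wt m = d ->
  exists2 c, c != 0 & (u * f)@_(m + mu) = c * u@_m.
Proof.
move=> [c c0 [r -> hr]] hu hm; exists c => //.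
have e : (u * 'X_[mu])@_(m + mu) = u@_m by rewrite addmC mcoeffMX.
rewrite mulrDr mcoeffD -scalerAr mcoeffZ e (@wlt_coef (d + wt mu) (u * r)) ?addr0 ?wtD ?hm //.
exact: wltM.
Qed.

(* As in the Buchberger criterion, leading monomials with disjoint supports create no new ones. *)
Lemma std_nzdiv I L f mu : std I L -> islead f mu ->
  (forall nu, nu \in L -> coprimem mu nu) -> nzdiv I f.
Proof.
move=> st lf cop h; have [d] := wlt_ex h; elim: d h => [|d IHd] h hd Ifh.
  by rewrite (wlt0_eq0 hd); case: st => /ideal0.
have [Ii hL hI] := st.
have [||q Iq hq] := @std_reduce I L h d st => //.
  move=> m mh md; have [c c0 e] := lead_coefM lf hd md.
  have : has (fun nu => (nu <= m + mu)%MM) L.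
    apply: hI (d + wt mu)%N Ifh _ _ _ _; last by rewrite wtD md.
      by rewrite mulrC -addnS; apply: wltM => //; apply: islead_wlt.
    by rewrite mcoeff_msupp mulrC e mulf_neq0 // -mcoeff_msupp.
  case/hasP => nu nuL le; apply/hasP; exists nu => //.
  exact: coprimem_le (cop _ nuL) le.
apply: (idealBr Ii (IHd _ hq _) Iq).
by rewrite mulrBr; apply: idealB => //; apply: idealMl.
Qed.

(** Write p = (p - u f) + u f with p - u f in I. As long as u f is heavier than p, its top layer is
    that of an element of I; by coprimality the top layer of u is then divisible by monomials of L,
    and u can be reduced modulo I. Once u f is no heavier than p, a top monomial of p comes from I
    or is a multiple of mu. *)
Lemma std_add I L f mu : std I L -> islead f mu ->
  (forall nu, nu \in L -> coprimem mu nu) -> std (idadd I f) (mu :: L).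
Proof.
move=> st lf cop; have [Ii hL hI] := st; split; first exact: idadd_ideal.
  move=> nu; rewrite inE => /orP [/eqP -> | /hL [g Ig lg]].
    by exists f => //; apply: idadd_gen.
  by exists g => //; apply: idadd_incl.
move=> p d [u Iu] hp m mp md; have [D] := wlt_ex u.
elim: D u Iu => [|D IHD] u Iu hu.
  by move: Iu; rewrite (wlt0_eq0 hu) mul0r subr0 => Ip /=; rewrite (hI _ _ Ip hp) ?orbT.
have huf : wlt (D + wt mu).+1 (u * f).
  by rewrite -addnS; apply: wltM => //; apply: islead_wlt.
have [le|lt] := leqP (D + wt mu) d.
  have [mpu|mpu] := boolP (m \in msupp (p - u * f)).
    rewrite /= (hI _ d Iu) ?orbT //; apply: wltB => //.
    exact: wlt_leq huf.
  have e : (u * f)@_m = p@_m.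
    by apply/eqP; rewrite eq_sym -subr_eq0 -mcoeffB mcoeff_eq0.
  apply/orP; left; apply: contraT => nle.
  case: lf => c c0 [r def_f hr].
  move: mp; rewrite mcoeff_msupp -e def_f mulrDr mcoeffD -scalerAr mcoeffZ.
  rewrite (@wlt_coef (D + wt mu) (u * r)) ?addr0 //; first last.
  - by rewrite md.
  - exact: wltM.
  rewrite [_@_m]memN_msupp_eq0 ?mulr0 ?eqxx //.
  apply: contra nle => /msuppM_le /allpairsP [[m1 m2] /= [_]].
  by rewrite msuppX inE => /eqP -> ->; rewrite lem_addl.
have [||q Iq hq] := @std_reduce I L u D st => //.
  move=> m' mu' mD; have [c c0 e] := lead_coefM lf hu mD.
  have : has (fun nu => (nu <= m' + mu)%MM) L.
    apply: hI (D + wt mu)%N Iu _ _ _ _; last by rewrite wtD mD.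
      by apply: wltB => //; apply: wlt_leq hp; rewrite ltnS ltnW.
    rewrite mcoeff_msupp mcoeffB (@wlt_coef d.+1 p) ?wtD ?mD // sub0r oppr_eq0 e.
    by rewrite mulf_neq0 // -mcoeff_msupp.
  case/hasP => nu nuL le; apply/hasP; exists nu => //.
  exact: coprimem_le (cop _ nuL) le.
apply: IHD hq; rewrite (_ : _ - _ = (p - u * f) + q * f); last by ring.
by apply: idealD => //; apply: idealMr.
Qed.

End Weights.

(** * A primality criterion *)

Lemma mpoly_gen_ind (K : fieldType) (n : nat) (Q : {mpoly K[n]} -> Prop) :
  (forall c, Q c%:MP) -> (forall v, Q 'X_v) ->
  (forall p q, Q p -> Q q -> Q (p + q)) -> (forall p q, Q p -> Q q -> Q (p * q)) ->
  forall p, Q p.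
Proof.
move=> QC QX QD QM p; rewrite (mpolyE p); apply: (big_ind Q) => //.
  by rewrite -mpolyC0.
move=> m _; rewrite -mul_mpolyC; apply: (QM) => //; rewrite mpolyXE_id.
apply: (big_ind Q) => [|x y|i _]; [by rewrite -mpolyC1 | exact: QM |].
elim: (m i) => [|k IHk]; first by rewrite expr0 -mpolyC1.
by rewrite exprS; apply: (QM).
Qed.

Section PrimeCriterion.
Variables (K : fieldType) (n : nat) (I : {mpoly K[n]} -> Prop) (f : {mpoly K[n]}).
Variable dep : pred 'I_n.
Implicit Types (p q g h : {mpoly K[n]}) (m mu : 'X_{1..n}).
Hypothesis Ii : is_ideal I.

Definition par g := forall m, m \in msupp g -> forall v, dep v -> m v = 0%N.

Lemma parD g h : par g -> par h -> par (g + h).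
Proof. by move=> hg hh m /msuppD_le; rewrite mem_cat => /orP[/hg|/hh]. Qed.

Lemma parN g : par g -> par (- g).
Proof. by move=> hg m; rewrite (perm_mem (msuppN g)) => /hg. Qed.

Lemma parB g h : par g -> par h -> par (g - h).
Proof. by move=> hg hh; apply/parD/parN. Qed.

Lemma parM g h : par g -> par h -> par (g * h).
Proof.
move=> hg hh m /msuppM_le /allpairsP [[m1 m2] /= [/hg h1 /hh h2 ->]] v dv.
by rewrite mnmDE h1 // h2.
Qed.

Lemma parC c : par c%:MP.
Proof. by move=> m; rewrite msuppC; case: eqP => // _; rewrite inE => /eqP -> v; rewrite mnm0E. Qed.

Lemma parX v : ~~ dep v -> par 'X_v.
Proof.
move=> nv m; rewrite msuppX inE => /eqP -> u du.
by rewrite mnm1E; case: eqP => // e; rewrite e du in nv.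
Qed.

Lemma parXn g k : par g -> par (g ^+ k).
Proof.
move=> hg; elim: k => [|k IHk]; first by rewrite expr0 -mpolyC1; apply: parC.
by rewrite exprS; apply: parM.
Qed.

Lemma par_sum (T : Type) (r : seq T) (Q : pred T) F :
  (forall i, Q i -> par (F i)) -> par (\sum_(i <- r | Q i) F i).
Proof.
move=> h; apply: (big_ind par) => //; last exact: parD.
by move=> m; rewrite msupp0.
Qed.

(** A nonzero element of I has a monomial divisible by some leading monomial, hence involving a
    variable in [dep]; so the free variables are algebraically independent modulo I. *)
Lemma std_par w L g : std w I L ->
  (forall mu, mu \in L -> exists2 v, dep v & mu v <> 0%N) -> par g -> I g -> g = 0.
Proof.
move=> [_ _ hI] hL pg Ig; have [d] := wlt_ex w g.
elim: d => [|d IHd] hd; first exact: wlt0_eq0 hd.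
apply: IHd => m mg; move: (hd m mg); rewrite ltnS leq_eqVlt => /orP [/eqP e|//].
have /hasP [mu /hL [v dv mv] /mnm_lepP/(_ v)] := hI _ _ Ig hd m mg e.
by rewrite (pg m mg v dv); lia.
Qed.

(* Modulo [I] and after inverting [f], [p] is a polynomial in the variables outside [dep]. *)
Definition frac p := exists k, exists2 g, par g & I (f ^+ k * p - g).

Hypothesis pf : par f.

Lemma frac_mod p q : I (p - q) -> frac q -> frac p.
Proof.
move=> Ipq [k [g pg Ig]]; exists k, g => //.
rewrite (_ : _ - _ = f ^+ k * (p - q) + (f ^+ k * q - g)); last by ring.
by apply: idealD => //; apply: idealMl.
Qed.

Lemma frac_par g : par g -> frac g.
Proof. by move=> pg; exists 0%N, g; rewrite // mul1r subrr; apply: ideal0. Qed.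

Lemma fracD p q : frac p -> frac q -> frac (p + q).
Proof.
move=> [k [g pg Ig]] [l [h ph Ih]]; exists (k + l)%N, (f ^+ l * g + f ^+ k * h).
  by apply: parD; apply: parM => //; apply: parXn.
rewrite (_ : _ - _ = f ^+ l * (f ^+ k * p - g) + f ^+ k * (f ^+ l * q - h)); last first.
  by rewrite exprD; ring.
by apply: idealD => //; apply: idealMl.
Qed.

Lemma fracM p q : frac p -> frac q -> frac (p * q).
Proof.
move=> [k [g pg Ig]] [l [h ph Ih]]; exists (k + l)%N, (g * h); first exact: parM.
rewrite (_ : _ - _ = f ^+ l * q * (f ^+ k * p - g) + g * (f ^+ l * q - h)); last first.
  by rewrite exprD; ring.
by apply: idealD => //; apply: idealMl.
Qed.

Lemma fracN p : frac p -> frac (- p).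
Proof. by move=> hp; rewrite -mulN1r; apply/fracM/hp/frac_par/parN; rewrite -mpolyC1; apply: parC. Qed.

Lemma fracB p q : frac p -> frac q -> frac (p - q).
Proof. by move=> hp hq; apply/fracD/fracN. Qed.

Lemma frac_sum (T : Type) (r : seq T) (Q : pred T) F :
  (forall i, Q i -> frac (F i)) -> frac (\sum_(i <- r | Q i) F i).
Proof.
move=> h; apply: (big_ind frac) => //; last exact: fracD.
by apply: frac_par => m; rewrite msupp0.
Qed.

(** Dividing by a factor h of f costs one more power of f. *)
Lemma frac_div h h' p : f = h' * h -> frac h' -> frac (h * p) -> frac p.
Proof.
move=> def_f fh' fhp; have [k [g pg Ig]] := fracM fh' fhp.
exists k.+1, g => //; move: Ig; rewrite (mulrA h') -def_f.
by rewrite mulrA -exprSr.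
Qed.

(** The quotient by I embeds in its localization at f because f is a nonzerodivisor; the other two
    hypotheses identify this localization with that of the polynomial ring in the free variables,
    which is a domain. *)
Lemma prime_criterion : nzdiv I f -> (forall g, par g -> I g -> g = 0) ->
  (forall v, frac 'X_v) -> prime_ideal I.
Proof.
move=> nzf parI fX.
have fr p : frac p.
  elim/mpoly_gen_ind: p => //; [|exact: fracD|exact: fracM].
  by move=> c; apply/frac_par/parC.
split=> //.
  by move=> /parI e; have := oner_neq0 {mpoly K[n]}; rewrite e ?eqxx // -mpolyC1; apply: parC.
move=> a b Iab; have [k [g pg Ig]] := fr a; have [l [h ph Ih]] := fr b.
have : g * h = 0.
  apply: parI; first exact: parM.
  rewrite (_ : g * h = f ^+ k * f ^+ l * (a * b)
     - (f ^+ k * a - g) * (f ^+ l * b) - g * (f ^+ l * b - h)); last by ring.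
  by do 2?apply: idealB => //; [apply: idealMl| apply: idealMr|apply: idealMl].
move/eqP; rewrite mulf_eq0 => /orP [] /eqP e.
  by left; apply: (nzdivX nzf (n := k)); move: Ig; rewrite e subr0.
by right; apply: (nzdivX nzf (n := l)); move: Ih; rewrite e subr0.
Qed.

End PrimeCriterion.

(** * The spinor ring *)

Definition mdisj (T : eqType) (s t : seq T) := all (fun v => v \notin t) s.

Section SpinorVariables.
Variable N : nat.
Implicit Types (i j : 'I_N) (k r c : bool).

(** Rows and columns are indexed by booleans so that case analysis and computation settle statements
    about entries. *)
Definition o2 (b : bool) : 'I_2 := if b then 1 else 0.

Lemma o2_inj : injective o2. Proof. by do 2!case. Qed.

Lemma o2_surj (r : 'I_2) : exists b, r = o2 b.
Proof. by case: r => [[|[|//]] h]; [exists false|exists true]; apply: val_inj. Qed.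

Definition vi i k r : 'I_(N * (2 * 2)) := mxvec_index i (mxvec_index (o2 k) (o2 r)).

Lemma mxvec_index_inj m n (i i' : 'I_m) (j j' : 'I_n) :
  mxvec_index i j = mxvec_index i' j' -> i = i' /\ j = j'.
Proof. by move/cast_ord_inj/enum_rank_inj => -[-> ->]. Qed.

Lemma vi_eq i k r i' k' r' : (vi i k r == vi i' k' r') = [&& i == i', k == k' & r == r'].
Proof.
apply/eqP/and3P => [/mxvec_index_inj [-> /mxvec_index_inj [/o2_inj -> /o2_inj ->]] //|].
by case=> /eqP -> /eqP -> /eqP ->.
Qed.

Lemma vi_surj v : exists i k r, v = vi i k r.
Proof.
case/mxvec_indexP: v => i v; case/mxvec_indexP: v => k r.
by have [[k' ->] [r' ->]] := (o2_surj k, o2_surj r); exists i, k', r'.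
Qed.

(** Inverse of [vi]. The default is never reached, by [vi_surj]; it takes its particle from v
    because ['I_N] may be empty. *)
Definition vdec (v : 'I_(N * (2 * 2))) : 'I_N * bool * bool :=
  odflt ((enum_val (cast_ord (esym (mxvec_cast N (2 * 2))) v)).1, false, false)
    [pick t : 'I_N * bool * bool | v == vi t.1.1 t.1.2 t.2].

Lemma vdecE i k r : vdec (vi i k r) = (i, k, r).
Proof.
rewrite /vdec; case: pickP => [[[i' k'] r'] /= | /(_ (i, k, r))]; last by rewrite eqxx.
by rewrite vi_eq => /and3P [/eqP -> /eqP -> /eqP ->].
Qed.

(* The spinor ring, in the variables of k_i = lambda_i x_i^T, is again [Pol N]: the variable with
   index [vi i false r] is now lambda_{i,r} and the one with index [vi i true c] is x_{i,c}.
   So [ang i j] is <ij>, [ell r c] is an entry of sum_i k_i, and [QS J] is Q_J. *)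
Definition lam r i : Pol N := 'X_(vi i false r).
Definition xx c i : Pol N := 'X_(vi i true c).
Definition ell r c : Pol N := \sum_i lam r i * xx c i.
Definition ang i j : Pol N := lam false i * lam true j - lam true i * lam false j.
Definition KS (J : {set 'I_N}) r c : Pol N := \sum_(i in J) lam r i * xx c i.
Definition QS J : Pol N := KS J false false * KS J true true - KS J false true * KS J true false.
(** For i in J this is the coefficient of [xx false i] in [QS J], which is linear in that variable
    (see [QS_linear]). *)
Definition kap J i : Pol N := lam false i * KS J true true - lam true i * KS J false true.

(** The generators are adjoined one by one because [std_add] extends a standard basis by a single
    element. *)
Definition Esp g : Pol N -> Prop :=
  idadd (idadd (idadd (idadd (idadd (fun p => p = 0)
    (ell false false)) (ell false true)) (ell true false)) (ell true true)) g.

Lemma zero_ideal : is_ideal (fun p : Pol N => p = 0).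
Proof. by split=> // [a b -> ->|a b ->]; rewrite ?addr0 ?mulr0. Qed.

Lemma Esp_ideal g : is_ideal (Esp g).
Proof. by do 5!apply: idadd_ideal; apply: zero_ideal. Qed.

Lemma Esp_gen g : Esp g g.
Proof. by apply: idadd_gen; do 4!apply: idadd_ideal; apply: zero_ideal. Qed.

Lemma Esp_ell g r c : Esp g (ell r c).
Proof.
have h0 := zero_ideal.
have h1 := idadd_ideal (ell false false) h0.
have h2 := idadd_ideal (ell false true) h1.
have h3 := idadd_ideal (ell true false) h2.
have h4 := idadd_ideal (ell true true) h3.
apply: (idadd_incl _ h4).
case: r; case: c; first exact: idadd_gen.
- by apply: (idadd_incl _ h3); apply: idadd_gen.
- by apply: (idadd_incl _ h3); apply: (idadd_incl _ h2); apply: idadd_gen.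
by apply: (idadd_incl _ h3); apply: (idadd_incl _ h2); apply: (idadd_incl _ h1); apply: idadd_gen.
Qed.

Lemma Esp_sub g I : is_ideal I -> (forall r c, I (ell r c)) -> I g -> isub (Esp g) I.
Proof. by move=> Ii Il Ig; do 5!apply: idadd_sub => //; move=> _ ->; apply: ideal0. Qed.

(** Monomials are given as lists of variables, so that disjointness of supports becomes a computable
    test on lists. *)
Definition mvs (s : seq 'I_(N * (2 * 2))) : 'X_{1..N * (2 * 2)} := (\sum_(v <- s) U_(v))%MM.

Lemma mvsE s v : mvs s v = count_mem v s.
Proof.
rewrite /mvs mnm_sumE; elim: s => [|u s IHs]; first by rewrite big_nil.
by rewrite big_cons IHs mnm1E /= eq_sym.
Qed.

Lemma mvs_coprime s t : mdisj s t -> coprimem (mvs s) (mvs t).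
Proof.
move=> /allP h v; rewrite !mvsE; have [vs|vs] := boolP (v \in s).
  by right; apply/count_memPn/h.
by left; apply/count_memPn.
Qed.

Lemma mpolyX_mvs s : 'X_[mvs s] = \prod_(v <- s) 'X_v :> Pol N.
Proof. by rewrite mprodXE. Qed.

Lemma wt_mvs w s : wt w (mvs s) = (\sum_(v <- s) w v)%N.
Proof.
rewrite /mvs; elim: s => [|v s IHs]; last by rewrite !big_cons wtD wtU IHs.
by rewrite !big_nil /wt big1 // => i _; rewrite mnm0E.
Qed.

Lemma islead_mvs w (z : CC) s (f : Pol N) : z != 0 ->
  wlt w (wt w (mvs s)) (f - z *: \prod_(v <- s) 'X_v) -> islead w f (mvs s).
Proof.
move=> c0 h; exists z => //; exists (f - z *: \prod_(v <- s) 'X_v) => //.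
by rewrite mpolyX_mvs addrC subrK.
Qed.

Lemma wlt_prodX w d s : ((\sum_(v <- s) w v)%N < d)%N -> wlt w d (\prod_(v <- s) 'X_v : Pol N).
Proof. by move=> h; rewrite -mpolyX_mvs; apply: wltX; rewrite wt_mvs. Qed.

Lemma std_Esp w g s00 s01 s10 s11 sg :
  islead w (ell false false) (mvs s00) -> islead w (ell false true) (mvs s01) ->
  islead w (ell true false) (mvs s10) -> islead w (ell true true) (mvs s11) ->
  islead w g (mvs sg) ->
  pairwise (@mdisj _) [:: sg; s11; s10; s01; s00] ->
  std w (Esp g) [seq mvs s | s <- [:: sg; s11; s10; s01; s00]].
Proof.
move=> l00 l01 l10 l11 lg.
rewrite [pairwise _ _]/= => /and5P [hg h11 h10 h01 _].
have cop s S : all (mdisj s) S ->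
    forall nu, nu \in [seq mvs s | s <- S] -> coprimem (mvs s) nu.
  by move=> /allP h _ /mapP [t tS ->]; apply/mvs_coprime/h.
have st1 := std_add (@std0 _ _ w) l00 (cop _ [::] isT).
have st2 := std_add st1 l01 (cop _ [:: _] h01).
have st3 := std_add st2 l10 (cop _ [:: _; _] h10).
have st4 := std_add st3 l11 (cop _ [:: _; _; _] h11).
exact: (std_add st4 lg (cop _ [:: _; _; _; _] hg)).
Qed.

Section Tables.
(* A weight is given by a table [T] with one row [:: w(lam_0); w(lam_1); w(x_0); w(x_1)] for each
   distinguished particle of [s] and a last row for all other particles. A triple [(a, k, r)]
   stands for the variable [vi i k r] of the particle number [a] of [s]. *)
Variables (T : seq (seq nat)) (s : seq 'I_N) (i0 : 'I_N).
Hypothesis s_uniq : uniq s.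

Definition tw (c : nat) (k r : bool) := nth 0%N (nth [::] T c) (2 * k + r).
(** For a particle outside s, [index] returns [size s], which selects the last row of the table. *)
Definition w v := let: (i, k, r) := vdec v in tw (index i s) k r.

Lemma wE i k r : w (vi i k r) = tw (index i s) k r.
Proof. by rewrite /w vdecE. Qed.

Definition sv (t : nat * bool * bool) := vi (nth i0 s t.1.1) t.1.2 t.2.

Lemma wt_sv ts : all (fun t => t.1.1 < size s)%N ts ->
  wt w (mvs (map sv ts)) = sumn [seq tw t.1.1 t.1.2 t.2 | t <- ts].
Proof.
rewrite wt_mvs big_map; elim: ts => [|t ts IHs] /=; first by rewrite big_nil.
by case/andP => ht hts; rewrite big_cons IHs // wE index_uniq.
Qed.

Lemma sv_notin t ts : (t.1.1 < size s)%N -> all (fun t => t.1.1 < size s)%N ts ->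
  t \notin ts -> sv t \notin map sv ts.
Proof.
move=> ht /allP hts; apply: contra => /mapP [u uts]; have hu := hts u uts.
case: t u uts ht hu {hts} => [[a b] c] [[a' b'] c'] /= uts ht hu /eqP.
by rewrite vi_eq nth_uniq //= => /and3P [/eqP -> /eqP -> /eqP ->].
Qed.

Lemma sv_pairwise L : all (all (fun t => t.1.1 < size s)%N) L ->
  pairwise (@mdisj _) L ->
  pairwise (@mdisj _) (map (map sv) L).
Proof.
elim: L => [//|a L IHL] /= /andP [ha /allP hL] /andP [haL hL'].
apply/andP; split; last by apply: IHL => //; apply/allP.
apply/allP => _ /mapP [b bL ->]; apply/allP => _ /mapP [t ta ->].
apply: sv_notin; [exact: (allP ha) | exact: hL | exact: (allP (allP haL b bL))].
Qed.

Lemma index_inj_lt i j : (index i s < size s)%N -> index i s = index j s -> i = j.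
Proof.
rewrite index_mem => hi e; have hj : j \in s by rewrite -index_mem -e index_mem.
by rewrite -(nth_index i0 hi) e nth_index.
Qed.

(** The range includes the row [size s] of the undistinguished particles, so this finite test
    decides dominance for every N. *)
Definition lead_ell_check r c a := all (fun d => (d == a) ||
  (tw d false r + tw d true c < tw a false r + tw a true c)%N) (iota 0 (size s).+1).

Lemma lead_ell r c a : (a < size s)%N -> lead_ell_check r c a ->
  islead w (ell r c) (mvs (map sv [:: (a, false, r); (a, true, c)])).
Proof.
move=> ha /allP h; apply: (@islead_mvs _ 1); first exact: oner_neq0.
rewrite wt_sv /= ?ha // !addn0 !big_cons big_nil mulr1 scale1r /ell /sv /=.
rewrite (bigD1 (nth i0 s a)) //= addrAC subrr add0r.
apply: wlt_sum => i ne; rewrite -[_ * _]mulr1 -mulrA.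
have -> : lam r i * (xx c i * 1) = \prod_(v <- [:: vi i false r; vi i true c]) 'X_v.
  by rewrite !big_cons big_nil.
apply: wlt_prodX; rewrite !big_cons big_nil addn0 !wE.
have /h /orP [/eqP e|//] : index i s \in iota 0 (size s).+1.
  by rewrite mem_iota add0n ltnS index_size.
case/eqP: ne; apply: (@index_inj_lt i (nth i0 s a)); by rewrite ?e ?index_uniq.
Qed.

Lemma lead_var (c : nat) k r : (c < size s)%N -> islead w ('X_(sv (c, k, r)) : Pol N) (mvs (map sv [:: (c, k, r)])).
Proof.
move=> hc; apply: (@islead_mvs _ 1); first exact: oner_neq0.
by rewrite scale1r /= big_seq1 subrr; apply: wlt0.
Qed.

Lemma lead_ang_ff a b : (a < size s)%N -> (b < size s)%N ->
  (tw a false true + tw b false false < tw a false false + tw b false true)%N ->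
  islead w (ang (nth i0 s a) (nth i0 s b)) (mvs (map sv [:: (a, false, false); (b, false, true)])).
Proof.
move=> ha hb h; apply: (@islead_mvs _ 1); first exact: oner_neq0.
rewrite wt_sv /= ?ha ?hb // !addn0 !big_cons big_nil mulr1 scale1r /ang /sv /=.
rewrite addrAC subrr add0r; apply/wltN; rewrite -[_ * _]mulr1 -mulrA.
have -> : lam true (nth i0 s a) * (lam false (nth i0 s b) * 1) =
  \prod_(v <- [:: vi (nth i0 s a) false true; vi (nth i0 s b) false false]) 'X_v.
  by rewrite !big_cons big_nil.
by apply: wlt_prodX; rewrite !big_cons big_nil addn0 !wE !index_uniq.
Qed.

Lemma lead_ang_tf a b : (a < size s)%N -> (b < size s)%N ->
  (tw a false false + tw b false true < tw a false true + tw b false false)%N ->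
  islead w (ang (nth i0 s a) (nth i0 s b)) (mvs (map sv [:: (a, false, true); (b, false, false)])).
Proof.
move=> ha hb h; apply: (@islead_mvs _ (-1)); first by rewrite oppr_eq0 oner_neq0.
rewrite wt_sv /= ?ha ?hb // !addn0 !big_cons big_nil mulr1 scaleN1r opprK /ang /sv /=.
rewrite subrK -[_ * _]mulr1 -mulrA.
have -> : lam false (nth i0 s a) * (lam true (nth i0 s b) * 1) =
  \prod_(v <- [:: vi (nth i0 s a) false false; vi (nth i0 s b) false true]) 'X_v.
  by rewrite !big_cons big_nil.
by apply: wlt_prodX; rewrite !big_cons big_nil addn0 !wE !index_uniq.
Qed.

Section Subset.
Variables (J : {set 'I_N}) (cJ : seq nat).
Hypothesis hJ : forall i, i \in J -> index i s \in cJ.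

(** The pairs (c, d) are classes of particles in the double sum for Q_J. Diagonal terms cancel, but
    c = d may be skipped only for a distinguished particle: two different particles can share the
    last row. *)
Definition lead_QS_check a b := all (fun c : nat => all (fun d : nat =>
  let W := (tw a false false + tw a true true + tw b false true + tw b true false)%N in
  ((c == d) && (c < size s)%N) ||
  ((tw c false false + tw c true false + tw d false true + tw d true true < W)%N &&
   (((c == a) && (d == b)) ||
    (tw c false false + tw c true true + tw d false true + tw d true false < W)%N))) cJ) cJ.

Lemma lead_QS a b : (a < size s)%N -> (b < size s)%N -> a != b ->
  nth i0 s a \in J -> nth i0 s b \in J -> lead_QS_check a b ->
  islead w (QS J) (mvs (map sv [:: (a, false, false); (a, true, true); (b, false, true); (b, true, false)])).
Proof.
move=> ha hb ab aJ bJ /allP h; apply: (@islead_mvs _ (-1)); first by rewrite oppr_eq0 oner_neq0.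
rewrite wt_sv /= ?ha ?hb // addn0 !big_cons big_nil mulr1 scaleN1r opprK /sv /= !addnA.
set W := (_ + _ + _ + _)%N.
pose A i j : Pol N := lam false i * (xx false i * (lam true j * xx true j)).
pose B i j : Pol N := lam false i * (xx true i * (lam true j * xx false j)).
have -> : QS J = \sum_(i in J) \sum_(j in J) (A i j - B i j).
  rewrite /QS /KS !big_distrlr -sumrB /=; apply: eq_bigr => i _.
  by rewrite -sumrB; apply: eq_bigr => j _; rewrite /A /B; ring.
set p := nth i0 s a; set q := nth i0 s b.
rewrite (_ : 'X_(vi p false false) * _ = B p q) //.
have prodE (v1 v2 v3 v4 : 'I_(N * (2 * 2))) :
  'X_v1 * ('X_v2 * ('X_v3 * 'X_v4)) = \prod_(v <- [:: v1; v2; v3; v4]) 'X_v :> Pol N.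
  by rewrite !big_cons big_nil mulr1.
have hAB i j : i \in J -> j \in J -> i != j ->
   wlt w W (A i j) /\ (~~ ((i == p) && (j == q)) -> wlt w W (B i j)).
  move=> iJ jJ ij; have /allP/(_ _ (hJ jJ)) := h _ (hJ iJ); rewrite -/W.
  case/orP => [/andP [/eqP e lt] | /andP [h1 h2]].
    by case/eqP: ij; apply: index_inj_lt.
  split; first by rewrite /A prodE; apply: wlt_prodX; rewrite !big_cons big_nil !wE addn0 !addnA.
  move=> npq; rewrite /B prodE; apply: wlt_prodX; rewrite !big_cons big_nil !wE addn0 !addnA.
  case/orP: h2 => // /andP [/eqP ea /eqP eb]; case/negP: npq.
  by rewrite -(@index_inj_lt i p) ?ea ?index_uniq // -(@index_inj_lt j q) ?eb ?index_uniq ?eqxx.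
have pq : p != q by rewrite nth_uniq.
(* On the diagonal the two products A i i and B i i coincide and cancel. *)
have hAB' i j : i \in J -> j \in J -> ~~ ((i == p) && (j == q)) -> wlt w W (A i j - B i j).
  move=> iJ jJ npq; have [-> | ij] := eqVneq i j.
    by rewrite (_ : _ - _ = 0) ?/A ?/B; [exact: wlt0 | ring].
  by have [h1 h2] := hAB i j iJ jJ ij; exact: wltB h1 (h2 npq).
have hA : wlt w W (A p q) by have [] := hAB p q aJ bJ pq.
clearbody A B; clear hAB.
rewrite (bigD1 p) //= (bigD1 q) //=.
set S1 := \sum_(_ in J | _) (A p _ - _); set S2 := \sum_(_ in J | _) _.
rewrite (_ : _ + _ = A p q + S1 + S2); last by ring.
apply: wltD; last first.
  apply: wlt_sum => i /andP [iJ ip]; apply: wlt_sum => j jJ; apply: hAB' => //.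
  by rewrite (negbTE ip).
apply: wltD => //.
by apply: wlt_sum => j /andP [jJ jq]; apply: hAB' => //; rewrite (negbTE jq) andbF.
Qed.

Definition lead_kap_check a b := all (fun c : nat =>
  let W := (tw a false true + tw b false false + tw b true true)%N in
  (c == a) || ((tw a false false + tw c false true + tw c true true < W)%N &&
     ((c == b) || (tw a false true + tw c false false + tw c true true < W)%N))) cJ.

Lemma lead_kap a b : (a < size s)%N -> (b < size s)%N -> a != b ->
  nth i0 s a \in J -> nth i0 s b \in J -> lead_kap_check a b ->
  islead w (kap J (nth i0 s a)) (mvs (map sv [:: (a, false, true); (b, false, false); (b, true, true)])).
Proof.
move=> ha hb ab aJ bJ /allP h; apply: (@islead_mvs _ (-1)); first by rewrite oppr_eq0 oner_neq0.
rewrite wt_sv /= ?ha ?hb // addn0 !big_cons big_nil mulr1 scaleN1r opprK /sv /= !addnA.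
set W := (_ + _ + _)%N.
set p := nth i0 s a; set q := nth i0 s b.
pose A j : Pol N := lam false p * (lam true j * xx true j).
pose B j : Pol N := lam true p * (lam false j * xx true j).
have -> : kap J p = \sum_(j in J) (A j - B j).
  by rewrite /kap /KS !mulr_sumr -sumrB.
rewrite (_ : 'X_(vi p false true) * _ = B q) //.
have prodE (v1 v2 v3 : 'I_(N * (2 * 2))) :
  'X_v1 * ('X_v2 * 'X_v3) = \prod_(v <- [:: v1; v2; v3]) 'X_v :> Pol N.
  by rewrite !big_cons big_nil mulr1.
have hAB j : j \in J -> j != p -> wlt w W (A j) /\ (j != q -> wlt w W (B j)).
  move=> jJ jp; have /orP [/eqP e|/andP [h1 h2]] := h _ (hJ jJ).
    by case/eqP: jp; apply: index_inj_lt; rewrite ?e ?index_uniq.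
  split; first by rewrite /A prodE; apply: wlt_prodX; rewrite !big_cons big_nil !wE addn0 !addnA index_uniq.
  move=> jq; rewrite /B prodE; apply: wlt_prodX; rewrite !big_cons big_nil !wE addn0 !addnA index_uniq //.
  by case/orP: h2 => // /eqP eb; case/eqP: jq; apply: index_inj_lt; rewrite ?eb ?index_uniq.
have qp : q != p by rewrite nth_uniq // eq_sym.
rewrite (bigD1 q) //= addrAC subrK; apply: wltD; first by have [] := hAB q bJ qp.
apply: wlt_sum => j /andP [jJ jq]; have [-> | jp] := eqVneq j p.
  by rewrite (_ : _ - _ = 0) ?/A ?/B; [exact: wlt0 | ring].
by have [h1 h2] := hAB j jJ jp; exact: wltB h1 (h2 jq).
Qed.
End Subset.

End Tables.
End SpinorVariables.

(** * Primality of the spinor ideal generated by the four relations and <pq> *)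

Section SpinorPrimes.
Variable N : nat.
Implicit Types (i j p q a b e : 'I_N) (k r c : bool).

Lemma Esp_nzdiv w (g f : Pol N) s00 s01 s10 s11 sg sf :
  islead w (ell N false false) (mvs s00) -> islead w (ell N false true) (mvs s01) ->
  islead w (ell N true false) (mvs s10) -> islead w (ell N true true) (mvs s11) ->
  islead w g (mvs sg) -> islead w f (mvs sf) ->
  pairwise (@mdisj _) [:: sf; sg; s11; s10; s01; s00] ->
  nzdiv (Esp g) f.
Proof.
move=> l00 l01 l10 l11 lg lf; rewrite pairwise_cons => /andP [hf hL].
apply: (std_nzdiv (std_Esp l00 l01 l10 l11 lg hL) lf).
by move=> nu /mapP [t tL ->]; apply: mvs_coprime; apply: (allP hf).
Qed.

(* The tables are solutions of the linear inequalities that make a chosen monomial of each generator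
   dominant. No single weight serves for all the nonzerodivisors needed. *)
Definition Tc1 := [:: [:: 0; 7; 3; 4]; [:: 4; 7; 3; 8]; [:: 6; 5; 4; 7]; [:: 7; 4; 7; 4]; [:: 8; 2; 8; 2]; [:: 5; 5; 5; 5]]%N.
Definition Tc2 := [:: [:: 2; 0; 1; 1]; [:: 0; 2; 1; 1]; [:: 4; 1; 4; 1]; [:: 3; 3; 3; 3]; [:: 1; 4; 1; 4]; [:: 2; 2; 2; 2]]%N.
Definition Tc3 := [:: [:: 0; 2; 1; 1]; [:: 2; 0; 1; 1]; [:: 4; 1; 4; 1]; [:: 3; 3; 3; 3]; [:: 1; 4; 1; 4]; [:: 2; 2; 2; 2]]%N.

(** The four relations are led by their terms at e, a, b and q. The two lambda-variables of a, and
    likewise of b and of q, are divided between a relation and a bracket, so all six leading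
    monomials are disjoint. *)
Lemma Esp_ang_nzdiv_ang p q a b e : uniq [:: p; q; a; b; e] ->
  nzdiv (Esp (ang p q)) (ang a b).
Proof.
move=> us; pose s := [:: p; q; a; b; e].
apply: (@Esp_nzdiv (w Tc1 s) _ _
  (map (sv s p) [:: (4, false, false); (4, true, false)])
  (map (sv s p) [:: (2, false, false); (2, true, true)])
  (map (sv s p) [:: (3, false, true); (3, true, false)])
  (map (sv s p) [:: (1, false, true); (1, true, true)])
  (map (sv s p) [:: (0, false, true); (1, false, false)])
  (map (sv s p) [:: (2, false, true); (3, false, false)])).
1-4: exact: lead_ell.
- exact: (@lead_ang_tf _ Tc1 s p us 0 1).
- exact: (@lead_ang_tf _ Tc1 s p us 2 3).
exact: (@sv_pairwise _ s p us [:: _; _; _; _; _; _]).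
Qed.

Lemma Esp_ang_nzdiv_lam p q a b e : uniq [:: p; q; a; b; e] ->
  nzdiv (Esp (ang p q)) (lam true p).
Proof.
move=> us; pose s := [:: p; q; a; b; e].
apply: (@Esp_nzdiv (w Tc2 s) _ _
  (map (sv s p) [:: (2, false, false); (2, true, false)])
  (map (sv s p) [:: (3, false, false); (3, true, true)])
  (map (sv s p) [:: (3, false, true); (3, true, false)])
  (map (sv s p) [:: (4, false, true); (4, true, true)])
  (map (sv s p) [:: (0, false, false); (1, false, true)])
  (map (sv s p) [:: (0, false, true)])).
1-4: exact: lead_ell.
- exact: (@lead_ang_ff _ Tc2 s p us 0 1).
- exact: (@lead_var _ Tc2 s p 0).
exact: (@sv_pairwise _ s p us [:: _; _; _; _; _; _]).
Qed.

Lemma ang_id i : ang i i = 0 :> Pol N. Proof. by rewrite /ang; ring. Qed.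
Lemma angC i j : ang i j = - ang j i :> Pol N. Proof. by rewrite /ang; ring. Qed.

(** Contracting a column of the relations with lambda_b removes the term of b, since <bb> = 0. *)
Lemma ell_elim c b : lam true b * ell N false c - lam false b * ell N true c =
  \sum_i ang i b * xx c i.
Proof.
by rewrite /ell !mulr_sumr -sumrB; apply: eq_bigr => i _; rewrite /ang; ring.
Qed.

(* Cramer's rule: the relations [ell] determine [xx c a] and [xx c b] once <ab> is inverted. *)
Lemma frac_xx (I : Pol N -> Prop) f dep h a b c :
  is_ideal I -> (forall r, I (ell N r c)) -> par dep f -> f = h * ang a b ->
  frac I f dep h ->
  (forall i, i != a -> frac I f dep (ang i b * xx c i)) -> frac I f dep (xx c a).
Proof.
move=> Ii Il pf ef fh fi. apply: (frac_div Ii ef fh).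
apply: (@frac_mod _ _ _ _ _ Ii _ (- \sum_(i | i != a) ang i b * xx c i)).
  rewrite opprK -(bigD1 a (P := predT) (F := fun i => ang i b * xx c i)) //= -ell_elim.
  by apply: idealB => //; apply: idealMl.
by apply: (fracN Ii); apply: (frac_sum Ii pf).
Qed.

(** The variable lambda_{q,0} is solved from <pq> = 0, the variables x_{a,0}, x_{b,0} from the first
    column of the relations and x_{b,1}, x_{e,1} from the second. Under [Tc3] each leading monomial
    contains exactly one of these five. *)
Lemma Esp_ang_prime p q a b e : uniq [:: p; q; a; b; e] -> prime_ideal (Esp (ang p q)).
Proof.
move=> us; pose s := [:: p; q; a; b; e].
pose dep := [pred v | v \in map (sv s p) [:: (1, false, false); (2, true, false); (3, true, false); (3, true, true); (4, true, true)]].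
(* The factors are the denominators for column 0, for column 1 and for lambda_{q,0}, in this
   order. *)
have [f def_f] : {f : Pol N | f = ang a b * ang b e * lam true p} by exists (ang a b * ang b e * lam true p).
have Ii := Esp_ideal (ang p q).
have ndep i k r : vi i k r \notin [pred v in map (sv s p) [:: (1, false, false); (2, true, false); (3, true, false); (3, true, true); (4, true, true)]] -> par dep ('X_(vi i k r) : Pol N).
  by move=> h; apply: parX.
have depE i k r : dep (vi i k r) = [|| [&& i == q, k == false & r == false],
   [&& i == a, k == true & r == false], [&& i == b, k == true & r == false],
   [&& i == b, k == true & r == true] | [&& i == e, k == true & r == true]].
  by rewrite /dep /= !inE !vi_eq.
move: (us); rewrite /= !inE !negb_or => /and5P [/and4P [pq pa pb pe] /and3P [qa qb qe] /andP [ab ae] be _].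
have plam r i : (r || (i != q)) -> par dep (lam r i : Pol N).
  move=> h; apply: parX; rewrite depE /= !andbF !orbF; apply: contraL h.
  by case/andP => /eqP -> /eqP ->; rewrite eqxx.
have pang i j : i != q -> j != q -> par dep (ang i j : Pol N).
  by move=> iq jq; apply: parB; apply: parM; apply: plam; rewrite ?iq ?jq.
have pf : par dep f.
  by rewrite def_f; apply: parM; [apply: parM; apply: pang; rewrite eq_sym | apply: plam].
have frP g : par dep g -> frac (Esp (ang p q)) f dep g by move=> h; apply: (frac_par _ Ii).
have Fang0 i j : i != q -> j != q -> frac (Esp (ang p q)) f dep (ang i j) by move=> *; apply/frP/pang.
have flam r i : frac (Esp (ang p q)) f dep (lam r i).
  have [h|] := boolP (r || (i != q)); first exact/frP/plam.
  rewrite negb_or => /andP [/negbTE -> /negPn /eqP ->] {r i}.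
  apply: (@frac_div _ _ _ _ _ Ii (lam true p) (ang a b * ang b e) _ def_f).
    by apply: (fracM Ii); apply: Fang0; rewrite eq_sym.
  apply: (@frac_mod _ _ _ _ _ Ii _ (lam false p * lam true q)).
    rewrite (_ : _ - _ = - ang p q); last by rewrite /ang; ring.
    exact: idealN Ii (Esp_gen _).
  by apply: (fracM Ii); apply/frP/plam; rewrite ?pq.
have fang i j : frac (Esp (ang p q)) f dep (ang i j).
  by apply: (fracB Ii pf); apply: (fracM Ii).
have Il := Esp_ell (ang p q).
have fx c i : ~~ dep (vi i true c) -> frac (Esp (ang p q)) f dep (xx c i).
  by move=> h; apply/frP/parX.
have F0 : frac (Esp (ang p q)) f dep (0 : Pol N) by rewrite -(ang_id p).
(* In the Cramer sum for x_c of a' the term of b' vanishes; the hypothesis says that the remaining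
   x-variables of column c are free. *)
have main c a' b' h : f = h * ang a' b' -> frac (Esp (ang p q)) f dep h ->
    (forall i, i != a' -> i != b' -> ~~ dep (vi i true c)) ->
    frac (Esp (ang p q)) f dep (xx c a').
  move=> ef fh hi; apply: (frac_xx Ii (fun r => Il r c) pf ef fh) => i ia.
  have [->|ib] := eqVneq i b'; first by rewrite ang_id mul0r; exact: F0.
  exact: (fracM Ii (fang i b') (fx c i (hi i ia ib))).
apply: (prime_criterion Ii pf).
- rewrite def_f; apply: nzdivM; first apply: nzdivM.
  + exact: Esp_ang_nzdiv_ang us.
  + apply: (@Esp_ang_nzdiv_ang p q b e a).
    by move: us; rewrite /= !inE !negb_or pq pa pb pe qa qb qe ab ae be /= => _; rewrite eq_sym ab eq_sym ae.
  + exact: Esp_ang_nzdiv_lam us.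
- move=> g pg Ig.
  have st : std (w Tc3 s) (Esp (ang p q)) [seq mvs t | t <- map (map (sv s p))
    [:: [:: (0, false, true); (1, false, false)]; [:: (4, false, true); (4, true, true)];
        [:: (3, false, true); (3, true, false)]; [:: (3, false, false); (3, true, true)];
        [:: (2, false, false); (2, true, false)]]].
    apply: std_Esp.
    1-4: exact: lead_ell.
    + exact: (@lead_ang_tf _ Tc3 s p us 0 1).
    exact: (@sv_pairwise _ s p us [:: _; _; _; _; _]).
  apply: (std_par (dep := dep) st _ pg Ig) => mu /mapP [t /mapP [u uL ->] ->].
  have /hasP [v vu vd] : has (fun v => v \in [:: (1, false, false); (2, true, false); (3, true, false); (3, true, true); (4, true, true)]) u.
    by move: u uL; apply/allP.
  exists (sv s p v); first exact: map_f.
  by rewrite mvsE => /count_memPn; rewrite map_f.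
- move=> v; have [i [k [r ->]]] := vi_surj v; case: k; last exact: flam.
  have [|/negPn] := boolP (~~ dep (vi i true r)); first exact: fx.
  rewrite depE !andbF /=.
  have neb : ang a b = - ang b a := angC a b.
  case/or4P => /andP [/eqP -> /eqP ->].
  + apply: (main _ a b (ang b e * lam true p)); [by rewrite def_f -mulrA mulrC | |].
      exact: (fracM Ii (fang _ _) (flam _ _)).
    by move=> j ja jb; rewrite depE (negbTE ja) (negbTE jb) /= !andbF.
  + apply: (main _ b a (- (ang b e * lam true p))); [by rewrite def_f neb -mulrA !mulNr mulrC | |].
      exact: (fracN Ii (fracM Ii (fang _ _) (flam _ _))).
    by move=> j jb ja; rewrite depE (negbTE ja) (negbTE jb) /= !andbF.
  + apply: (main _ b e (ang a b * lam true p)); [by rewrite def_f mulrAC | |].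
      exact: (fracM Ii (fang _ _) (flam _ _)).
    by move=> j jb je; rewrite depE (negbTE jb) (negbTE je) /= !andbF.
  + apply: (main _ e b (- (ang a b * lam true p))); [by rewrite def_f (angC b e) mulrN !mulNr mulrAC | |].
      exact: (fracN Ii (fracM Ii (fang _ _) (flam _ _))).
    by move=> j je jb; rewrite depE (negbTE jb) (negbTE je) /= !andbF.
Qed.

End SpinorPrimes.

(** * Primality of the spinor ideal generated by the four relations and Q_J *)

Section SpinorPrimesQ.
Variable N : nat.
Implicit Types (i j p q t a b e : 'I_N) (k r c : bool) (J : {set 'I_N}).

(** Rows for p, q, t in J, for a, b, e outside J, and one row for all other particles on either side
    of J; hence the classes 0, 1, 2, 6 for members of J. [Td1] and [Td2] serve the nonzerodivisors
    <ab> and [kap J p], and [Td3] the independence of the free variables. *)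
Definition Td1 := [:: [:: 2; 1; 1; 2]; [:: 5; 0; 0; 5]; [:: 6; 4; 4; 6]; [:: 1; 7; 4; 4]; [:: 4; 8; 9; 3]; [:: 6; 7; 8; 5]; [:: 4; 1; 2; 3]]%N.
Definition Td2 := [:: [:: 0; 2; 1; 1]; [:: 3; 0; 0; 3]; [:: 4; 5; 5; 4]; [:: 5; 5; 5; 5]; [:: 1; 6; 6; 1]; [:: 6; 2; 2; 6]; [:: 2; 1; 2; 1]]%N.
Definition Td3 := [:: [:: 0; 2; 2; 0]; [:: 2; 0; 0; 2]; [:: 1; 1; 1; 1]; [:: 5; 1; 5; 1]; [:: 4; 4; 4; 4]; [:: 1; 5; 1; 5]; [:: 1; 1; 1; 1]]%N.

Definition sixcond J p q t a b e :=
  uniq [:: p; q; t; a; b; e] && [&& p \in J, q \in J, t \in J, a \notin J, b \notin J & e \notin J].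

Lemma sixcond_index J p q t a b e : sixcond J p q t a b e ->
  forall i, i \in J -> index i [:: p; q; t; a; b; e] \in [:: 0; 1; 2; 6]%N.
Proof.
case/andP => _ /and5P [_ _ _ aJ /andP [bJ eJ]] i iJ /=.
case: (p == i) => //; case: (q == i) => //; case: (t == i) => //.
case: eqP => [ea|_]; first by rewrite ea iJ in aJ.
case: eqP => [ea|_]; first by rewrite ea iJ in bJ.
by case: eqP => [ea|_]; first by rewrite ea iJ in eJ.
Qed.

Lemma sixcond_rot J p q t a b e : sixcond J p q t a b e -> sixcond J p q t b e a.
Proof.
case/andP => us /and5P [pJ qJ tJ aJ /andP [bJ eJ]].
rewrite /sixcond pJ qJ tJ aJ bJ eJ !andbT.
rewrite (@perm_uniq _ _ ([:: p; q; t] ++ [:: a; b; e])) //.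
by rewrite (_ : [:: p; q; t; b; e; a] = [:: p; q; t] ++ rot 1 [:: a; b; e]) // perm_cat2l perm_rot.
Qed.

Lemma Esp_QS_nzdiv_ang J p q t a b e : sixcond J p q t a b e -> nzdiv (Esp (QS J)) (ang a b).
Proof.
move=> hs; have hJ := sixcond_index hs.
case/andP: hs => us /and5P [pJ qJ tJ _ _]; pose s := [:: p; q; t; a; b; e].
apply: (@Esp_nzdiv _ (w Td1 s) _ _
  (map (sv s p) [:: (5, false, false); (5, true, false)])
  (map (sv s p) [:: (2, false, false); (2, true, true)])
  (map (sv s p) [:: (4, false, true); (4, true, false)])
  (map (sv s p) [:: (5, false, true); (5, true, true)])
  (map (sv s p) [:: (1, false, false); (1, true, true); (2, false, true); (2, true, false)])
  (map (sv s p) [:: (3, false, true); (4, false, false)])).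
1-4: exact: lead_ell.
- exact: (@lead_QS _ Td1 s p us J [:: 0; 1; 2; 6]%N hJ 1 2).
- exact: (@lead_ang_tf _ Td1 s p us 3 4).
exact: (@sv_pairwise _ s p us [:: _; _; _; _; _; _]).
Qed.

Lemma Esp_QS_nzdiv_kap J p q t a b e : sixcond J p q t a b e -> nzdiv (Esp (QS J)) (kap J p).
Proof.
move=> hs; have hJ := sixcond_index hs.
case/andP: hs => us /and5P [pJ qJ tJ _ _]; pose s := [:: p; q; t; a; b; e].
apply: (@Esp_nzdiv _ (w Td2 s) _ _
  (map (sv s p) [:: (3, false, false); (3, true, false)])
  (map (sv s p) [:: (5, false, false); (5, true, true)])
  (map (sv s p) [:: (4, false, true); (4, true, false)])
  (map (sv s p) [:: (3, false, true); (3, true, true)])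
  (map (sv s p) [:: (1, false, false); (1, true, true); (2, false, true); (2, true, false)])
  (map (sv s p) [:: (0, false, true); (2, false, false); (2, true, true)])).
1-4: exact: lead_ell.
- exact: (@lead_QS _ Td2 s p us J [:: 0; 1; 2; 6]%N hJ 1 2).
- exact: (@lead_kap _ Td2 s p us J [:: 0; 1; 2; 6]%N hJ 0 2).
exact: (@sv_pairwise _ s p us [:: _; _; _; _; _; _]).
Qed.

Lemma QS_linear J p : p \in J -> QS J = kap J p * xx false p +
  ((\sum_(i in J | i != p) lam false i * xx false i) * KS J true true
   - KS J false true * (\sum_(i in J | i != p) lam true i * xx false i)).
Proof.
move=> pJ; rewrite /QS {1 4}/KS (bigD1 p) //= [X in _ - _ * X](bigD1 p) //= /kap.
set K11 := KS J true true; set K01 := KS J false true.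
set S0 := \sum_(i in J | _) _; set S1 := \sum_(i in J | _) _.
move: (lam false p) (lam true p) (xx false p) K11 K01 S0 S1 => x y z *.
by ring.
Qed.

(** All lambda-variables are free. Since a, b, e lie outside J, their x-variables do not occur in
    Q_J: x_{p,0} is solved first from Q_J = 0 by inverting [kap J p], and then the relations are
    solved as for <pq>. *)
Lemma Esp_QS_prime J p q t a b e : sixcond J p q t a b e -> prime_ideal (Esp (QS J)).
Proof.
move=> hs; have hJ := sixcond_index hs; have := hs.
case/andP => us /and5P [pJ qJ tJ aJ /andP [bJ eJ]]; pose s := [:: p; q; t; a; b; e].
pose D : seq (nat * bool * bool) := ([:: (0, true, false); (3, true, false); (4, true, false); (4, true, true); (5, true, true)])%N.
pose dep := [pred v | v \in map (sv s p) D].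
have [f def_f] : {f : Pol N | f = kap J p * ang a b * ang b e} by exists (kap J p * ang a b * ang b e).
have Ii := Esp_ideal (QS J).
have depE i k r : dep (vi i k r) = [|| [&& i == p, k == true & r == false],
   [&& i == a, k == true & r == false], [&& i == b, k == true & r == false],
   [&& i == b, k == true & r == true] | [&& i == e, k == true & r == true]].
  by rewrite /dep /= !inE !vi_eq.
have plam r i : par dep (lam r i : Pol N).
  by apply: parX; rewrite depE /= !andbF.
have pang i j : par dep (ang i j : Pol N) by apply: parB; apply: parM.
have pxx c i : i \in J -> c || (i != p) -> par dep (xx c i : Pol N).
  move=> iJ h; apply: parX; rewrite depE.
  have -> : (i == a) = false by apply: contraNF aJ => /eqP <-.
  have -> : (i == b) = false by apply: contraNF bJ => /eqP <-.
  have -> : (i == e) = false by apply: contraNF eJ => /eqP <-.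
  by rewrite /= orbF; case: c h => [_|/negbTE ->]; rewrite ?andbF.
have pK r : par dep (KS J r true : Pol N).
  by apply: par_sum => i iJ; apply: parM => //; apply: pxx.
have pK0 r : par dep (\sum_(i in J | i != p) lam r i * xx false i : Pol N).
  by apply: par_sum => i /andP [iJ ip]; apply: parM => //; apply: pxx.
have pkap : par dep (kap J p) by apply: parB; apply: parM.
have pf : par dep f by rewrite def_f; do 2!apply: parM => //.
have frP g : par dep g -> frac (Esp (QS J)) f dep g by move=> h; apply: (frac_par _ Ii).
have flam r i : frac (Esp (QS J)) f dep (lam r i) by apply/frP/plam.
have fang i j : frac (Esp (QS J)) f dep (ang i j) by apply/frP/pang.
have fkap : frac (Esp (QS J)) f dep (kap J p) by apply/frP/pkap.
have Il := Esp_ell (QS J).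
have fx0 : frac (Esp (QS J)) f dep (xx false p).
  apply: (@frac_div _ _ _ _ _ Ii (kap J p) (ang a b * ang b e)).
  - by rewrite def_f -mulrA [RHS]mulrC.
  - exact: (fracM Ii (fang _ _) (fang _ _)).
  apply: (@frac_mod _ _ _ _ _ Ii _ (- (QS J - kap J p * xx false p))).
    by rewrite opprK addrC subrK; apply: Esp_gen.
  apply/frP/parN; rewrite (QS_linear pJ) addrAC subrr add0r.
  by apply: parB; apply: parM.
have fx c i : ~~ dep (vi i true c) || (i == p) -> frac (Esp (QS J)) f dep (xx c i).
  case/orP => [h|/eqP ->]; first by apply/frP/parX.
  by case: c; [exact: (frP _ (pxx true p pJ isT)) | exact: fx0].
have F0 : frac (Esp (QS J)) f dep (0 : Pol N) by apply: frP => m; rewrite msupp0.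
have main c a' b' h : f = h * ang a' b' -> frac (Esp (QS J)) f dep h ->
    (forall i, i != a' -> i != b' -> ~~ dep (vi i true c) || (i == p)) ->
    frac (Esp (QS J)) f dep (xx c a').
  move=> ef fh hi; apply: (frac_xx Ii (fun r => Il r c) pf ef fh) => i ia.
  have [->|ib] := eqVneq i b'; first by rewrite ang_id mul0r; exact: F0.
  exact: (fracM Ii (fang i b') (fx c i (hi i ia ib))).
apply: (prime_criterion Ii pf).
- rewrite def_f; apply: nzdivM; first apply: nzdivM.
  + exact: Esp_QS_nzdiv_kap hs.
  + exact: Esp_QS_nzdiv_ang hs.
  + apply: (@Esp_QS_nzdiv_ang J p q t b e a).
    exact: sixcond_rot.
- move=> g pg Ig.
  have st : std (w Td3 s) (Esp (QS J)) [seq mvs u | u <- map (map (sv s p))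
    [:: [:: (1, false, false); (1, true, true); (0, false, true); (0, true, false)];
        [:: (5, false, true); (5, true, true)];
        [:: (4, false, true); (4, true, false)]; [:: (4, false, false); (4, true, true)];
        [:: (3, false, false); (3, true, false)]]].
    apply: std_Esp.
    1-4: exact: lead_ell.
    + exact: (@lead_QS _ Td3 s p us J [:: 0; 1; 2; 6]%N hJ 1 0).
    exact: (@sv_pairwise _ s p us [:: _; _; _; _; _]).
  apply: (std_par (dep := dep) st _ pg Ig) => mu /mapP [t' /mapP [u uL ->] ->].
  have /hasP [v vu vd] : has (fun v => v \in D) u by move: u uL; apply/allP.
  exists (sv s p v); first exact: map_f.
  by rewrite mvsE => /count_memPn; rewrite map_f.
- move=> v; have [i [k [r ->]]] := vi_surj v; case: k; last exact: flam.
  have [|/negPn] := boolP (~~ dep (vi i true r)); first by move=> h; apply: fx; rewrite h.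
  rewrite depE /=.
  have neb : ang a b = - ang b a := angC a b.
  case/or4P => [/andP [/eqP -> /eqP ->] //|||/orP []] /andP [/eqP -> /eqP ->].
  + apply: (main _ a b (kap J p * ang b e)); [by rewrite def_f mulrAC | |].
      exact: (fracM Ii fkap (fang _ _)).
    by move=> j ja jb; rewrite depE (negbTE ja) (negbTE jb) /= !andbF ?orbF; case: (j == p).
  + apply: (main _ b a (- (kap J p * ang b e))); [by rewrite def_f neb mulrN !mulNr mulrAC | |].
      exact: (fracN Ii (fracM Ii fkap (fang _ _))).
    by move=> j jb ja; rewrite depE (negbTE ja) (negbTE jb) /= !andbF ?orbF; case: (j == p).
  + apply: (main _ b e (kap J p * ang a b)); [exact: def_f | |].
      exact: (fracM Ii fkap (fang _ _)).
    by move=> j jb je; rewrite depE (negbTE jb) (negbTE je) /= !andbF ?orbF; case: (j == p).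
  + apply: (main _ e b (- (kap J p * ang a b))); [by rewrite def_f (angC b e) mulrN mulNr | |].
      exact: (fracN Ii (fracM Ii fkap (fang _ _))).
    by move=> j je jb; rewrite depE (negbTE jb) (negbTE je) /= !andbF ?orbF; case: (j == p).
Qed.

End SpinorPrimesQ.

(** * Toric kernels *)

Section Substitution.
Variables (K : fieldType) (n k : nat).
Implicit Types (h : 'I_n -> {mpoly K[k]}).

Lemma sub_sig h : {f : {rmorphism {mpoly K[n]} -> {mpoly K[k]}} |
  (forall c, f c%:MP = c%:MP) /\ (forall v, f 'X_v = h v)}.
Proof.
exists (mmap (@mpolyC k K) h : {rmorphism _ -> _}); split=> [c|v] /=; first exact: mmapC.
by rewrite mmapX mmap1U.
Qed.

Definition sub h : {rmorphism {mpoly K[n]} -> {mpoly K[k]}} := sval (sub_sig h).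

Lemma subX h v : sub h 'X_v = h v. Proof. exact: (svalP (sub_sig h)).2. Qed.

Lemma subC h c : sub h c%:MP = c%:MP. Proof. exact: (svalP (sub_sig h)).1. Qed.

Lemma sub_cong h h' (I : {mpoly K[k]} -> Prop) : is_ideal I ->
  (forall v, I (h v - h' v)) -> forall p, I (sub h p - sub h' p).
Proof.
move=> Ii hv; apply: mpoly_gen_ind => [c|v|p q hp hq|p q hp hq].
- by rewrite !subC subrr; apply: ideal0.
- by rewrite !subX.
- by rewrite !rmorphD opprD addrACA; apply: idealD.
rewrite !rmorphM (_ : _ - _ = (sub h p - sub h' p) * sub h q + sub h' p * (sub h q - sub h' q)).
  by apply: idealD => //; [apply: idealMr | apply: idealMl].
by rewrite mulrBl mulrBr addrA subrK.
Qed.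
End Substitution.

Lemma sub_id (K : fieldType) n (p : {mpoly K[n]}) : sub (fun v => 'X_v) p = p.
Proof.
by elim/mpoly_gen_ind: p => [c|v|p q hp hq|p q hp hq];
  rewrite ?subC ?subX ?rmorphD ?rmorphM /= ?hp ?hq.
Qed.

Lemma sub_comp (K : fieldType) n k l (h : 'I_n -> {mpoly K[k]}) (g : 'I_k -> {mpoly K[l]}) p :
  sub g (sub h p) = sub (fun v => sub g (h v)) p.
Proof.
by elim/mpoly_gen_ind: p => [c|v|p q hp hq|p q hp hq];
  rewrite ?subC ?subX ?subC ?rmorphD ?rmorphM /= ?hp ?hq.
Qed.

Section Toric.
Variables (K : fieldType) (n k : nat) (em : 'I_n -> 'X_{1..k}).
Implicit Types (m : 'X_{1..n}) (p : {mpoly K[n]}).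

Definition mtor m : 'X_{1..k} := (\sum_i em i *+ m i)%MM.

Lemma mtorD m1 m2 : mtor (m1 + m2) = (mtor m1 + mtor m2)%MM.
Proof.
apply/mnmP => j; rewrite mnmDE !mnm_sumE -big_split /=; apply: eq_bigr => i _.
by rewrite !mulmnE mnmDE mulnDr.
Qed.

Lemma mtorU i : mtor U_(i) = em i.
Proof.
apply/mnmP => j; rewrite mnm_sumE (bigD1 i) //= mulmnE mnm1E eqxx muln1 big1 ?addn0 // => i' ne.
by rewrite mulmnE mnm1E eq_sym (negbTE ne) muln0.
Qed.

Definition ptor : {rmorphism {mpoly K[n]} -> {mpoly K[k]}} := sub (fun v => 'X_[em v]).

Lemma ptorX m : ptor 'X_[m] = 'X_[mtor m].
Proof. by rewrite mpolyXE_id rmorph_prod /mtor -mprodXnE; apply: eq_bigr => i _; rewrite rmorphXn /= /ptor subX. Qed.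

Lemma ptorE p : ptor p = \sum_(m <- msupp p) p@_m *: 'X_[mtor m].
Proof.
rewrite {1}(mpolyE p) rmorph_sum; apply: eq_bigr => m _.
by rewrite -mul_mpolyC rmorphM /= ptorX -mul_mpolyC /ptor subC.
Qed.

Lemma mtor_rep_ex m : exists m', mtor m' == mtor m. Proof. by exists m. Qed.
(** A chosen monomial in the fibre of [mtor] through m; by [eq_xchoose] the choice depends on the
    fibre only. *)
Definition mrep m := xchoose (mtor_rep_ex m).

Lemma mtor_rep m : mtor (mrep m) = mtor m. Proof. exact/eqP/(xchooseP (mtor_rep_ex m)). Qed.

Lemma mrep_eq m m' : mtor m = mtor m' -> mrep m = mrep m'.
Proof. by move=> e; apply: eq_xchoose => x; rewrite e. Qed.

(** The kernel of a monomial map is spanned by binomials: if p maps to 0, its coefficients add up to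
    0 on each fibre, so replacing every monomial by the representative of its fibre gives 0, and p
    is the sum of the differences. *)
Lemma ptor_kernel (M : {mpoly K[n]} -> Prop) : is_ideal M ->
  (forall m m', mtor m = mtor m' -> M ('X_[m] - 'X_[m'])) ->
  forall p, ptor p = 0 -> M p.
Proof.
move=> Mi hM p p0.
have -> : p = \sum_(m <- msupp p) p@_m *: ('X_[m] - 'X_[mrep m]).
  have e0 : \sum_(m <- msupp p) p@_m *: 'X_[mrep m] = 0 :> {mpoly K[n]}.
    apply/mpolyP => u; rewrite mcoeff0 raddf_sum /=.
    have := congr1 (mcoeff (mtor u)) p0; rewrite ptorE mcoeff0 raddf_sum /= => e.
    (* The coefficient at u is zero unless u represents its fibre, and then it is the coefficient
       sum over that fibre. *)
    transitivity ((u == mrep u)%:R * \sum_(m <- msupp p) (p@_m *: 'X_[mtor m])@_(mtor u)); last first.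
      by rewrite e mulr0.
    rewrite mulr_sumr; apply: eq_bigr => m _; rewrite !mcoeffZ !mcoeffX mulrCA; congr (_ * _).
    rewrite -natrM mulnb; congr (_%:R); congr (nat_of_bool _).
    apply/eqP/andP => [e1 | [/eqP eu /eqP e1]]; last by rewrite eu; apply: mrep_eq.
    have e2 : mtor m = mtor u by rewrite -e1 mtor_rep.
    by rewrite -(mrep_eq e2) e1 e2 !eqxx.
  by under eq_bigr do rewrite scalerBr; rewrite sumrB e0 subr0 -mpolyE.
apply: ideal_sum => // m _; rewrite -mul_mpolyC; apply: idealMl => //.
by apply: hM; rewrite mtor_rep.
Qed.
End Toric.

Section ToricGraph.
Variables (K : fieldType) (n k : nat) (s t : 'I_n -> 'I_k).
Variables (M : {mpoly K[n]} -> Prop) (good : pred 'I_n).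
(** Variables are the edges of a bipartite graph without multiple edges, monomials are multisets of
    edges, and [mtor] records the degrees of the vertices. *)
Let em v : 'X_{1..k} := (U_(s v) + U_(t v))%MM.
Implicit Types (m : 'X_{1..n}).
Hypothesis Mi : is_ideal M.
Hypothesis st_disj : forall e e', s e != t e'.
Hypothesis st_inj : forall e e', s e = s e' -> t e = t e' -> e = e'.
(** In a ladder the edge e3 that closes an exchange may be missing. Restricting the exchanges for
    edges that are not [good] excludes these cases, and [toric_cong] treats good edges first. *)
Hypothesis swap : forall e e1 e2, s e1 = s e -> t e2 = t e ->
  good e || (~~ good e1 && ~~ good e2) ->
  exists e3, [/\ s e3 = s e2, t e3 = t e1 & M ('X_e1 * 'X_e2 - 'X_e * 'X_e3)].

Lemma mtor_s m v : mtor em m (s v) = (\sum_(e | s e == s v) m e)%N.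
Proof.
rewrite mnm_sumE [RHS]big_mkcond; apply: eq_bigr => e _.
rewrite mulmnE mnmDE !mnm1E [t e == _]eq_sym (negbTE (st_disj _ _)) addn0.
by case: eqP => _; rewrite ?mul1n ?mul0n.
Qed.

Lemma mtor_t m v : mtor em m (t v) = (\sum_(e | t e == t v) m e)%N.
Proof.
rewrite mnm_sumE [RHS]big_mkcond; apply: eq_bigr => e _.
rewrite mulmnE mnmDE !mnm1E (negbTE (st_disj _ _)) add0n.
by case: eqP => _; rewrite ?mul1n ?mul0n.
Qed.

Lemma mtor_deg m : mdeg (mtor em m) = (2 * mdeg m)%N.
Proof.
rewrite mdeg_sum mdegE big_distrr /=; apply: eq_bigr => i _.
by rewrite mdegMn mdegD !mdeg1.
Qed.

Lemma mtor_edge m m' e : mtor em m = mtor em m' -> m e != 0%N ->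
  exists e1 e2, [/\ s e1 = s e, t e2 = t e, m' e1 != 0%N & m' e2 != 0%N].
Proof.
move=> emm me.
have ex (T : 'I_n -> 'I_k) : (\sum_(x | T x == T e) m x)%N = (\sum_(x | T x == T e) m' x)%N ->
    exists2 x, T x = T e & m' x != 0%N.
  move=> h; have : (\sum_(x | T x == T e) m' x)%N != 0%N.
    by rewrite -h (bigD1 e) //= addn_eq0 (negbTE me).
  rewrite sum_nat_eq0 => /forallPn [x]; rewrite negb_imply => /andP [/eqP h1 h2].
  by exists x.
have [|e1 h1 h2] := ex s; first by rewrite -!mtor_s emm.
have [|e2 h3 h4] := ex t; first by rewrite -!mtor_t emm.
by exists e1, e2.
Qed.

Lemma mnm_split m e : m e != 0%N -> exists m', m = (U_(e) + m')%MM.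
Proof. by rewrite -lep1mP => h; exists (m - U_(e))%MM; rewrite addmC submK. Qed.

(* Exchange argument: a swap brings the edge [e] of [m] into [m'], and then it cancels. *)
Lemma toric_step m m' e :
  (forall m1 m2, (mdeg m1 < mdeg m)%N -> mtor em m1 = mtor em m2 -> M ('X_[m1] - 'X_[m2])) ->
  mtor em m = mtor em m' -> m e != 0%N ->
  (good e \/ forall e', m' e' != 0%N -> ~~ good e') -> M ('X_[m] - 'X_[m']).
Proof.
move=> IH emm me hgood.
suff [m2 Mm2 em2] : exists2 m2, M ('X_[U_(e) + m2] - 'X_[m']) & mtor em (U_(e) + m2) = mtor em m'.
  rewrite -(subrK 'X_[U_(e) + m2] 'X_[m]) -addrA; apply: idealD => //.
  have [m1 em1] := mnm_split me; rewrite em1 !mpolyXD -mulrBr; apply: idealMl => //.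
  apply: IH; first by rewrite em1 mdegD mdeg1.
  by move: emm; rewrite -em2 em1 !mtorD => /addmI.
have [e1 [e2 [se1 te2 m1 m2]]] := mtor_edge emm me.
have [e12|ne12] := eqVneq e1 e2.
  have ee1 : e1 = e by apply: st_inj; rewrite // e12.
  have [m3 em3] := mnm_split m1; exists m3; rewrite -?ee1 -em3 //.
  by rewrite subrr; apply: ideal0.
have [m3 em3] := mnm_split m1.
have [m4 em4] : exists m4, m3 = (U_(e2) + m4)%MM.
  by apply: mnm_split; move: m2; rewrite em3 mnmDE mnm1E (negbTE ne12).
have [|e3 [se3 te3 Me3]] := swap se1 te2.
  by case: hgood => [->//|h]; rewrite !h ?orbT.
exists (U_(e3) + m4)%MM; last first.
  rewrite em3 em4 !mtorD !mtorU !addmA; congr (_ + _)%MM; apply/mnmP => j.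
  by rewrite !mnmDE se3 te3 se1 te2; ring.
rewrite em3 em4 !addmA mpolyXD [X in _ - X]mpolyXD -mulrBl; apply: idealMr => //.
by rewrite !mpolyXD -opprB; apply: idealN.
Qed.

(** Induction on the degree. A good edge of m or of m' is cancelled first; if neither has one, any
    edge of m will do, since the exchange then involves only edges that are not good. *)
Lemma toric_cong m m' : mtor em m = mtor em m' -> M ('X_[m] - 'X_[m']).
Proof.
move: {-1}(mdeg m) (erefl (mdeg m)) => d; elim/ltn_ind: d m m' => d IH m m' dm emm.
have dm' : mdeg m' = d by move: (congr1 mdeg emm); rewrite !mtor_deg dm; lia.
have [d0|d0] := posnP d.
  move: dm dm'; rewrite d0 => /eqP; rewrite mdeg_eq0 => /eqP -> /eqP; rewrite mdeg_eq0 => /eqP ->.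
  by rewrite subrr; apply: ideal0.
have IHm : forall m1 m2, (mdeg m1 < d)%N -> mtor em m1 = mtor em m2 -> M ('X_[m1] - 'X_[m2]).
  by move=> m1 m2 lt; apply: IH lt _ _ erefl.
have [/existsP [e /andP [ge me]]|ng] := boolP [exists e, good e && (m e != 0%N)].
  by apply: (toric_step (e := e)) => //; [rewrite dm | left].
have [/existsP [e /andP [ge me]]|ng'] := boolP [exists e, good e && (m' e != 0%N)].
  by rewrite -opprB; apply: idealN => //; apply: (toric_step (e := e)) => //; [rewrite dm' | left].
have [e me] : exists e, m e != 0%N.
  apply/existsP; apply: contraT => /existsPn h; move: d0; rewrite -dm mdegE big1 // => i _.
  by apply/eqP/negPn/h.
apply: (toric_step (e := e)) => //; first by rewrite dm.
by right=> e' me'; move/existsPn: ng' => /(_ e'); rewrite me' andbT.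
Qed.

Lemma toric_kernel p : ptor K em p = 0 -> M p.
Proof. by apply: ptor_kernel => //; apply: toric_cong. Qed.
End ToricGraph.

(** * Momenta and minors *)

Lemma det2 (R : comNzRingType) (A : 'M[R]_2) : \det A = A 0 0 * A 1 1 - A 0 1 * A 1 0.
Proof.
rewrite (expand_det_row _ 0) !big_ord_recl big_ord0 addr0 /cofactor !det_mx11 !mxE /=.
rewrite (_ : lift 0 0 = 1); last exact: val_inj.
rewrite (_ : lift 1 0 = 0); last exact: val_inj.
by rewrite expr0 expr1 mul1r mulN1r mulrN.
Qed.

Section Momenta.
Variable N : nat.
Implicit Types (i j t u : 'I_N) (k r c e f tr : bool) (I : Pol N -> Prop).

Definition kv i r c : Pol N := 'X_(vi i r c).

Lemma kmatE i r c : kmat i (o2 r) (o2 c) = kv i r c. Proof. by rewrite mxE. Qed.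

Lemma QiE i : Qi i = kv i false false * kv i true true - kv i false true * kv i true false.
Proof. by rewrite /Qi det2 -!kmatE. Qed.

Definition kS (J : {set 'I_N}) r c := \sum_(i in J) kv i r c.
Definition kT r c := \sum_i kv i r c.

Lemma kSE J r c : kJ J (o2 r) (o2 c) = kS J r c.
Proof. by rewrite /kJ summxE; apply: eq_bigr => i _; rewrite kmatE. Qed.

Lemma kTE r c : (\sum_(i < N) kmat i) (o2 r) (o2 c) = kT r c.
Proof. by rewrite summxE; apply: eq_bigr => i _; rewrite kmatE. Qed.

Lemma QJE J : QJ J = kS J false false * kS J true true - kS J false true * kS J true false.
Proof. by rewrite /QJ det2 -!kSE. Qed.

(* the ideals of R_N, seen as ideals of the polynomial ring *)
Definition Rideal I := [/\ is_ideal I, forall r c, I (kT r c) & forall i, I (Qi i)].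

Lemma Rideal_ideal I : Rideal I -> is_ideal I. Proof. by case. Qed.

Lemma Rgen_Rideal (G : Pol N -> Prop) : Rideal (Rgen G).
Proof.
split; first exact: ideal_gen_ideal.
  by move=> r c; apply: ideal_gen_incl; left; left; exists (o2 r), (o2 c); rewrite kTE.
by move=> i; apply: ideal_gen_incl; left; right; exists i.
Qed.

Lemma Rgen_incl (G : Pol N -> Prop) x : G x -> Rgen G x.
Proof. by move=> Gx; apply: ideal_gen_incl; right. Qed.

Lemma Rgen_sub (G : Pol N -> Prop) I : Rideal I -> isub G I -> isub (Rgen G) I.
Proof.
move=> [Ii IT IQ] GI; apply: ideal_gen_sub => // x [[[r [c ->]]|[i ->]]|/GI //]; last exact: IQ.
by have [[r' ->] [c' ->]] := (o2_surj r, o2_surj c); rewrite kTE.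
Qed.

Lemma RprimeE I : Rprime I <-> prime_ideal I /\ Rideal I.
Proof.
split=> -[Ip h]; split=> //; last exact: Rgen_sub.
have [_ hT hQ] := Rgen_Rideal (fun _ => False).
by split; [case: Ip | move=> r c; apply: h | move=> i; apply: h].
Qed.

Definition kt tr i r c := if tr then kv i c r else kv i r c.

(* [rmin false] gives the minors of the rows (k_t k_u), [rmin true] those of (k_t^T k_u^T). *)
Definition rmin tr t e u f := kt tr t false e * kt tr u true f - kt tr u false f * kt tr t true e.

Definition dep tr I (s : seq 'I_N) := forall t u e f, t \in s -> u \in s -> I (rmin tr t e u f).

Lemma rminC tr t e u f : rmin tr t e u f = - rmin tr u f t e.
Proof. by rewrite /rmin; ring. Qed.

(** A minor within a single k_t is zero or equals Q_t up to sign. *)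
Lemma rmin_diag I tr t e f : Rideal I -> I (rmin tr t e t f).
Proof.
move=> [Ii _ IQ]; have h := IQ t; rewrite QiE in h.
case: tr; case: e; case: f; rewrite /rmin /kt;
move: (kv t false false) (kv t false true) (kv t true false) (kv t true true) h;
move=> a b c d h; have h0 x : x = 0 -> I x by [move=> ->; apply: ideal0];
have h1 x : x = a * d - b * c -> I x by [move=> ->];
have h2 x : x = - (a * d - b * c) -> I x by [move=> ->; apply: idealN];
by first [apply: h0; ring | apply: h1; ring | apply: h2; ring].
Qed.

Lemma dep_sub tr I s s' : {subset s <= s'} -> dep tr I s' -> dep tr I s.
Proof. by move=> ss h t u e f /ss ts /ss us; apply: h. Qed.

Lemma dep2 tr I i j : Rideal I -> (forall e f, I (rmin tr i e j f)) -> dep tr I [:: i; j].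
Proof.
move=> RI h t u e f; rewrite !inE => /orP [/eqP ->|/eqP ->] /orP [/eqP ->|/eqP ->].
- exact: rmin_diag.
- exact: h.
- by rewrite rminC; apply: (idealN (Rideal_ideal RI)); exact: h.
exact: rmin_diag.
Qed.

(** The columns of A matter only as a set, since minors are antisymmetric; this avoids index
    arithmetic in nested block matrices. *)
Definition covers tr m (A : 'M[Pol N]_(2, m)) (s : seq 'I_N) :=
  (forall c : 'I_m, exists t e, [/\ t \in s, A 0 c = kt tr t false e & A 1 c = kt tr t true e]) /\
  (forall t e, t \in s -> exists c : 'I_m, A 0 c = kt tr t false e /\ A 1 c = kt tr t true e).

Lemma covers_kmat i : covers false (kmat i) [:: i].
Proof.
split=> [c|t e].
  have [e ->] := o2_surj c; exists i, e.
  by split; [rewrite inE | exact: (kmatE i false e) | exact: (kmatE i true e)].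
rewrite inE => /eqP ->; exists (o2 e).
by split; [exact: (kmatE i false e) | exact: (kmatE i true e)].
Qed.

Lemma covers_kmatT i : covers true (kmat i)^T [:: i].
Proof.
split=> [c|t e].
  have [e ->] := o2_surj c; exists i, e.
  by split; [rewrite inE | rewrite mxE (kmatE i e false) | rewrite mxE (kmatE i e true)].
rewrite inE => /eqP ->; exists (o2 e).
by split; [rewrite mxE (kmatE i e false) | rewrite mxE (kmatE i e true)].
Qed.

Lemma covers_row tr m n (A : 'M_(2, m)) (B : 'M_(2, n)) s s' :
  covers tr A s -> covers tr B s' -> covers tr (row_mx A B) (s ++ s').
Proof.
move=> [hA hA'] [hB hB']; split=> [c|t e].
  case: (splitP c) => c' ec.
    have -> : c = lshift n c' by apply: val_inj.
    have [t [e [ts h0 h1]]] := hA c'; by exists t, e; rewrite mem_cat ts !row_mxEl.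
  have -> : c = rshift m c' by apply: val_inj.
  by have [t [e [ts h0 h1]]] := hB c'; exists t, e; rewrite mem_cat ts orbT !row_mxEr.
rewrite mem_cat => /orP [/(hA' _ e)|/(hB' _ e)] [c [h0 h1]].
  by exists (lshift n c); rewrite !row_mxEl.
by exists (rshift m c); rewrite !row_mxEr.
Qed.

Lemma max_minors_dep tr m (A : 'M_(2, m)) s I : is_ideal I -> covers tr A s ->
  isub (max_minors A) I <-> dep tr I s.
Proof.
move=> Ii [hA hA']; split=> [h t u e f ts us | h x [c [c' [_ ->]]]].
  have [c [h0 h1]] := hA' t e ts; have [c' [h0' h1']] := hA' u f us.
  rewrite /rmin -h0 -h1 -h0' -h1'.
  case: (ltngtP c c') => [lt|gt|/val_inj ->]; first by apply: h; exists c, c'.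
    by rewrite -opprB; apply: idealN => //; apply: h; exists c', c.
  by rewrite subrr; apply: ideal0.
have [t [e [ts -> ->]]] := hA c; have [u [f [us -> ->]]] := hA c'.
exact: h.
Qed.

Lemma Rgen_dep tr m (A : 'M_(2, m)) s I : covers tr A s ->
  Rideal I -> isub (Rgen (max_minors A)) I <-> dep tr I s.
Proof.
move=> cA RI; have Ii := Rideal_ideal RI; rewrite -(max_minors_dep Ii cA).
by split=> h; [move=> x Gx; apply/h/Rgen_incl | apply: Rgen_sub].
Qed.

Lemma p_plusP i j I : Rideal I -> isub (p_plus i j) I <-> dep false I [:: i; j].
Proof. exact: (Rgen_dep (covers_row (covers_kmat i) (covers_kmat j))). Qed.

Lemma p_minusP i j I : Rideal I -> isub (p_minus i j) I <-> dep true I [:: i; j].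
Proof. exact: (Rgen_dep (covers_row (covers_kmatT i) (covers_kmatT j))). Qed.

Lemma p_plus_dep i j : dep false (p_plus i j) [:: i; j].
Proof. by apply/p_plusP => //; apply: Rgen_Rideal. Qed.

Lemma p_minus_dep i j : dep true (p_minus i j) [:: i; j].
Proof. by apply/p_minusP => //; apply: Rgen_Rideal. Qed.

End Momenta.

Section TorAB.
Variables (N : nat) (al be : 'I_N -> 'I_N).
Implicit Types (i j t u : 'I_N) (k r c e f tr : bool) (I M : Pol N -> Prop).

(** Particles with the same [al] share their lambda and those with the same [be] share their x. Both
    identities give the spinor map, a constant [al] the generic determinantal ideal, and a mixed
    pattern the ladder. *)
Definition tors v := vi (al (vdec v).1.1) false (vdec v).1.2.
Definition tort v := vi (be (vdec v).1.1) true (vdec v).2.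
Definition tor : {rmorphism Pol N -> Pol N} := ptor CC (fun v => (U_(tors v) + U_(tort v))%MM).

Lemma torE i r c : tor (kv i r c) = lam r (al i) * xx c (be i).
Proof. by rewrite /tor /ptor subX mpolyXD /tors /tort !vdecE. Qed.

Lemma tor_kernel (good : pred 'I_N) M : is_ideal M ->
  (forall i j, al i = al j -> be i = be j -> i = j) ->
  (forall i i1 i2, al i1 = al i -> be i2 = be i -> good i || (~~ good i1 && ~~ good i2) ->
    exists i3, [/\ al i3 = al i2, be i3 = be i1 &
      forall r r2 c c1, M (kv i1 r c1 * kv i2 r2 c - kv i r c * kv i3 r2 c1)]) ->
  forall p, tor p = 0 -> M p.
Proof.
move=> Mi inj sw p; apply: (@toric_kernel _ _ _ tors tort M (fun v => good (vdec v).1.1)) => //.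
- by move=> e e'; rewrite /tors /tort vi_eq andbF.
- move=> e e'; have [i [r [c ->]]] := vi_surj e; have [i' [r' [c' ->]]] := vi_surj e'.
  rewrite /tors /tort !vdecE /= => /eqP; rewrite vi_eq => /and3P [/eqP h1 _ /eqP ->] /eqP.
  by rewrite vi_eq => /and3P [/eqP h2 _ /eqP ->]; rewrite (inj _ _ h1 h2).
move=> e e1 e2; have [i [r [c ->]]] := vi_surj e.
have [i1 [r1 [c1 ->]]] := vi_surj e1; have [i2 [r2 [c2 ->]]] := vi_surj e2.
rewrite /tors /tort !vdecE /= => /eqP; rewrite vi_eq => /and3P [/eqP h1 _ /eqP ->] /eqP.
rewrite vi_eq => /and3P [/eqP h2 _ /eqP ->] h3.
have [i3 [h4 h5 h6]] := sw i i1 i2 h1 h2 h3.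
by exists (vi i3 r2 c1); rewrite !vdecE /= h4 h5; split=> //; exact: h6.
Qed.
End TorAB.

(** * Descent from the spinor ring *)

Section Selection.
Variables (K : fieldType) (n : nat) (P : pred 'X_{1..n}).
Implicit Types (p q : {mpoly K[n]}) (m : 'X_{1..n}).

Definition msel q : {mpoly K[n]} := \sum_(m <- msupp q | P m) q@_m *: 'X_[m].

Lemma msel_coef q m : (msel q)@_m = if P m then q@_m else 0.
Proof.
rewrite /msel raddf_sum /=; have [mq|mq] := boolP (m \in msupp q); last first.
  rewrite (memN_msupp_eq0 mq) if_same big_seq_cond big1 // => m' /andP [m'q _].
  by rewrite mcoeffZ mcoeffX; case: eqP => [e|_]; [rewrite e (negbTE mq) in m'q | rewrite mulr0].
rewrite big_mkcond (bigD1_seq m) ?msupp_uniq //= big1 ?addr0 => [|m' ne].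
  by case: (P m); rewrite // mcoeffZ mcoeffX eqxx mulr1.
by case: (P m'); rewrite // mcoeffZ mcoeffX (negbTE ne) mulr0.
Qed.

Lemma mselD p q : msel (p + q) = msel p + msel q.
Proof.
by apply/mpolyP => m; rewrite mcoeffD !msel_coef mcoeffD; case: (P m); rewrite ?addr0.
Qed.

Lemma mselZ c q : msel (c *: q) = c *: msel q.
Proof. by apply/mpolyP => m; rewrite mcoeffZ !msel_coef mcoeffZ; case: (P m); rewrite ?mulr0. Qed.

Lemma msel_id q : (forall m, m \in msupp q -> P m) -> msel q = q.
Proof.
move=> h; apply/mpolyP => m; rewrite msel_coef; have [mq|mq] := boolP (m \in msupp q).
  by rewrite h.
by rewrite (memN_msupp_eq0 mq) if_same.
Qed.

Lemma msel_eq0 q : (forall m, m \in msupp q -> ~~ P m) -> msel q = 0.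
Proof.
move=> h; apply/mpolyP => m; rewrite msel_coef mcoeff0; have [mq|mq] := boolP (m \in msupp q).
  by rewrite (negbTE (h _ mq)).
by rewrite (memN_msupp_eq0 mq) if_same.
Qed.

End Selection.

Section SpinorDescent.
Variable N : nat.
Implicit Types (i j t u : 'I_N) (k r c e f tr : bool) (I M : Pol N -> Prop).
Implicit Types (m : 'X_{1..N * (2 * 2)}) (p q g : Pol N).

Definition phi : {rmorphism Pol N -> Pol N} := tor id id.

Lemma phiE i r c : phi (kv i r c) = lam r i * xx c i. Proof. exact: torE. Qed.

(** Particle by particle this is the Segre embedding of P^1 x P^1, whose only equation is Q_i =
    0. *)
Lemma phi_kernel I p : is_ideal I -> (forall i, I (Qi i)) -> phi p = 0 -> I p.
Proof.
move=> Ii IQ; apply: (@tor_kernel _ id id predT) => // i _ _ -> -> _.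
exists i; split=> // r r2 c c1; have := IQ i; rewrite QiE.
case: r; case: r2; case: c; case: c1;
move: (kv i false false) (kv i false true) (kv i true false) (kv i true true);
move=> x y z w h; have h0 a : a = 0 -> I a by [move=> ->; apply: ideal0];
have h1 a : a = x * w - y * z -> I a by [move=> ->];
have h2 a : a = - (x * w - y * z) -> I a by [move=> ->; apply: idealN];
by first [apply: h0; ring | apply: h1; ring | apply: h2; ring].
Qed.

(* torus weight zero, for the torus acting by t_i on lambda_i and t_i^-1 on x_i *)
Definition bal m := [forall i, (m (vi i false false) + m (vi i false true) ==
  m (vi i true false) + m (vi i true true))%N].

Definition emid (v : 'I_(N * (2 * 2))) := (U_(tors id v) + U_(tort id v))%MM.

Lemma bal_edge i r c m : bal (U_(vi i false r) + U_(vi i true c) + m) = bal m.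
Proof.
apply: eq_forallb => j; rewrite !mnmDE !mnm1E !vi_eq /=.
by case: (i == j); case: r; case: c => //=; apply/eqP/eqP; lia.
Qed.

Lemma bal_add m1 m2 : bal m1 -> bal (m1 + m2) = bal m2.
Proof.
move=> /forallP h; apply: eq_forallb => j; rewrite !mnmDE.
by have /eqP e := h j; apply/eqP/eqP; lia.
Qed.

Lemma mnm_split2 m v v' : v != v' -> m v != 0%N -> m v' != 0%N ->
  exists m', m = (U_(v) + U_(v') + m')%MM.
Proof.
move=> ne h1 h2; have [m1 e1] := mnm_split h1.
have [|m2 e2] := @mnm_split _ m1 v'; last by exists m2; rewrite e1 e2 addmA.
by move: h2; rewrite e1 mnmDE mnm1E (negbTE ne).
Qed.

(** At each particle a balanced monomial has as many lambda-factors as x-factors; pairing them off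
    writes it as a product of images of the variables [kv i r c]. *)
Lemma bal_lift m : bal m -> exists m', mtor emid m' = m.
Proof.
move: {-1}(mdeg m) (leqnn (mdeg m)) => d; elim: d m => [|d IHd] m.
  rewrite leqn0 mdeg_eq0 => /eqP -> _; exists 0%MM; apply/mnmP => j.
  by rewrite mnm_sumE mnm0E big1 // => i _; rewrite mulmnE mnm0E muln0.
move=> hd bm; have [/eqP m0|m0] := boolP (mdeg m == 0%N).
  by apply: IHd => //; rewrite m0.
have [v mv] : exists v, m v != 0%N.
  apply/existsP; apply: contraT => /existsPn h; move: m0; rewrite mdegE big1 // => i _.
  by apply/eqP/negPn/h.
have [i [r [c [hr hc]]]] : exists i r c, m (vi i false r) != 0%N /\ m (vi i true c) != 0%N.
{ have [i [k [r ev]]] := vi_surj v; exists i; rewrite ev in mv.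
  have /eqP h := forallP bm i.
  have [f0|f0] := eqVneq (m (vi i false false)) 0%N; have [f1|f1] := eqVneq (m (vi i false true)) 0%N;
  have [f2|f2] := eqVneq (m (vi i true false)) 0%N; have [f3|f3] := eqVneq (m (vi i true true)) 0%N.
  all: try by (exists false, false; split).
  all: try by (exists false, true; split).
  all: try by (exists true, false; split).
  all: try by (exists true, true; split).
  all: by move: mv h; clear ev; case: k; case: r; rewrite ?f0 ?f1 ?f2 ?f3 //; lia. }
have [|m1 e1] := mnm_split2 _ hr hc; first by rewrite vi_eq andbF.
have [||m2 e2] := IHd m1; first by move: hd; rewrite e1 !mdegD !mdeg1; lia.
  by move: bm; rewrite e1 bal_edge.
exists (U_(vi i r c) + m2)%MM; rewrite mtorD mtorU e2 /emid /tors /tort !vdecE /= e1.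
by [].
Qed.

Lemma bal_mtor m : bal (mtor emid m).
Proof.
rewrite /mtor; apply: (big_ind bal) => [|x y hx hy|v _].
- by apply/forallP => j; rewrite !mnm0E.
- by rewrite bal_add.
have [i [r [c ->]]] := vi_surj v; rewrite /emid /tors /tort !vdecE /=.
apply/forallP => j; rewrite !mulmnE !mnmDE !mnm1E !vi_eq /=.
by case: (i == j); case: r; case: c; apply/eqP => /=; lia.
Qed.

Lemma bal_phi p m : m \in msupp (phi p) -> bal m.
Proof.
rewrite /phi /tor ptorE => /msupp_sum_le /flatten_mapP [m1 _] /msuppZ_le.
by rewrite msuppX inE => /eqP ->; apply: bal_mtor.
Qed.

Notation balp := (msel bal).

(** Monomial multiples suffice, because [msel] is linear. *)
Definition descends I g := forall m, exists2 p, I p & phi p = balp ('X_[m] * g).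

(* The projection [msel bal] to torus weight zero is the Reynolds operator of the torus. *)
Lemma spinor_descent I (G : Pol N -> Prop) p : is_ideal I -> (forall i, I (Qi i)) ->
  (forall g, G g -> descends I g) -> ideal_gen G (phi p) -> I p.
Proof.
move=> Ii IQ hG [s [hs es]].
have [p' Ip' ep'] : exists2 p', I p' & phi p' = balp (phi p).
  rewrite es; elim: s hs {es} => [|[a g] s IHs] hs.
    exists 0; [exact: ideal0 | rewrite rmorph0 big_nil msel_eq0 // => m]; by rewrite msupp0.
  have [|p1 I1 e1] := IHs; first by move=> x xs; apply: hs; right.
  have [p2 I2 e2] : exists2 p2, I p2 & phi p2 = balp (a * g).
    have Gg : G g by apply: (hs (a, g)); left.
    rewrite (mpolyE a); elim: (msupp a) => [|m l [p2 I2 e2]].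
      exists 0; [exact: ideal0 | rewrite rmorph0 big_nil mul0r msel_eq0 // => m]; by rewrite msupp0.
    have [p3 I3 e3] := hG g Gg m.
    exists ((a@_m)%:MP * p3 + p2); first exact: (idealD Ii (idealMl _ Ii I3) I2).
    rewrite big_cons mulrDl mselD -scalerAl mselZ -e3 -e2 rmorphD rmorphM /=.
    by rewrite /phi /tor /ptor subC mul_mpolyC.
  exists (p2 + p1); first exact: idealD.
  by rewrite big_cons mselD rmorphD /= e1 e2.
apply: (idealBr Ii _ Ip'); apply: phi_kernel => //.
by rewrite rmorphB /= ep' msel_id ?subrr //; apply: bal_phi.
Qed.

(** Since [phi p] is balanced, all monomials of X^m [phi p] are balanced if m is, and none is
    otherwise. *)
Lemma descends_phi I p : is_ideal I -> I p -> descends I (phi p).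
Proof.
move=> Ii Ip m; have [bm|bm] := boolP (bal m).
  have [m' em'] := bal_lift bm; exists ('X_[m'] * p); first exact: idealMl.
  rewrite rmorphM /= msel_id; first by rewrite /phi /tor ptorX em'.
  by rewrite -em' -ptorX -rmorphM => m1; apply: bal_phi.
exists 0; first exact: ideal0.
rewrite rmorph0 msel_eq0 // => m1 /msuppM_le /allpairsP [[m2 m3] /= []].
rewrite msuppX inE => /eqP -> /bal_phi bm3 ->.
by rewrite addmC bal_add.
Qed.

Lemma phi_kT r c : phi (kT N r c) = ell N r c.
Proof. by rewrite /kT rmorph_sum; apply: eq_bigr => i _; rewrite /= phiE. Qed.

Lemma phi_kS J r c : phi (kS J r c) = KS J r c.
Proof. by rewrite /kS rmorph_sum; apply: eq_bigr => i _; rewrite /= phiE. Qed.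

Lemma phi_QJ J : phi (QJ J) = QS J.
Proof. by rewrite QJE rmorphB !rmorphM /= !phi_kS. Qed.

Lemma phi_Qi i : phi (Qi i) = 0.
Proof. by rewrite QiE rmorphB !rmorphM /= !phiE; ring. Qed.

Lemma phi_rmin i c j d : phi (rmin false i c j d) = ang i j * xx c i * xx d j.
Proof. by rewrite /rmin /kt rmorphB !rmorphM /= !phiE /ang; ring. Qed.

(** To offset the lambda_i and lambda_j in <ij>, a balanced multiple must contain an x-variable of i
    and one of j. With <ij> they form the image of a row minor, and the remaining factor is
    balanced. *)
Lemma descends_ang I i j : i != j -> is_ideal I -> (forall c d, I (rmin false i c j d)) ->
  descends I (ang i j).
Proof.
(* Both terms of <ij> have the same torus weight, so the balance of this one monomial decides for
   the whole product. *)
move=> ij Ii Im m; pose mu := (m + (U_(vi i false false) + U_(vi j false true)))%MM.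
have ang_supp m1 : m1 \in msupp ('X_[m] * ang i j) -> bal m1 = bal mu.
  move=> /msuppM_le /allpairsP [[m2 m3] /= []].
  rewrite msuppX inE => /eqP -> h3 ->.
  have {h3} [r ->] : exists r, m3 = (U_(vi i false r) + U_(vi j false (~~ r)))%MM.
    move: h3; rewrite /ang /lam -!mpolyXD => /msuppB_le; rewrite mem_cat !msuppX !inE.
    by case/orP => /eqP ->; [exists false | exists true].
  apply: eq_forallb => l; rewrite /mu !mnmDE !mnm1E !vi_eq /=.
  by case: (i == l); case: (j == l); case: r => //=; apply/eqP/eqP; lia.
have [bm|bm] := boolP (bal mu); last first.
  exists 0; [exact: ideal0 | rewrite rmorph0 msel_eq0 // => m1 /ang_supp -> //].
rewrite msel_id => [|m1 /ang_supp -> //].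
have [c mc] : exists c, m (vi i true c) != 0%N.
  have /eqP := forallP bm i; rewrite /mu !mnmDE !mnm1E !vi_eq eqxx /= [j == i]eq_sym (negbTE ij) /=.
  have [h0|h0] := eqVneq (m (vi i true false)) 0%N; last by exists false.
  have [h1|h1] := eqVneq (m (vi i true true)) 0%N; last by exists true.
  by rewrite h0 h1 !addn0 ?add0n ?addn1 ?addSn ?addnS.
have [d md] : exists d, m (vi j true d) != 0%N.
  have /eqP := forallP bm j; rewrite /mu !mnmDE !mnm1E !vi_eq !eqxx /= (negbTE ij) /=.
  have [h0|h0] := eqVneq (m (vi j true false)) 0%N; last by exists false.
  have [h1|h1] := eqVneq (m (vi j true true)) 0%N; last by exists true.
  by rewrite h0 h1 !addn0 ?add0n ?addn1 ?addSn ?addnS.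
have [|m1 e1] := mnm_split2 _ mc md; first by rewrite vi_eq (negbTE ij).
have [|m2 e2] := @bal_lift m1.
  move: bm; rewrite /mu e1 (_ : (_ + _)%MM = (U_(vi i false false) + U_(vi i true c) +
    (U_(vi j false true) + U_(vi j true d) + m1))%MM) ?bal_edge //.
  by apply/mnmP => l; rewrite !mnmDE; lia.
exists ('X_[m2] * rmin false i c j d); first exact: idealMl.
rewrite rmorphM phi_rmin /= {1}/phi /tor ptorX e2 e1 !mpolyXD -/(xx c i) -/(xx d j).
by move: (ang i j) (xx c i) (xx d j) 'X_[m1] => *; ring.
Qed.

End SpinorDescent.

(** * Primes of R_N *)

Section PrimesR.
Variable N : nat.
Implicit Types (i j t u a b : 'I_N) (k r c e f tr : bool) (I p q : Pol N -> Prop) (J : {set 'I_N}).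

Lemma ieq_sym I I' : ieq I I' -> ieq I' I. Proof. by move=> h x; split; apply h. Qed.
Lemma ieq_trans I I' I'' : ieq I I' -> ieq I' I'' -> ieq I I''.
Proof. by rewrite /ieq => h h' x; rewrite h. Qed.
Lemma isub_ieq I I' : isub I I' -> isub I' I -> ieq I I'.
Proof. by move=> h h' x; split; [exact: h|exact: h']. Qed.

Lemma ideal_ieq I I' : ieq I I' -> is_ideal I -> is_ideal I'.
Proof.
move=> h Ii; split; first by apply h; apply: ideal0.
  by move=> a b ha hb; apply h; apply: idealD => //; apply h.
by move=> a b hb; apply h; apply: idealMl => //; apply h.
Qed.

Lemma prime_ieq I I' : ieq I I' -> prime_ideal I -> prime_ideal I'.
Proof.
move=> h [Ii I1 Ip]; split; first exact: ideal_ieq h Ii.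
  by move=> h1; apply: I1; apply h.
by move=> a b /(proj2 (h _))/Ip [] hx; [left|right]; apply h.
Qed.

Lemma Rprime_ieq I I' : ieq I I' -> Rprime I -> Rprime I'.
Proof. by move=> h [Ip Is]; split; [exact: prime_ieq h Ip | move=> x /Is; apply h]. Qed.

Lemma Rprime_Rideal I : Rprime I -> Rideal I. Proof. by case/RprimeE. Qed.

Lemma minprime_ieq I I' (G : Pol N -> Prop) : ieq I I' -> minprime_over I G -> minprime_over I' G.
Proof.
move=> h [Ip Is Im]; split; [exact: Rprime_ieq h Ip | by move=> x /Is; apply h |].
move=> q qp qG qI'; have e : ieq q I by apply: Im => // x /qI'; apply h.
exact: ieq_trans e h.
Qed.

Lemma preim_ideal (f : {rmorphism Pol N -> Pol N}) I : is_ideal I -> is_ideal (fun x => I (f x)).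
Proof.
move=> Ii; split; first by rewrite rmorph0; apply: ideal0.
  by move=> a b ha hb; rewrite rmorphD; apply: idealD.
by move=> a b h; rewrite rmorphM; apply: idealMl.
Qed.

Lemma preim_phi_Rideal g : Rideal (fun x => Esp g (phi N x)).
Proof.
split; first exact: preim_ideal (Esp_ideal g).
  by move=> r c; rewrite phi_kT; apply: Esp_ell.
by move=> i; rewrite phi_Qi; apply: ideal0 (Esp_ideal g).
Qed.

Lemma Esp_descent I g x : Rideal I -> descends I g -> Esp g (phi N x) -> I x.
Proof.
move=> [Ii IT IQ] dg Ex.
pose G y := (exists r c, y = ell N r c) \/ y = g.
apply: (@spinor_descent _ I G) => //.
  by move=> y [[r [c ->]] | -> //]; rewrite -phi_kT; apply: descends_phi.
apply: Esp_sub Ex; first exact: ideal_gen_ideal.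
  by move=> r c; apply: ideal_gen_incl; left; exists r, c.
by apply: ideal_gen_incl; right.
Qed.

Lemma p_plus_phi i j : i != j -> ieq (p_plus i j) (fun x => Esp (ang i j) (phi N x)).
Proof.
move=> ij; apply: isub_ieq.
  apply/(p_plusP _ _ (preim_phi_Rideal _)); apply: dep2; first exact: preim_phi_Rideal.
  move=> e f; rewrite phi_rmin; do 2!apply: (idealMr _ (Esp_ideal _)); exact: Esp_gen.
move=> x; have RI : Rideal (p_plus i j) := Rgen_Rideal _.
apply: Esp_descent => //; apply: descends_ang => //; first exact: Rideal_ideal.
by move=> c d; apply: p_plus_dep; rewrite !inE eqxx ?orbT.
Qed.

Lemma card3P J : (3 <= #|J|)%N -> exists i j t, uniq [:: i; j; t] && [&& i \in J, j \in J & t \in J].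
Proof.
rewrite cardE; have := enum_uniq J; have := mem_enum J.
case: (enum J) => [//|i [//|j [//|t s]]] hm us _; exists i, j, t.
rewrite -!hm !inE !eqxx ?orbT /= andbT.
by move: us; rewrite /= !inE !negb_or => /and4P [/and3P [-> -> _] /andP [-> _] _ _].
Qed.

Lemma p_plus_prime i j : (5 <= N)%N -> i != j -> Rprime (p_plus i j).
Proof.
move=> N5 ij; apply/RprimeE; split; last exact: Rgen_Rideal.
apply: prime_ieq (ieq_sym (p_plus_phi ij)) _; apply: prime_preim.
(* Here N >= 5 supplies the three further particles a, b, e. *)
have : (3 <= #|~: [set i; j]|)%N by have := cardsC [set i; j]; rewrite cards2 ij card_ord; lia.
case/card3P => a [b [e /andP [us]]]; rewrite !inE !negb_or => /and3P [/andP [ai aj] /andP [bi bj] /andP [ei ej]].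
apply: (@Esp_ang_prime _ i j a b e).
by rewrite 2!cons_uniq us !inE !negb_or ij ![i == _]eq_sym ![j == _]eq_sym ai aj bi bj ei ej.
Qed.

Lemma QJ_phi J : ieq (Rgen (single (QJ J))) (fun x => Esp (QS J) (phi N x)).
Proof.
apply: isub_ieq.
  by apply: (Rgen_sub (preim_phi_Rideal _)) => _ ->; rewrite phi_QJ; apply: Esp_gen.
move=> x; have RI : Rideal (Rgen (single (QJ J))) := Rgen_Rideal _.
apply: Esp_descent => //; rewrite -phi_QJ; apply: descends_phi; first exact: Rideal_ideal.
exact: Rgen_incl.
Qed.

Lemma QJ_prime J : (3 <= #|J|)%N -> (3 <= #|~: J|)%N -> Rprime (Rgen (single (QJ J))).
Proof.
move=> hJ hJc; apply/RprimeE; split; last exact: Rgen_Rideal.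
apply: prime_ieq (ieq_sym (QJ_phi J)) _; apply: prime_preim.
have [i [j [t /andP [us1 /and3P [iJ jJ tJ]]]]] := card3P hJ.
have [a [b [e /andP [us2 /and3P [aJ bJ eJ]]]]] := card3P hJc.
rewrite !in_setC in aJ bJ eJ.
apply: (@Esp_QS_prime _ J i j t a b e); rewrite /sixcond iJ jJ tJ aJ bJ eJ andbT.
rewrite -[[:: i; j; t; a; b; e]]/([:: i; j; t] ++ [:: a; b; e]) cat_uniq us1 us2 !andbT andTb.
by apply/hasPn => x; rewrite !inE => /or3P [] /eqP ->; apply/negP => /or3P [] /eqP h;
  move: aJ bJ eJ; rewrite h ?iJ ?jJ ?tJ.
Qed.

End PrimesR.

(** The products x w and y z add up to 0, and their product is (x z)(y w) = 0; hence (x w)^2 = 0. *)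
Lemma offdiag0 (F : idomainType) (x y z w : F) : x * z = 0 -> y * w = 0 ->
  (x + y) * (z + w) = 0 -> x * w = 0 /\ y * z = 0.
Proof.
move=> h1 h2; rewrite mulrDl !mulrDr h1 h2 add0r addr0 => /eqP; rewrite addr_eq0 => /eqP h3.
have h4 : x * w = 0.
  apply/eqP; rewrite -sqrf_eq0 expr2 {2}h3.
  have -> : x * w * - (y * z) = - ((x * z) * (y * w)) by ring.
  by rewrite h1 mul0r oppr0.
by split=> //; apply/eqP; rewrite -oppr_eq0 -h3 h4.
Qed.

Lemma intr_sum (F : fieldType) n (P : pred 'I_n) (f : 'I_n -> int) :
  (\sum_(i | P i) f i)%:~R = \sum_(i | P i) (f i)%:~R :> F.
Proof. exact: rmorph_sum. Qed.

Lemma sum_supp n (s : seq 'I_n) (f : 'I_n -> int) : uniq s -> (forall u, u \notin s -> f u = 0) ->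
  \sum_u f u = foldr +%R 0 (map f s).
Proof.
move=> us h; rewrite foldrE big_map [RHS]big_uniq //=.
by rewrite (bigID (mem s)) /= [X in _ + X]big1 ?addr0.
Qed.

(** * Transposition, the splitting of Q_ij, and explicit points *)

Section Structure.
Variable N : nat.
Implicit Types (i j t u a b : 'I_N) (k r c e f tr : bool) (I p q : Pol N -> Prop) (J : {set 'I_N}).

(** Transposing every k_i exchanges row and column minors, so statements about the minus sign are
    derived from those about the plus sign. *)
Definition tau : {rmorphism Pol N -> Pol N} :=
  sub (fun v => kv (vdec v).1.1 (vdec v).2 (vdec v).1.2).

Lemma tauE i r c : tau (kv i r c) = kv i c r.
Proof. by rewrite /tau subX vdecE. Qed.

Lemma tauK : involutive tau.
Proof.
move=> x; rewrite {1}/tau {1}/tau sub_comp -[RHS]sub_id.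
suff h (v : 'I_(N * (2 * 2))) : (sub (fun v => kv (vdec v).1.1 (vdec v).2 (vdec v).1.2)) (kv (vdec v).1.1 (vdec v).2 (vdec v).1.2) = 'X_v :> Pol N.
  apply/eqP; rewrite -subr_eq0; apply/eqP.
  by apply: (@sub_cong _ _ _ _ _ _ (@zero_ideal N)) => v; rewrite h subrr.
by have [i [r [c ->]]] := vi_surj v; rewrite vdecE /= subX vdecE.
Qed.

Lemma tau_kT r c : tau (kT N r c) = kT N c r.
Proof. by rewrite /kT rmorph_sum; apply: eq_bigr => i _; rewrite /= tauE. Qed.

Lemma tau_Qi i : tau (Qi i) = Qi i.
Proof. by rewrite QiE rmorphB !rmorphM /= !tauE [X in _ - X]mulrC. Qed.

Lemma tau_rmin tr i c j d : tau (rmin tr i c j d) = rmin (~~ tr) i c j d.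
Proof. by case: tr; rewrite /rmin /kt /= rmorphB !rmorphM /= !tauE. Qed.

Definition tI I x := I (tau x).

Lemma tI_Rideal I : Rideal I -> Rideal (tI I).
Proof.
move=> [Ii IT IQ]; split; first exact: preim_ideal.
  by move=> r c; rewrite /tI tau_kT.
by move=> i; rewrite /tI tau_Qi.
Qed.

Lemma tI_Rprime I : Rprime I -> Rprime (tI I).
Proof.
by case/RprimeE => Ip RI; apply/RprimeE; split; [apply: prime_preim | apply: tI_Rideal].
Qed.

Lemma tI_subr I I' : isub I (tI I') -> isub (tI I) I'.
Proof. by move=> h x /h; rewrite /tI tauK. Qed.

Lemma tI_dep tr I s : dep tr (tI I) s <-> dep (~~ tr) I s.
Proof.
by split=> h t u e f ts us; move: (h t u e f ts us); rewrite /tI tau_rmin.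
Qed.

Lemma p_minus_tau i j : ieq (p_minus i j) (tI (p_plus i j)).
Proof.
apply: isub_ieq.
  apply/p_minusP; first exact/tI_Rideal/Rgen_Rideal.
  by apply/tI_dep; apply: p_plus_dep.
apply: tI_subr; apply/p_plusP; first exact/tI_Rideal/Rgen_Rideal.
by apply/tI_dep; apply: p_minus_dep.
Qed.

Lemma p_minus_prime i j : (5 <= N)%N -> i != j -> Rprime (p_minus i j).
Proof.
move=> N5 ij; apply: Rprime_ieq (ieq_sym (p_minus_tau i j)) _.
exact: tI_Rprime (p_plus_prime N5 ij).
Qed.

(** Modulo conservation the momentum of the complement is -k_J, and a 2x2 determinant does not
    change under this sign. *)
Lemma QJ_compl I J : Rideal I -> I (QJ J) -> I (QJ (~: J)).
Proof.
move=> [Ii IT _] IJ; have kc r c : kS (~: J) r c = kT N r c - kS J r c.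
  rewrite /kT (bigID (mem J)) /= addrC addrK; apply: eq_bigl => i; by rewrite in_setC.
move: IJ; rewrite !QJE !kc; move: (kS J) (IT false false) (IT false true) (IT true false) (IT true true).
move: (kT N false false) (kT N false true) (kT N true false) (kT N true true) => x y z w S hx hy hz hw IJ.
rewrite (_ : _ - _ = x * (w - S true true) - w * S false false - y * (z - S true false)
  + z * S false true + (S false false * S true true - S false true * S true false)); last by ring.
apply: (idealD Ii _ IJ); apply: (idealD Ii _ (idealMr _ Ii hz)).
apply: (idealB Ii _ (idealMr _ Ii hy)).
exact: (idealB Ii (idealMr _ Ii hx) (idealMr _ Ii hw)).
Qed.

Lemma QJ_pair i j : i != j -> forall tr, QJ [set i; j] =
  Qi i + Qi j + (rmin tr i false j true - rmin tr i true j false).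
Proof.
move=> ij tr; rewrite QJE !QiE.
have kc r c : kS [set i; j] r c = kv i r c + kv j r c.
  by rewrite /kS big_setU1 ?inE //= big_set1.
rewrite !kc; case: tr; rewrite /rmin /kt.
all: move: (kv i false false) (kv i false true) (kv i true false) (kv i true true);
  move: (kv j false false) (kv j false true) (kv j true false) (kv j true true) => *; ring.
Qed.

Lemma dep_QJ tr I i j : i != j -> Rideal I -> dep tr I [:: i; j] -> I (QJ [set i; j]).
Proof.
move=> ij [Ii _ IQ] h; rewrite (QJ_pair ij tr).
apply: idealD => //; first exact: idealD.
by apply: idealB => //; apply: h; rewrite !inE eqxx ?orbT.
Qed.

(* In spinors, Q_ij = <ij> [ij] modulo Q_i and Q_j. *)
Lemma rminM I i j c d r s : i != j -> Rideal I -> I (QJ [set i; j]) ->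
  I (rmin false i c j d * rmin true i r j s).
Proof.
move=> ij [Ii _ IQ] IJ.
(* In spinors the two minors are <ij> x_{i,c} x_{j,d} and [ij] lambda_{i,r} lambda_{j,s}, so the
   difference lies in the kernel of [phi]. *)
suff h : I (rmin false i c j d * rmin true i r j s - kv i r c * kv j s d * QJ [set i; j]).
  by apply: (idealBr Ii h); apply: idealMl.
apply: phi_kernel => //.
have eJ : phi N (QJ [set i; j]) = ang i j * xx false i * xx true j - ang i j * xx true i * xx false j.
  have ks r' c' : KS [set i; j] r' c' = lam r' i * xx c' i + lam r' j * xx c' j.
    by rewrite /KS big_setU1 ?inE //= big_set1.
  rewrite phi_QJ /QS !ks /ang.
  move: (lam false i) (lam true i) (lam false j) (lam true j) (xx false i) (xx true i) (xx false j) (xx true j).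
  by move=> *; ring.
have er : phi N (rmin true i r j s) = lam r i * xx false i * (lam s j * xx true j)
    - lam s j * xx false j * (lam r i * xx true i).
  by rewrite /rmin /kt rmorphB !rmorphM /= !phiE.
rewrite rmorphB !rmorphM phi_rmin er eJ /= !phiE.
move: (ang i j) (lam r i) (lam s j) (xx c i) (xx d j) (xx false i) (xx true i) (xx false j) (xx true j).
by move=> *; ring.
Qed.

(** If some row minor is outside q, its product with any column minor is in q, so all column minors
    are in q. *)
Lemma QJ_split q i j : i != j -> Rprime q -> q (QJ [set i; j]) ->
  dep false q [:: i; j] \/ dep true q [:: i; j].
Proof.
move=> ij qp qJ; have Rq := Rprime_Rideal qp; have [[_ _ qm] _] := qp.
have [h|h] := classic (forall c d, q (rmin false i c j d)); first by left; apply: dep2.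
right; apply: dep2 => // e f; apply: NNPP => ne; apply: h => c d.
by have [|//] := qm _ _ (rminM c d e f ij Rq qJ).
Qed.

Section Points.
Variable y : 'I_N -> bool -> bool -> int.

Lemma ev_sig : {f : {rmorphism Pol N -> CC} | forall i r c, f (kv i r c) = (y i r c)%:~R}.
Proof.
exists (meval (fun v => (y (vdec v).1.1 (vdec v).1.2 (vdec v).2)%:~R) : {rmorphism _ -> _}) => i r c /=.
by rewrite mevalXU vdecE.
Qed.

Definition ev := sval ev_sig.

Lemma evE i r c : ev (kv i r c) = (y i r c)%:~R. Proof. exact: (svalP ev_sig). Qed.

(** The ideal of a point: an inclusion into it means that the point lies on the variety, so points
    refute inclusions between ideals. *)
Definition EI (p : Pol N) := ev p = 0.

Lemma EI_unit (p : Pol N) (z : int) : ev p = z%:~R -> z = 1 \/ z = -1 -> ~ EI p.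
Proof.
rewrite /EI => -> hz e; have := oner_neq0 CC; suff -> : (1 : CC) = 0 by rewrite eqxx.
case: hz => hz; first by rewrite -e hz.
by apply: oppr_inj; rewrite oppr0 -e hz mulrN1z.
Qed.

Definition yt tr i r c := if tr then y i c r else y i r c.
Definition ymin tr t e u f := yt tr t false e * yt tr u true f - yt tr u false f * yt tr t true e.

Lemma ev_rmin tr t e u f : ev (rmin tr t e u f) = (ymin tr t e u f)%:~R.
Proof. by case: tr; rewrite /rmin /kt rmorphB !rmorphM /= !evE /ymin /yt intrB !intrM. Qed.

Lemma EI_rmin tr t e u f : ymin tr t e u f = 0 -> EI (rmin tr t e u f).
Proof. by move=> h; rewrite /EI ev_rmin h. Qed.

Lemma ev_kS J r c : ev (kS J r c) = (\sum_(i in J) y i r c)%:~R.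
Proof. by rewrite /kS rmorph_sum (@intr_sum CC); apply: eq_bigr => i _; rewrite /= evE. Qed.

Lemma ev_QJ J : ev (QJ J) = ((\sum_(i in J) y i false false) * (\sum_(i in J) y i true true)
  - (\sum_(i in J) y i false true) * (\sum_(i in J) y i true false))%:~R.
Proof. by rewrite QJE rmorphB !rmorphM /= !ev_kS intrB !intrM. Qed.

Lemma EI_Rideal : (forall r c, \sum_i y i r c = 0) ->
  (forall i, y i false false * y i true true = y i false true * y i true false) -> Rideal EI.
Proof.
move=> hs hQ; split.
- split; first by rewrite /EI rmorph0.
    by move=> a b; rewrite /EI rmorphD => -> ->; rewrite addr0.
  by move=> a b; rewrite /EI rmorphM => ->; rewrite mulr0.
- move=> r c; rewrite /EI (_ : kT N r c = kS [set: 'I_N] r c).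
    by rewrite ev_kS (eq_bigl predT) ?hs // => i; rewrite in_setT.
  by apply: eq_bigl => i; rewrite in_setT.
by move=> i; rewrite /EI QiE rmorphB !rmorphM /= !evE -!intrM hQ subrr.
Qed.
End Points.

Section Diagonal.
Variables s t : 'I_N -> int.
Hypothesis st : forall i, s i * t i = 0.
Hypothesis s0 : \sum_i s i = 0.
Hypothesis t0 : \sum_i t i = 0.

(** At a diagonal point Q_J factors as s_J t_J, and both factors can be prescribed by choosing the
    supports of s and t. *)
Definition dpt i r c : int := if r == c then (if r then t i else s i) else 0.

Lemma dpt_Rideal : Rideal (EI dpt).
Proof.
apply: EI_Rideal => [|i]; last by rewrite /dpt /= mulr0 st.
by case; case; rewrite /dpt /= ?s0 ?t0 ?big1_eq.
Qed.

Lemma dpt_QJ J : ev dpt (QJ J) = ((\sum_(i in J) s i) * (\sum_(i in J) t i))%:~R.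
Proof. by rewrite ev_QJ /dpt /= !big1_eq mulr0 subr0. Qed.

(** The only minors of the pair that could survive are s_i t_j and s_j t_i up to sign. Hence a
    diagonal point with Q_ij = 0 lies on both varieties over Q_ij, whichever sign is considered. *)
Lemma dpt_dep tr i j : (s i + s j) * (t i + t j) = 0 -> dep tr (EI dpt) [:: i; j].
Proof.
move=> h; have [h1 h2] := offdiag0 (st i) (st j) h.
apply: dep2 => [|e f]; first exact: dpt_Rideal.
apply: EI_rmin; rewrite /ymin /yt /dpt.
by case: tr; case: e; case: f; rewrite /= ?mulr0 ?mul0r ?subrr ?sub0r ?subr0 // 1?mulrC ?h1 ?h2 ?oppr0 // mulrC ?h1 ?h2 ?oppr0.
Qed.
End Diagonal.

Section Points3.
Variables (tr : bool) (i j l : 'I_N).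
Hypothesis us : uniq [:: i; j; l].

(* k_i = E_11, k_j = E_12 and k_l = - k_i - k_j, transposed if [tr] *)
Definition pt3 u r c : int :=
  if (if tr then c else r) then 0 else
  if u == l then -1 else if u == i then (if (if tr then r else c) then 0 else 1) else
  if u == j then (if (if tr then r else c) then 1 else 0) else 0.

Lemma pt3_Rideal : Rideal (EI pt3).
Proof.
move: us; rewrite /= !inE negb_or andbT => /andP [/andP [ij il] jl].
apply: EI_Rideal => [r c|u]; last by rewrite /pt3; case: tr; rewrite /= ?mulr0 ?mul0r.
rewrite (@sum_supp _ [:: i; j; l]) //.
  rewrite /= /pt3 !eqxx (negbTE il) (negbTE jl) [j == i]eq_sym (negbTE ij).
  by case: tr; case: r; case: c => /=; lia.
move=> u; rewrite !inE !negb_or => /and3P [/negbTE ui /negbTE uj /negbTE ul].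
by rewrite /pt3 ui uj ul; case: ifP.
Qed.

Lemma pt3_dep s : dep tr (EI pt3) s.
Proof.
move=> t u e f _ _; apply: EI_rmin; rewrite /ymin /yt /pt3.
by case: tr; rewrite /= !mulr0 subrr.
Qed.

Lemma pt3_ndep s : i \in s -> j \in s -> ~ dep (~~ tr) (EI pt3) s.
Proof.
move: us; rewrite /= !inE negb_or andbT => /andP [/andP [ij il] jl] si sj h.
apply: (@EI_unit _ _ 1 _ _ (h i j false false si sj)); last by left.
rewrite ev_rmin; congr (_%:~R); rewrite /ymin /yt /pt3 !eqxx (negbTE il) (negbTE jl) [j == i]eq_sym (negbTE ij).
by case: tr => /=; lia.
Qed.
End Points3.

End Structure.

(** * Minimal primes for N >= 5 *)

Section FiveOrMore.
Variable N : nat.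
Implicit Types (i j u a b : 'I_N) (k r c e f tr : bool) (I p q : Pol N -> Prop) (J : {set 'I_N}).

Definition pp tr i j : Pol N -> Prop := if tr then p_minus i j else p_plus i j.

Lemma pp_Rideal tr i j : Rideal (pp tr i j).
Proof. by case: tr; apply: Rgen_Rideal. Qed.

Lemma ppP tr i j I : Rideal I -> isub (pp tr i j) I <-> dep tr I [:: i; j].
Proof. by case: tr; [exact: p_minusP | exact: p_plusP]. Qed.

Lemma pp_dep tr i j : dep tr (pp tr i j) [:: i; j].
Proof. by case: tr; [exact: p_minus_dep | exact: p_plus_dep]. Qed.

Lemma pp_ndep tr i j : (3 <= N)%N -> i != j -> ~ dep (~~ tr) (pp tr i j) [:: i; j].
Proof.
move=> N3 ij h.
have [l hl] : exists l, l \in ~: [set i; j].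
  by apply/card_gt0P; have := cardsC [set i; j]; rewrite cards2 ij card_ord; lia.
have us : uniq [:: i; j; l].
  by move: hl; rewrite /= !inE !negb_or ij andbT => /andP [li lj]; rewrite eq_sym li eq_sym lj.
apply: (@pt3_ndep _ tr i j l us [:: i; j]); rewrite ?inE ?eqxx ?orbT //.
have hs : isub (pp tr i j) (EI (pt3 tr i j l)).
  by apply/(ppP _ _ _ (pt3_Rideal tr us)); exact: pt3_dep.
by move=> t u e f ht hu; apply/hs/h.
Qed.

Lemma pp_nsub tr i j : (3 <= N)%N -> i != j -> ~ isub (pp (~~ tr) i j) (pp tr i j).
Proof. by move=> N3 ij /(ppP _ _ _ (pp_Rideal tr i j)); exact: pp_ndep. Qed.

Lemma Rgen_singleP I x : Rideal I -> isub (Rgen (single x)) I <-> I x.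
Proof.
move=> RI; split=> [h|Ix]; first by apply/h/Rgen_incl.
by apply: Rgen_sub => // _ ->.
Qed.

(** Every prime over x contains a member of the family and distinct members are incomparable, so the
    members are exactly the minimal primes. *)
Lemma minprime_family (T : Type) (F : T -> Pol N -> Prop) (x : Pol N) :
  (forall a : T, Rprime (F a)) -> (forall a : T, F a x) ->
  (forall q, Rprime q -> q x -> exists a : T, isub (F a) q) ->
  (forall a b : T, isub (F a) (F b) -> a = b) ->
  forall p, minprime_over p (single x) <-> exists a : T, ieq p (F a).
Proof.
move=> Fp Fx Fq Fs p; have Fsub (a : T) : isub (Rgen (single x)) (F a).
  by apply/(Rgen_singleP _ (Rprime_Rideal (Fp a))).
split=> [[pp px pm]|[a e]].
  have [a ha] := Fq p pp (px _ (Rgen_incl (erefl _))).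
  by exists a; apply: ieq_sym; apply: (pm _ (Fp a) (Fsub a) ha).
apply: (minprime_ieq (ieq_sym e)); split; [exact: Fp | exact: Fsub |].
move=> q qp qx qa; apply: isub_ieq => //.
have [b hb] := Fq q qp (qx _ (Rgen_incl (erefl _))).
by rewrite -(Fs b a) // => y /hb/qa.
Qed.

Hypothesis N5 : (5 <= N)%N.
Let N3 : (3 <= N)%N. Proof. exact: leq_trans N5. Qed.

Lemma pp_prime tr i j : i != j -> Rprime (pp tr i j).
Proof. by case: tr; [exact: p_minus_prime | exact: p_plus_prime]. Qed.

Lemma minprime_pair i j : i != j -> forall p,
  minprime_over p (single (QJ [set i; j])) <-> exists tr, ieq p (pp tr i j).
Proof.
move=> ij; apply: minprime_family => [tr|tr|q qp qQ|tr tr' h].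
- exact: pp_prime.
- exact: (dep_QJ ij (pp_Rideal tr i j) (@pp_dep tr i j)).
- have Rq := Rprime_Rideal qp.
  by have [h|h] := QJ_split ij qp qQ; [exists false | exists true]; apply/(ppP _ _ _ Rq).
have [// | ne] := eqVneq tr tr'.
have e : tr = ~~ tr' by move: ne; case: tr {h}; case: tr'.
by move: h; rewrite e => /(pp_nsub N3 ij).
Qed.

Lemma QJ_compl_minprime J p :
  minprime_over p (single (QJ J)) -> minprime_over p (single (QJ (~: J))).
Proof.
move=> [pp pQ pm]; have Rp := Rprime_Rideal pp.
have pJ : p (QJ J) := proj1 (Rgen_singleP _ Rp) pQ.
split; [exact: pp | exact: (proj2 (Rgen_singleP _ Rp) (QJ_compl Rp pJ)) |].
move=> q qp qQ; apply: (pm q qp); have Rq := Rprime_Rideal qp.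
have qJ : q (QJ (~: J)) := proj1 (Rgen_singleP _ Rq) qQ.
have := QJ_compl Rq qJ; rewrite setCK => qJ'.
exact: (proj2 (Rgen_singleP _ Rq) qJ').
Qed.

(* The point with k_i = diag(s_i, t_i) has Q_J = s_J t_J. *)
Lemma minprime_diag J p (s t : 'I_N -> int) : internal J -> minprime_over p (single (QJ J)) ->
  (forall i, s i * t i = 0) -> \sum_i s i = 0 -> \sum_i t i = 0 ->
  (\sum_(i in J) s i) * (\sum_(i in J) t i) = 0 -> isub p (EI (dpt s t)).
Proof.
move=> iJ mp st s0 t0; have RE := dpt_Rideal st s0 t0.
have pair (K : {set 'I_N}) : #|K| = 2 -> minprime_over p (single (QJ K)) ->
    (\sum_(i in K) s i) * (\sum_(i in K) t i) = 0 -> isub p (EI (dpt s t)).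
  move=> /eqP/cards2P [i [j [ij ->]]] /(minprime_pair ij) [tr e].
  rewrite !big_setU1 ?inE //= !big_set1 => h.
  move=> x /(proj1 (e _)); move: x; apply/ppP => //.
  exact: (dpt_dep st s0 t0 tr h).
move=> h; have cJ := cardsC J; rewrite card_ord in cJ.
case/andP: iJ => J2 JN.
have [c2|c2] := eqVneq #|J| 2; first exact: pair c2 mp h.
have [d2|d2] := eqVneq #|~: J| 2.
  apply: (pair _ d2 (QJ_compl_minprime mp)).
  have cs (f : 'I_N -> int) : \sum_i f i = 0 -> \sum_(i in ~: J) f i = - \sum_(i in J) f i.
    rewrite (bigID (mem J)) /= => /eqP; rewrite addr_eq0 => /eqP ->; rewrite opprK.
    by apply: eq_bigl => i; rewrite in_setC.
  by rewrite !cs // mulrNN.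
have J3 : (3 <= #|J|)%N by move: c2 J2; lia.
have Jc3 : (3 <= #|~: J|)%N by move: d2 JN; lia.
have QP := QJ_prime J3 Jc3.
(* The ideal (Q_J) is prime, hence its own only minimal prime: a family with one member. *)
have [[]] := proj1 (@minprime_family unit (fun _ => Rgen (single (QJ J))) (QJ J)
  (fun _ => QP) (fun _ => Rgen_incl (erefl _))
  (fun q qp qQ => ex_intro _ tt (proj2 (Rgen_singleP _ (Rprime_Rideal qp)) qQ))
  (fun a b : unit => match a, b with tt, tt => fun _ => erefl end) p) mp.
move=> e x /(proj1 (e _)); move: x; apply/Rgen_singleP => //.
by rewrite /EI (dpt_QJ s t) h.
Qed.

(** If J' is neither J nor its complement, some a in J' and c outside J' lie on the same side of J.
    With b in J' and d outside J', all four distinct, the diagonal point with s = 1 at a, -1 at c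
    and t = 1 at b, -1 at d has Q_J = 0 and Q_J' = 1; so it lies on the variety of p but not on that
    of Q_J'. *)
Lemma minprime_unique p J J' : internal J -> internal J' ->
  minprime_over p (single (QJ J)) -> minprime_over p (single (QJ J')) -> J' = J \/ J' = ~: J.
Proof.
move=> iJ iJ' mp [_ pQ' _]; apply: NNPP => ne.
have [a [c [aJ' cJ' ac]]] : exists a (c : 'I_N), [/\ a \in J', c \notin J' & (a \in J) = (c \in J)].
  apply: NNPP => nac; apply: ne.
  have [a aJ'] : exists a, a \in J'.
    by apply/card_gt0P; case/andP: iJ' => h _; apply: leq_trans h.
  have [c cJ'] : exists c : 'I_N, c \in ~: J'.
    case/andP: iJ' => _ h2; apply/card_gt0P; have h3 := cardsC J'; rewrite card_ord in h3.
    by rewrite -(ltn_add2l #|J'|) addn0 h3; apply: leq_ltn_trans h2 _; move: (N5); lia.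
  rewrite in_setC in cJ'.
  have h x y : x \in J' -> y \notin J' -> (x \in J) = ~~ (y \in J).
    move=> hx hy; case h1: (x \in J); case h2: (y \in J) => //; case: nac; exists x, y.
      by rewrite h1 h2.
    by rewrite h1 h2.
  have aJ := h a c aJ' cJ'.
  case caJ: (a \in J); rewrite caJ in aJ; [left|right]; apply/setP => x;
    rewrite ?in_setC; case xJ': (x \in J').
  - by rewrite (h x c) // -aJ.
  - by have := h a x aJ' (negbT xJ'); rewrite caJ; case: (x \in J).
  - by rewrite (h x c) // -aJ.
  - by have := h a x aJ' (negbT xJ'); rewrite caJ; case: (x \in J).
(* Second elements of J' and of its complement exist because J' is internal. *)
have [b /andP [bJ' ba]] : exists b, (b \in J') && (b != a).
  have : (0 < #|J' :\ a|)%N by case/andP: iJ' => h _; move: h; rewrite (cardsD1 a J') aJ' add1n ltnS.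
  by case/card_gt0P => b; rewrite !inE andbC; exists b.
have [d /andP [dJ' dc]] : exists d, (d \notin J') && (d != c).
  have : (0 < #|~: J' :\ c|)%N.
    case/andP: iJ' => _ h2; have h3 := cardsC J'; rewrite card_ord in h3.
    have h4 := cardsD1 c (~: J'); rewrite in_setC cJ' in h4.
    rewrite -(ltn_add2l 1) addn0 -[(1 + _)%N]h4 -(ltn_add2l #|J'|) h3.
    by apply: leq_ltn_trans (leq_add h2 (leqnn 1)) _; move: (N5); lia.
  by case/card_gt0P => d; rewrite !inE andbC; exists d.
have ne2 x y : x \in J' -> y \notin J' -> (x == y) = false.
  by move=> hx; apply: contraNF => /eqP <-.
pose g x y i : int := (i == x)%:R - (i == y)%:R.
have sg K x y : \sum_(i in K) g x y i = (x \in K)%:R - (y \in K)%:R.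
  have s1 z : \sum_(i in K) ((i == z)%:R : int) = (z \in K)%:R.
    have [zK|zK] := boolP (z \in K).
      by rewrite (bigD1 z) //= eqxx big1 ?addr0 // => i /andP [_ /negbTE ->].
    by rewrite big1 // => i iK; case: eqP => // e; rewrite -e iK in zK.
  by rewrite sumrB !s1.
have sg0 x y : \sum_i g x y i = 0.
  by rewrite (eq_bigl (mem [set: 'I_N])) ?sg ?inE ?subrr // => i; rewrite /= inE.
have gst i : g a c i * g b d i = 0.
  rewrite /g; have [->|ia] := eqVneq i a.
    by rewrite [a == b]eq_sym (negbTE ba) (ne2 a d) // subrr mulr0.
  have [->|ic] := eqVneq i c; last by rewrite subrr mul0r.
  by rewrite [c == b]eq_sym (ne2 b c) // [c == d]eq_sym (negbTE dc) subrr mulr0.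
have : isub p (EI (dpt (g a c) (g b d))).
  by apply: minprime_diag mp _ _ _ _ => //; rewrite !sg ac subrr mul0r.
move/(_ _ (pQ' _ (Rgen_incl (erefl _)))); apply: (@EI_unit _ _ _ 1); last by left.
by rewrite (dpt_QJ (g a c) (g b d)) !sg aJ' bJ' (negbTE cJ') (negbTE dJ') subr0 mulr1.
Qed.

End FiveOrMore.

(** * Minimal primes for N = 4 *)

Section ToricPrimes.
Variable N : nat.
Implicit Types (i j l m u : 'I_N) (k r c e f tr : bool) (I M p q : Pol N -> Prop).

Lemma zero_prime : prime_ideal (fun x : Pol N => x = 0).
Proof.
split; first exact: zero_ideal.
  by move/eqP; rewrite oner_eq0.
by move=> a b /eqP; rewrite mulf_eq0 => /orP [] /eqP; [left|right].
Qed.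

Definition depA tr I := forall t u e f, I (rmin tr t e u f).

Definition ksub (h : 'I_N -> bool -> bool -> Pol N) : {rmorphism Pol N -> Pol N} :=
  sub (fun v => h (vdec v).1.1 (vdec v).1.2 (vdec v).2).

Lemma ksubE h i r c : ksub h (kv i r c) = h i r c.
Proof. by rewrite /ksub subX vdecE. Qed.

Lemma ksub_id x : ksub (@kv N) x = x.
Proof.
rewrite -[RHS]sub_id; apply/eqP; rewrite -subr_eq0; apply/eqP.
apply: (@sub_cong _ _ _ _ _ _ (@zero_ideal N)) => v.
by have [i [r [c ->]]] := vi_surj v; rewrite vdecE subrr.
Qed.

Lemma ksub_cong h h' M : is_ideal M -> (forall i r c, M (h i r c - h' i r c)) ->
  forall x, M (ksub h x - ksub h' x).
Proof. by move=> Mi hh; apply: sub_cong => // v; apply: hh. Qed.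

Lemma ksub_comp h g x : ksub g (ksub h x) = ksub (fun i r c => ksub g (h i r c)) x.
Proof. exact: sub_comp. Qed.

Lemma prime_kernel (f : {rmorphism Pol N -> Pol N}) M :
  isub M (fun x => f x = 0) -> (forall x, f x = 0 -> M x) -> prime_ideal M.
Proof.
move=> h1 h2; apply: prime_ieq (prime_preim f zero_prime).
by move=> x; split; [exact: h2 | exact: h1].
Qed.

Lemma kernel_Rideal (f : {rmorphism Pol N -> Pol N}) :
  (forall r c, \sum_i f (kv i r c) = 0) ->
  (forall i, f (kv i false false) * f (kv i true true) = f (kv i false true) * f (kv i true false)) ->
  Rideal (fun x => f x = 0).
Proof.
move=> h1 h2; split; first exact: preim_ideal (@zero_ideal N).
  by move=> r c; rewrite /kT rmorph_sum -[RHS](h1 r c).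
by move=> i; rewrite QiE rmorphB !rmorphM /= h2 subrr.
Qed.

Lemma row_swap M (A B : bool -> bool -> Pol N) : is_ideal M ->
  (forall c d, M (A false c * B true d - B false d * A true c)) ->
  forall r r2 c c1, M (A r c1 * B r2 c - B r c * A r2 c1).
Proof.
move=> Mi h r r2 c c1; have := h c1 c.
case: r; case: r2; move: (A false c1) (A true c1) (B false c) (B true c) => a a' b b' hM //.
- by rewrite mulrC subrr; apply: ideal0.
- by rewrite (_ : _ - _ = - (a * b' - b * a')); [apply: idealN | ring].
by rewrite mulrC subrr; apply: ideal0.
Qed.

Lemma col_swap M (A B : bool -> bool -> Pol N) : is_ideal M ->
  (forall r s, M (A r false * B s true - B s false * A r true)) ->
  forall r r2 c c1, M (A r c1 * B r2 c - A r c * B r2 c1).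
Proof.
move=> Mi h r r2 c c1; have := h r r2.
case: c; case: c1; move: (A r false) (A r true) (B r2 false) (B r2 true) => a a' b b' hM.
- by rewrite subrr; apply: ideal0.
- by rewrite [a' * b]mulrC.
- by rewrite (_ : _ - _ = - (a * b' - b * a')); [apply: idealN | ring].
by rewrite subrr; apply: ideal0.
Qed.

Lemma kT_split (n : 'I_N) r c : kT N r c = kv n r c + \sum_(u | u != n) kv u r c.
Proof. by rewrite /kT (bigD1 n). Qed.

(* Eliminating k_n turns [M] into the ideal of 2-minors of a generic matrix. *)
Lemma depA_prime (n : 'I_N) M : Rideal M -> depA false M ->
  (forall I, Rideal I -> depA false I -> isub M I) -> prime_ideal M.
Proof.
move=> RM dM hM; have Mi := Rideal_ideal RM; have [_ MT _] := RM.
(* Conservation expresses k_n by the others, and all remaining momenta share one lambda, stored at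
   n. *)
pose h i r c : Pol N := if i == n then - \sum_(u | u != n) kv u r c else kv i r c.
pose X c i : Pol N := if i == n then - \sum_(u | u != n) xx c u else xx c i.
pose f : {rmorphism Pol N -> Pol N} := tor (fun _ => n) id \o ksub h.
have fE i r c : f (kv i r c) = lam r n * X c i.
  rewrite /f /= ksubE /h /X; case: eqP => _; last by rewrite torE.
  by rewrite rmorphN rmorph_sum mulrN mulr_sumr; congr (- _); apply: eq_bigr => u _; rewrite /= torE.
apply: (@prime_kernel f).
  apply: hM.
    apply: kernel_Rideal => [r c|i]; last by rewrite !fE mulrACA [RHS]mulrACA [X true i * _]mulrC.
    under eq_bigr do rewrite fE; rewrite -mulr_sumr (bigD1 n) //= /X eqxx.
    by rewrite [X in _ + X](eq_bigr (xx c)) ?addNr ?mulr0 // => u /negbTE ->.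
  move=> t u e g; rewrite /rmin /kt rmorphB !rmorphM !fE.
  by rewrite mulrACA [X in _ - X]mulrACA [X g u * _]mulrC subrr.
move=> x fx; apply: (idealBr Mi _ (b := ksub h x)).
  rewrite -{1}[x]ksub_id; apply: ksub_cong => // i r c; rewrite /h; case: eqP => [->|_].
    by rewrite opprK -kT_split.
  by rewrite subrr; apply: ideal0.
apply: (@tor_kernel _ (fun _ => n) id predT) => // i i1 i2 _ -> _.
exists i1; split=> // r r2 c c1; apply: (row_swap Mi) => c' d'; exact: (dM i1 i c' d').
Qed.

End ToricPrimes.

Section FourParticles.
Implicit Types (i j l m u : 'I_4) (k r c e f tr : bool) (I M p q : Pol 4 -> Prop).

Lemma uniq4_mem i j l m : uniq [:: i; j; l; m] -> forall u, u \in [:: i; j; l; m].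
Proof.
move=> us u; have /subset_cardP h : #|[:: i; j; l; m]| = #|'I_4|.
  by rewrite card_ord (card_uniqP us).
by move: (subset_predT (mem [:: i; j; l; m])) => /h ->.
Qed.

Lemma sum4 (V : zmodType) i j l m (g : 'I_4 -> V) : uniq [:: i; j; l; m] ->
  \sum_u g u = g i + g j + g l + g m.
Proof.
move=> us; rewrite (eq_bigl (mem [:: i; j; l; m])); last by move=> u; rewrite /= uniq4_mem.
by rewrite -big_uniq //= !big_cons big_nil addr0 !addrA.
Qed.

Lemma compl2 i j l m : uniq [:: i; j; l; m] -> ~: [set i; j] = [set l; m].
Proof.
move=> us; apply/setP => u; have := uniq4_mem us u; move: us; rewrite /= !inE !negb_or.
case/and4P => /and3P [ij il im] /andP [jl jm] lm _.
case/or4P => /eqP ->; rewrite !eqxx /= ?orbT ?(negbTE il) ?(negbTE im) ?(negbTE jl) ?(negbTE jm) ?andbF //=.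
  by rewrite ![l == _]eq_sym il jl.
by rewrite ![m == _]eq_sym im jm.
Qed.

Lemma ppmmP i j l m I : Rideal I ->
  isub (p_ppmm i j l m) I <-> dep false I [:: i; j] /\ dep true I [:: l; m].
Proof.
move=> RI; have Ii := Rideal_ideal RI.
have c1 := covers_row (covers_kmat i) (covers_kmat j).
have c2 := covers_row (covers_kmatT l) (covers_kmatT m).
split=> [h|[/(max_minors_dep Ii c1) h1 /(max_minors_dep Ii c2) h2]].
  by split; [apply/(max_minors_dep Ii c1) => x hx | apply/(max_minors_dep Ii c2) => x hx];
    apply/h/Rgen_incl; [left | right].
by apply: Rgen_sub => // x [/h1|/h2].
Qed.

Lemma ppmm_Rideal i j l m : Rideal (p_ppmm i j l m). Proof. exact: Rgen_Rideal. Qed.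

Lemma ppmm_dep i j l m : dep false (p_ppmm i j l m) [:: i; j] /\ dep true (p_ppmm i j l m) [:: l; m].
Proof. by apply/ppmmP => //; apply: ppmm_Rideal. Qed.

(* With K = k_i + k_j as a coordinate in place of k_j, the ideal becomes the ladder
   determinantal ideal of the 2-minors of (k_i K) and of (k_l^T K^T). *)
Lemma ppmm_prime i j l m : uniq [:: i; j; l; m] -> prime_ideal (p_ppmm i j l m).
Proof.
move=> us; set M := p_ppmm i j l m; have RM : Rideal M := ppmm_Rideal i j l m.
have [Mi MT MQ] := RM; have [d1 d2] : dep false M [:: i; j] /\ dep true M [:: l; m] := ppmm_dep i j l m.
have mem4 := uniq4_mem us.
have kT4 r c : kT 4 r c = kv i r c + kv j r c + kv l r c + kv m r c by rewrite /kT (sum4 _ us).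
move: (us); rewrite /= !inE !negb_or.
case/and4P => /and3P [/negbTE ij /negbTE il /negbTE im] /andP [/negbTE jl /negbTE jm] /negbTE lm _.
have [ji li mi] : [/\ (j == i) = false, (l == i) = false & (m == i) = false] by rewrite eq_sym ij eq_sym il eq_sym im.
have [lj mj ml] : [/\ (l == j) = false, (m == j) = false & (m == l) = false] by rewrite eq_sym jl eq_sym jm eq_sym lm.
(* Slot j now holds K: h writes k_j = K - k_i and k_m = -K - k_l, and g puts K = k_i + k_j back, so
   g after h is the identity modulo M. *)
pose h u r c : Pol 4 := if u == j then kv j r c - kv i r c else
  if u == m then - kv j r c - kv l r c else kv u r c.
pose g u r c : Pol 4 := if u == j then kv i r c + kv j r c else kv u r c.
pose al u := if u == j then i else u.
pose be u := if u == l then j else u.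
pose f : {rmorphism Pol 4 -> Pol 4} := tor al be \o ksub h.
have fi r c : f (kv i r c) = lam r i * xx c i.
  by rewrite /f /= ksubE /h ij im torE /al /be ij il.
have fj r c : f (kv j r c) = lam r i * (xx c j - xx c i).
  by rewrite /f /= ksubE /h eqxx rmorphB /= !torE /al /be eqxx ij il jl mulrBr.
have fl r c : f (kv l r c) = lam r l * xx c j.
  by rewrite /f /= ksubE /h lj lm torE /al /be lj eqxx.
have fm r c : f (kv m r c) = (- lam r i - lam r l) * xx c j.
  by rewrite /f /= ksubE /h mj eqxx rmorphB rmorphN /= !torE /al /be !eqxx lj jl mulrBl mulNr.
apply: (@prime_kernel _ f).
  have Rf : Rideal (fun x => f x = 0).
    apply: kernel_Rideal => [r c|u].
      rewrite (sum4 _ us) fi fj fl fm; move: (lam r i) (lam r l) (xx c i) (xx c j) => *; ring.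
    have := mem4 u; rewrite !inE => /or4P [] /eqP ->; rewrite ?fi ?fj ?fl ?fm;
      by rewrite mulrACA [RHS]mulrACA; congr (_ * _); rewrite mulrC.
  apply/(ppmmP _ _ _ _ Rf); split; apply: dep2 => // e e'; rewrite /rmin /kt rmorphB !rmorphM.
    by rewrite !fi !fj mulrACA [X in _ - X]mulrACA [(xx e' j - _) * _]mulrC subrr.
  by rewrite !fl !fm; move: (- lam e' i - lam e' l) (lam e l) (xx false j) (xx true j) => *; ring.
move=> x fx.
have gh : M (ksub g (ksub h x) - x).
  rewrite ksub_comp -{2}[x]ksub_id; apply: ksub_cong => // u r c; rewrite /h.
  have [->|uj] := eqVneq u j.
    by rewrite rmorphB /= !ksubE /g eqxx ij addrAC addrK subrr; apply: ideal0.
  have [->|um] := eqVneq u m; last by rewrite ksubE /g (negbTE uj) subrr; apply: ideal0.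
  rewrite rmorphB rmorphN /= !ksubE /g eqxx lj.
  rewrite (_ : _ - _ = - kT 4 r c); first exact: idealN.
  by rewrite kT4; move: (kv i r c) (kv j r c) (kv l r c) (kv m r c) => *; ring.
rewrite -[x](subKr (ksub g (ksub h x))); apply: idealB => //.
(* Exchanging K against k_i and k_l would need the corner lambda_l x_i, which the ladder lacks;
   hence slot j is the one that is not good. *)
apply: (@tor_kernel _ al be (predC1 j) (fun y => M (ksub g y))) => //.
- exact: preim_ideal.
- move=> u v; rewrite /al /be.
  have := mem4 u; have := mem4 v; rewrite !inE => /or4P [] /eqP -> /or4P [] /eqP -> //;
    by rewrite ?eqxx ?ij ?il ?im ?jl ?jm ?lm ?ji ?li ?mi ?lj ?mj ?ml // => h1 h2;
       move: ij il im jl jm lm; rewrite ?h1 ?h2 ?eqxx // -?h1 -?h2 ?eqxx.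
have din e e' t u : t \in [:: i; j] -> u \in [:: i; j] -> M (kv t false e * kv u true e' - kv u false e' * kv t true e).
  by move=> ht hu; exact: (d1 t u e e' ht hu).
have ii : i \in [:: i; j] by rewrite inE eqxx.
have jj : j \in [:: i; j] by rewrite !inE eqxx orbT.
have qq t e e' : M (kv t false e * kv t true e' - kv t false e' * kv t true e).
  exact: (rmin_diag false t e e' RM).
pose K r c : Pol 4 := kv i r c + kv j r c.
have rK t e e' : t \in [:: i; j] -> M (K false e * kv t true e' - kv t false e' * K true e).
  move=> ht; have := idealD Mi (din e e' i t ii ht) (din e e' j t jj ht).
  by congr M; rewrite /K; move: (kv i false e) (kv i true e) (kv j false e) (kv j true e) (kv t true e') (kv t false e') => *; ring.
have rKK e e' : M (K false e * K true e' - K false e' * K true e).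
  have := idealD Mi (rK i e e' ii) (rK j e e' jj).
  by congr M; rewrite /K; move: (kv i false e') (kv i true e') (kv j false e') (kv j true e') (kv i false e + kv j false e) (kv i true e + kv j true e) => *; ring.
(* By conservation K is -(k_l + k_m), so these minors reduce to column minors of the pair (l, m). *)
have cK r s : M (kv l r false * K s true - K s false * kv l r true).
  have h1 := rmin_diag true l r s RM.
  have h2 : M (rmin true l r m s) by apply: d2; rewrite !inE eqxx ?orbT.
  have h3 : M (kv l r false * kT 4 s true - kT 4 s false * kv l r true).
    by apply: (idealB Mi); [apply: idealMl | apply: idealMr].
  have := idealB Mi (idealB Mi h3 h1) h2; congr M; rewrite !kT4 /rmin /kt /K.
  move: (kv i s true) (kv i s false) (kv j s true) (kv j s false) (kv l r true) (kv l r false).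
  by move: (kv l s true) (kv l s false) (kv m s true) (kv m s false) => *; ring.
have gK r c : ksub g (kv j r c) = K r c by rewrite ksubE /g eqxx.
have gN u r c : u != j -> ksub g (kv u r c) = kv u r c by move=> /negbTE uj; rewrite ksubE /g uj.
have [ali alj all alm] : [/\ al i = i, al j = i, al l = l & al m = m] by rewrite /al !eqxx ij lj mj.
have [bei bej bel bem] : [/\ be i = i, be j = j, be l = j & be m = m] by rewrite /be !eqxx il jl ml.
have neq (u v : 'I_4) : (u == v) = false -> u = v -> False by move=> h0 e; rewrite e eqxx in h0.
have al_i u : al u = i -> u = i \/ u = j.
  have := mem4 u; rewrite !inE => /or4P [] /eqP ->; rewrite ?ali ?alj ?all ?alm; [by left|by right| |].
    by move/(neq _ _ li).
  by move/(neq _ _ mi).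
have al_l u : al u = l -> u = l.
  have := mem4 u; rewrite !inE => /or4P [] /eqP -> //; rewrite ?ali ?alj ?alm.
  - by move/(neq _ _ il).
  - by move/(neq _ _ il).
  by move/(neq _ _ ml).
have al_m u : al u = m -> u = m.
  have := mem4 u; rewrite !inE => /or4P [] /eqP -> //; rewrite ?ali ?alj ?all.
  - by move/(neq _ _ im).
  - by move/(neq _ _ im).
  by move/(neq _ _ lm).
have be_i u : be u = i -> u = i.
  have := mem4 u; rewrite !inE => /or4P [] /eqP -> //; rewrite ?bej ?bel ?bem.
  - by move/(neq _ _ ji).
  - by move/(neq _ _ ji).
  by move/(neq _ _ mi).
have be_j u : be u = j -> u = j \/ u = l.
  have := mem4 u; rewrite !inE => /or4P [] /eqP ->; rewrite ?bei ?bem; [|by left|by right|].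
    by move/(neq _ _ ij).
  by move/(neq _ _ mj).
have be_m u : be u = m -> u = m.
  have := mem4 u; rewrite !inE => /or4P [] /eqP -> //; rewrite ?bei ?bej ?bel.
  - by move/(neq _ _ im).
  - by move/(neq _ _ jm).
  by move/(neq _ _ jm).
have [ijn ljn mjn] : [/\ i != j, l != j & m != j] by rewrite ij lj mj.
have gker a1 a2 a a3 :
    (forall r r2 c c1, M (ksub g (kv a1 r c1) * ksub g (kv a2 r2 c) - ksub g (kv a r c) * ksub g (kv a3 r2 c1))) ->
    forall r r2 c c1, M (ksub g (kv a1 r c1 * kv a2 r2 c - kv a r c * kv a3 r2 c1)).
  by move=> hM r r2 c c1; rewrite rmorphB !rmorphM; exact: hM.
move=> a a1 a2; have := mem4 a; rewrite !inE => /or4P [] /eqP ->; rewrite ?ali ?alj ?all ?alm ?bei ?bej ?bel ?bem.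
- move=> /al_i h1 /be_i -> _; exists a1; split=> //; first by case: h1 => ->; rewrite ?ali ?alj.
  apply: gker => r r2 c c1.
  case: h1 => ->; first by rewrite !gN //; apply: (row_swap Mi) => e e'; exact: qq.
  by rewrite !gK !(gN i) //; apply: (row_swap (B := kv i) Mi) => e e'; exact: rK.
- move=> /al_i h1 /be_j h2 h3; exists j.
  have [-> ->] : a1 = j /\ a2 = j.
    move: h3; rewrite /= eqxx /=; case: h1 => ->; first by rewrite ijn.
    by case: h2 => ->; rewrite // ljn andbF.
  split=> //; apply: gker => r r2 c c1; rewrite !gK.
  by apply: (row_swap Mi) => e e'; exact: rKK.
- move=> /al_l -> /be_j h2 _; exists a2; split=> //; first by case: h2 => ->; rewrite ?bej ?bel.
  apply: gker => r r2 c c1.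
  case: h2 => ->; last by rewrite !gN //; apply: (col_swap (A := kv l) (B := kv l) Mi) => r' s';
    exact: (rmin_diag true l r' s' RM).
  by rewrite !gK !(gN l) //; apply: (col_swap (A := kv l) Mi) => r' s'; exact: cK.
move=> /al_m -> /be_m -> _; exists m; split=> //; apply: gker => r r2 c c1; rewrite !gN //.
by apply: (row_swap Mi) => e e'; exact: qq.
Qed.

End FourParticles.

(** * The list of minimal primes for N = 4 and their non-inclusions *)

Section FourParticlesMin.
Implicit Types (i j l m u : 'I_4) (k r c e f tr : bool) (I M p q : Pol 4 -> Prop).

Definition PP tr : Pol 4 -> Prop := if tr then p_mmmm else p_pppp.

Lemma mem_inord4 u : u \in [:: inord 0; inord 1; inord 2; inord 3].
Proof. by apply: uniq4_mem; rewrite -(map_inj_uniq val_inj) /= !inordK. Qed.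

Lemma PPP tr I : Rideal I -> isub (PP tr) I <-> depA tr I.
Proof.
move=> RI; have all4 : dep tr I [:: inord 0; inord 1; inord 2; inord 3] <-> depA tr I.
  by split=> h t u e f; [apply: h; exact: mem_inord4 | move=> _ _; exact: h].
rewrite -all4 /PP /p_mmmm /p_pppp; case: tr {all4}.
  have c s t := covers_row (covers_kmatT (inord s : 'I_4)) (covers_kmatT (inord t : 'I_4)).
  exact: (Rgen_dep (covers_row (c 0 1) (c 2 3)) RI).
have c s t := covers_row (covers_kmat (inord s : 'I_4)) (covers_kmat (inord t : 'I_4)).
exact: (Rgen_dep (covers_row (c 0 1) (c 2 3)) RI).
Qed.

Lemma PP_Rideal tr : Rideal (PP tr). Proof. by case: tr; apply: Rgen_Rideal. Qed.

Lemma PP_dep tr : depA tr (PP tr). Proof. by apply/PPP => //; apply: PP_Rideal. Qed.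

Lemma depA_dep tr I s : depA tr I -> dep tr I s. Proof. by move=> h t u e f _ _; exact: h. Qed.

Lemma tI_depA tr I : depA tr (tI I) <-> depA (~~ tr) I.
Proof. by split=> h t u e f; move: (h t u e f); rewrite /tI tau_rmin. Qed.

Lemma PP_prime tr : Rprime (PP tr).
Proof.
have h0 : Rprime (PP false).
  apply/RprimeE; split; last exact: PP_Rideal.
  by apply: (depA_prime ord0 (PP_Rideal false) (@PP_dep false)) => I RI dI; apply/PPP.
case: tr; last exact: h0.
apply: (Rprime_ieq (I := tI (PP false))); last exact: tI_Rprime.
apply: isub_ieq.
  by apply: tI_subr; apply/PPP; [exact/tI_Rideal/PP_Rideal | apply/tI_depA; exact: PP_dep].
by apply/PPP; [exact/tI_Rideal/PP_Rideal | apply/tI_depA; exact: PP_dep].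
Qed.

Lemma ppmm_Rprime i j l m : uniq [:: i; j; l; m] -> Rprime (p_ppmm i j l m).
Proof. by move=> us; apply/RprimeE; split; [exact: ppmm_prime | exact: ppmm_Rideal]. Qed.

Section Pairs.
Variables i j l m : 'I_4.
Hypothesis us : uniq [:: i; j; l; m].

Lemma uniq4_neq : i != j /\ l != m.
Proof. by move: us; rewrite /= !inE !negb_or => /and4P [/and3P [-> _ _] _ -> _]. Qed.

Lemma kT4 r c : kT 4 r c = kv i r c + kv j r c + kv l r c + kv m r c.
Proof. by rewrite /kT (sum4 _ us). Qed.

(* If k_i + k_j is nonzero modulo [q], all columns are parallel to one of its nonzero columns. *)
Lemma dep_same q : Rprime q -> dep false q [:: i; j] -> dep false q [:: l; m] ->
  depA false q \/ isub (p_ppmm i j l m) q.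
Proof.
move=> qp d1 d2; have Rq := Rprime_Rideal qp; have [qi qT qQ] := Rq; have [[_ _ qm] _] := qp.
have [hK|hK] := classic (forall r c, q (kv i r c + kv j r c)).
  (* Here k_m = -k_l modulo q, so the column minors of (l, m) reduce to minors within k_l. *)
  right; apply/(ppmmP _ _ _ _ Rq); split; [exact: d1 | apply: (dep2 Rq) => e f].
  have h1 := rmin_diag true l e f Rq.
  have hlm r c : q (kv l r c + kv m r c).
    rewrite (_ : _ + _ = kT 4 r c - (kv i r c + kv j r c)); first exact: idealB.
    by rewrite kT4; move: (kv i r c) (kv j r c) (kv l r c) (kv m r c) => *; ring.
  have := idealB qi (idealB qi (idealMl (kv l e false) qi (hlm f true))
    (idealMr (kv l e true) qi (hlm f false))) h1.
  congr q; rewrite /rmin /kt.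
  by move: (kv l e false) (kv l e true) (kv l f false) (kv l f true) (kv m f false) (kv m f true) => *; ring.
left; have [r0 [c0 nK]] : exists r0 c0, ~ q (kv i r0 c0 + kv j r0 c0).
  by apply: NNPP => h; apply: hK => r c; apply: NNPP => nq; apply: h; exists r, c.
pose K r := kv i r c0 + kv j r c0.
(* For t = l or m, conservation replaces K by the column of -(k_l + k_m), to which k_t is parallel
   by [d2]. *)
have hc t e : q (kv t false e * K true - K false * kv t true e).
  have := uniq4_mem us t; rewrite (mem_cat t [:: i; j] [:: l; m]) => /orP [ht|ht].
    have := idealD qi (d1 t i e c0 ht (mem_head _ _)) (d1 t j e c0 ht (mem_last i [:: j])).
    by congr q; rewrite /rmin /kt /K; move: (kv t false e) (kv t true e) (kv i false c0) (kv i true c0) (kv j false c0) (kv j true c0) => *; ring.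
  have h1 := idealD qi (d2 t l e c0 ht (mem_head _ _)) (d2 t m e c0 ht (mem_last l [:: m])).
  have := idealB qi (idealB qi (idealMl (kv t false e) qi (qT true c0)) (idealMr (kv t true e) qi (qT false c0))) h1.
  congr q; rewrite /rmin /kt /K !kT4.
  move: (kv t false e) (kv t true e) (kv i false c0) (kv i true c0) (kv j false c0) (kv j true c0).
  by move: (kv l false c0) (kv l true c0) (kv m false c0) (kv m true c0) => *; ring.
(* Both columns are parallel to K, so the entry K_{r0} times their minor combines two relations
   [hc]; this entry is not in the prime q. *)
move=> t u e f; have : q (K r0 * rmin false t e u f).
  have := idealB qi (idealMl (kv u r0 f) qi (hc t e)) (idealMl (kv t r0 e) qi (hc u f)).
  congr q; rewrite /rmin /kt; clear; case: r0;
  by move: (kv t false e) (kv t true e) (kv u false f) (kv u true f) (K false) (K true) => *; ring.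
by case/qm.
Qed.

End Pairs.

(* k_i = E_12, k_j = E_11 - E_12, k_l = E_21, k_m = - E_11 - E_21 *)
Definition pt4 i j l m u r c : int :=
  if u == i then (if ~~ r && c then 1 else 0) else
  if u == j then (if r then 0 else if c then -1 else 1) else
  if u == l then (if r && ~~ c then 1 else 0) else (if c then 0 else -1).

Section Point4.
Variables i j l m : 'I_4.
Hypothesis us : uniq [:: i; j; l; m].

Lemma pt4E : [/\ forall r c, pt4 i j l m i r c = (if ~~ r && c then 1 else 0),
  forall r c, pt4 i j l m j r c = (if r then 0 else if c then -1 else 1),
  forall r c, pt4 i j l m l r c = (if r && ~~ c then 1 else 0) &
  forall r c, pt4 i j l m m r c = (if c then 0 else -1)].
Proof.
move: us; rewrite /= !inE !negb_or.
case/and4P => /and3P [/negbTE ij /negbTE il /negbTE im] /andP [/negbTE jl /negbTE jm] /negbTE lm _.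
rewrite /pt4 !eqxx [j == i]eq_sym [l == i]eq_sym [m == i]eq_sym [l == j]eq_sym [m == j]eq_sym [m == l]eq_sym.
by rewrite ij il im jl jm lm.
Qed.

Lemma pt4_Rideal : Rideal (EI (pt4 i j l m)).
Proof.
have [hi hj hl hm] := pt4E; apply: EI_Rideal => [r c|u].
  by rewrite (sum4 _ us) hi hj hl hm; case: r; case: c.
by have := uniq4_mem us u; rewrite !inE => /or4P [] /eqP ->; rewrite ?hi ?hj ?hl ?hm.
Qed.

Lemma pt4_ppmm : isub (p_ppmm i j l m) (EI (pt4 i j l m)).
Proof.
have [hi hj hl hm] := pt4E; apply/ppmmP; first exact: pt4_Rideal.
by split; apply: dep2; try exact: pt4_Rideal; move=> e f; apply: EI_rmin;
  rewrite /ymin /yt ?hi ?hj ?hl ?hm; case: e; case: f.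
Qed.

(** Up to sign the lambdas of the point are (1,0), (1,0), (0,1), (1,1) for i, j, l, m, so (i, j) is
    the only parallel pair; every other pair has a row minor equal to 1 or -1. *)
Lemma pt4_dep_false a b : a != b -> dep false (EI (pt4 i j l m)) [:: a; b] -> [set a; b] = [set i; j].
Proof.
have [hi hj hl hm] := pt4E => ab h.
have key u v e f : u \in [:: a; b] -> v \in [:: a; b] ->
    ymin (pt4 i j l m) false u e v f = 1 \/ ymin (pt4 i j l m) false u e v f = -1 -> False.
  by move=> hu hv hy; apply: (EI_unit (ev_rmin _ _ _ _ _ _) hy (h u v e f hu hv)).
have ha : a \in [:: a; b] by rewrite inE eqxx.
have hb : b \in [:: a; b] by rewrite !inE eqxx orbT.
have k2 u v e f : (u = a /\ v = b) \/ (u = b /\ v = a) ->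
    ymin (pt4 i j l m) false u e v f = 1 \/ ymin (pt4 i j l m) false u e v f = -1 -> False.
  by case=> -[-> ->]; apply: key.
have kil := k2 i l true false; have kim := k2 i m true false.
have kjl := k2 j l false false; have kjm := k2 j m false false; have klm := k2 l m false false.
rewrite /ymin /yt ?hi ?hj ?hl ?hm /= in kil kim kjl kjm klm.
have := uniq4_mem us a; have := uniq4_mem us b; rewrite !inE.
case/or4P => /eqP eb /or4P [] /eqP ea; move: ab; rewrite ?ea ?eb ?eqxx // => _; try exact: setUC.
all: exfalso; first [apply: kil; [by auto | by auto] | apply: kim; [by auto | by auto]
  | apply: kjl; [by auto | by auto] | apply: kjm; [by auto | by auto] | apply: klm; [by auto | by auto] ].
Qed.

Lemma pt4_ndep_true : ~ dep true (EI (pt4 i j l m)) [:: i; j].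
Proof.
have [hi hj hl hm] := pt4E => h.
have := h i j false false (mem_head _ _) (mem_last i [:: j]).
apply: (@EI_unit _ _ _ (-1)); last by right.
by rewrite ev_rmin; congr (_%:~R); rewrite /ymin /yt !hi !hj.
Qed.
End Point4.

Lemma PP_ndep tr a b : a != b -> ~ dep (~~ tr) (PP tr) [:: a; b].
Proof.
move=> ab; have [t ht] : exists t, t \in ~: [set a; b].
  by apply/card_gt0P; have := cardsC [set a; b]; rewrite cards2 ab card_ord; lia.
have us3 : uniq [:: a; b; t].
  by move: ht; rewrite /= !inE !negb_or ab andbT => /andP [ta tb]; rewrite eq_sym ta eq_sym tb.
have hs : isub (PP tr) (EI (pt3 tr a b t)).
  by apply: (proj2 (PPP tr (pt3_Rideal tr us3))) => u v e f;
  exact: (@pt3_dep 4 tr a b t [:: u; v] u v e f (mem_head _ _) (mem_last u [:: v])).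
move=> h; apply: (@pt3_ndep _ tr a b t us3 [:: a; b] (mem_head _ _) (mem_last a [:: b])) => u v e f hu hv.
by apply: hs; apply: h.
Qed.

Section Contain.
Variables i j l m : 'I_4.
Hypothesis us : uniq [:: i; j; l; m].

Lemma us_swap : uniq [:: l; m; i; j].
Proof. by rewrite -[[:: l; m; i; j]]/([:: l; m] ++ [:: i; j]) uniq_catC. Qed.

(* [false] selects the row minors and [true] the column minors, for (i, j) and for (l, m). *)
Definition F4 (a : bool * bool) : Pol 4 -> Prop :=
  match a with
  | (false, false) => p_pppp
  | (true, true) => p_mmmm
  | (false, true) => p_ppmm i j l m
  | (true, false) => p_ppmm l m i j
  end.

Lemma tI_ppmm q : Rideal q -> isub (p_ppmm i j l m) (tI q) -> isub (p_ppmm l m i j) q.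
Proof.
move=> Rq /(ppmmP _ _ _ _ (tI_Rideal Rq)) [/tI_dep h1 /tI_dep h2].
by apply/(ppmmP _ _ _ _ Rq).
Qed.

Lemma F4_prime a : Rprime (F4 a).
Proof.
case: a => -[] [] /=; [exact: (PP_prime true) | | | exact: (PP_prime false)].
  exact: ppmm_Rprime us_swap.
exact: ppmm_Rprime us.
Qed.

Lemma F4_QJ a : F4 a (QJ [set i; j]).
Proof.
have [ij lm] := uniq4_neq us; have RF := Rprime_Rideal (F4_prime a).
case: a RF => -[] [] /= RF.
- exact: (dep_QJ ij RF (depA_dep (@PP_dep true))).
- exact: (dep_QJ ij RF (ppmm_dep l m i j).2).
- exact: (dep_QJ ij RF (ppmm_dep i j l m).1).
exact: (dep_QJ ij RF (depA_dep (@PP_dep false))).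
Qed.

Lemma F4_contain q : Rprime q -> q (QJ [set i; j]) -> exists a, isub (F4 a) q.
Proof.
move=> qp qQ; have Rq := Rprime_Rideal qp; have [ij lm] := uniq4_neq us.
have qQ' : q (QJ [set l; m]) by rewrite -(compl2 us); exact: QJ_compl.
have [h1|h1] := QJ_split ij qp qQ; have [h2|h2] := QJ_split lm qp qQ'.
- have [h|h] := dep_same us qp h1 h2; last by exists (false, true).
  by exists (false, false); exact: (proj2 (PPP false Rq) h).
- by exists (false, true); apply/(ppmmP _ _ _ _ Rq).
- by exists (true, false); apply/(ppmmP _ _ _ _ Rq).
(* Both pairs are of column type; transposition reduces to the row case of [dep_same]. *)
have tp := tI_Rprime qp.
have [h|h] := dep_same us tp (proj2 (tI_dep _ _ _) h1) (proj2 (tI_dep _ _ _) h2).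
  by exists (true, true); apply: (proj2 (PPP true Rq)); exact: (proj1 (tI_depA _ _) h).
by exists (true, false); apply: tI_ppmm.
Qed.

Lemma ppmm_dep_false a b : a != b -> dep false (p_ppmm i j l m) [:: a; b] -> [set a; b] = [set i; j].
Proof. by move=> ab h; apply: (pt4_dep_false us ab) => u v e f hu hv; apply/(pt4_ppmm us)/h. Qed.

Lemma ppmm_ndep_true : ~ dep true (p_ppmm i j l m) [:: i; j].
Proof. by move=> h; apply: (pt4_ndep_true us) => u v e f hu hv; apply/(pt4_ppmm us)/h. Qed.
End Contain.

Lemma PP_nsub_PP tr : ~ isub (PP (~~ tr)) (PP tr).
Proof.
move/(PPP _ (PP_Rideal tr)) => h.
exact: (@PP_ndep tr ord0 (lift ord0 ord0) isT (depA_dep h)).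
Qed.

Lemma ppmm_nsub_PP tr i j l m : uniq [:: i; j; l; m] -> ~ isub (p_ppmm i j l m) (PP tr).
Proof.
move=> us; have [ij lm] := uniq4_neq us.
move/(ppmmP _ _ _ _ (PP_Rideal tr)) => [h1 h2]; case: tr h1 h2 => h1 h2.
  exact: (PP_ndep (tr := true) ij h1).
exact: (PP_ndep (tr := false) lm h2).
Qed.

Lemma PP_nsub_ppmm tr i j l m : uniq [:: i; j; l; m] -> ~ isub (PP tr) (p_ppmm i j l m).
Proof.
move=> us; have [ij lm] := uniq4_neq us.
move/(PPP _ (ppmm_Rideal i j l m)) => h; case: tr h => h.
  exact: (ppmm_ndep_true us (depA_dep h)).
have e := ppmm_dep_false us lm (depA_dep h).
have : l \in [set i; j] by rewrite -e !inE eqxx.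
by rewrite -(negbK (l \in _)) -in_setC (compl2 us) !inE eqxx.
Qed.

Lemma ppmm_sub i j l m i' j' l' m' : uniq [:: i; j; l; m] -> uniq [:: i'; j'; l'; m'] ->
  isub (p_ppmm i j l m) (p_ppmm i' j' l' m') <-> [set i; j] = [set i'; j'].
Proof.
move=> us us'; have [ij lm] := uniq4_neq us; have R' := ppmm_Rideal i' j' l' m'.
split=> [/(ppmmP _ _ _ _ R') [h1 h2]|e].
  exact: (ppmm_dep_false us' ij h1).
have e2 : [set l; m] = [set l'; m'] by rewrite -(compl2 us) -(compl2 us') e.
apply/(ppmmP _ _ _ _ R'); have [h1 h2] := ppmm_dep i' j' l' m'; split.
  by apply: dep_sub h1 => u; have /setP/(_ u) := e; rewrite !inE => ->.
by apply: dep_sub h2 => u; have /setP/(_ u) := e2; rewrite !inE => ->.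
Qed.

Lemma minprime4 i j l m : uniq [:: i; j; l; m] -> forall p,
  minprime_over p (single (QJ [set i; j])) <-> exists a, ieq p (F4 i j l m a).
Proof.
move=> us; apply: minprime_family; [exact: F4_prime | exact: F4_QJ | exact: F4_contain |].
have us' := us_swap us.
have ne : [set i; j] <> [set l; m].
  move=> e; have : l \in [set i; j] by rewrite e !inE eqxx.
  by rewrite -(negbK (l \in _)) -in_setC (compl2 us) !inE eqxx.
case=> -[] [] [[] []] /= h //; exfalso.
- exact: (PP_nsub_ppmm (tr := true) us' h).
- exact: (PP_nsub_ppmm (tr := true) us h).
- exact: (PP_nsub_PP (tr := false) h).
- exact: (ppmm_nsub_PP (tr := true) us' h).
- by apply: ne; apply/esym/(proj1 (ppmm_sub us' us)).
- exact: (ppmm_nsub_PP (tr := false) us' h).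
- exact: (ppmm_nsub_PP (tr := true) us h).
- by apply: ne; apply/(proj1 (ppmm_sub us us')).
- exact: (ppmm_nsub_PP (tr := false) us h).
- exact: (PP_nsub_PP (tr := true) h).
- exact: (PP_nsub_ppmm (tr := false) us' h).
exact: (PP_nsub_ppmm (tr := false) us h).
Qed.

End FourParticlesMin.

(** * Assembling the statement for all internal momenta *)

Lemma uniq4_extend (i j : 'I_4) : i != j -> exists l m, uniq [:: i; j; l; m].
Proof.
move=> ij; have : #|~: [set i; j]| == 2 by have := cardsC [set i; j]; rewrite cards2 ij card_ord; lia.
case/cards2P => l [m [lm e]]; exists l, m.
have hl : l \in ~: [set i; j] by rewrite e !inE eqxx.
have hm : m \in ~: [set i; j] by rewrite e !inE eqxx orbT.
move: hl hm; rewrite /= !inE !negb_or ij lm andbT => /andP [li lj] /andP [mi mj].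
by rewrite ![i == _]eq_sym ![j == _]eq_sym li lj mi mj.
Qed.

Lemma internal4 (J : {set 'I_4}) : internal J <-> exists i j l m, uniq [:: i; j; l; m] /\ J = [set i; j].
Proof.
split=> [/andP [h1 h2]|[i [j [l [m [us ->]]]]]]; last first.
  by have [ij _] := uniq4_neq us; rewrite /internal cards2 ij.
have /cards2P [i [j [ij ->]]] : #|J| == 2 by rewrite eqn_leq h1 h2.
by have [l [m us]] := uniq4_extend ij; exists i, j, l, m.
Qed.

Lemma frakP4 (p : Pol 4 -> Prop) : frakP p <->
  (ieq p p_pppp \/ ieq p p_mmmm \/
   exists i j l m : 'I_4, uniq [:: i; j; l; m] /\ ieq p (p_ppmm i j l m)).
Proof.
split=> [[J [/internal4 [i [j [l [m [us ->]]]]] /(minprime4 us) [[[] []] /= e]]]|].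
- by right; left.
- by right; right; exists l, m, i, j; split; [exact: us_swap us|].
- by right; right; exists i, j, l, m.
- by left.
have h i j l m a : uniq [:: i; j; l; m] -> ieq p (F4 i j l m a) -> frakP p.
  move=> us e; exists [set i; j]; split; first by apply/internal4; exists i, j, l, m.
  by apply/(minprime4 us); exists a.
have [l [m us]] := @uniq4_extend ord0 (lift ord0 ord0) isT.
case=> [e|[e|[i [j [l' [m' [us' e]]]]]]].
- exact: (h _ _ _ _ (false, false) us e).
- exact: (h _ _ _ _ (true, true) us e).
exact: (h _ _ _ _ (false, true) us' e).
Qed.

Lemma Rgen_QJ_compl N (J : {set 'I_N}) : ieq (Rgen (single (QJ J))) (Rgen (single (QJ (~: J)))).
Proof.
have h K : isub (Rgen (single (QJ (~: K)))) (Rgen (single (QJ K))).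
  apply: (proj2 (Rgen_singleP _ (Rgen_Rideal _))).
  exact: QJ_compl (Rgen_Rideal _) (Rgen_incl (erefl _)).
by apply: isub_ieq; last exact: h; rewrite -{1}[J]setCK; exact: h.
Qed.

Theorem mainTheorem15 :
  (* ---------- N = 4 ---------- *)
  ( (* P_4 consists exactly of the 8 ideals *)
    (forall p : Pol 4 -> Prop,
       frakP p <->
       (ieq p p_pppp \/ ieq p p_mmmm \/
        exists i j l m : 'I_4, uniq [:: i; j; l; m] /\ ieq p (p_ppmm i j l m)))
    (* they are pairwise distinct (so |P_4| = 8) *)
    /\ ~ ieq p_pppp p_mmmm
    /\ (forall i j l m : 'I_4, uniq [:: i; j; l; m] ->
          ~ ieq p_pppp (p_ppmm i j l m) /\ ~ ieq p_mmmm (p_ppmm i j l m))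
    /\ (forall i j l m i' j' l' m' : 'I_4,
          uniq [:: i; j; l; m] -> uniq [:: i'; j'; l'; m'] ->
          (ieq (p_ppmm i j l m) (p_ppmm i' j' l' m') <-> [set i; j] = [set i'; j']))
    (* p_{++++} and p_{----} are minimal over (Q_12), (Q_13), (Q_14) *)
    /\ (forall j : 'I_4, j != inord 0 ->
          minprime_over p_pppp (single (QJ [set inord 0; j])) /\
          minprime_over p_mmmm (single (QJ [set inord 0; j])))
    (* p_{++--} is minimal over (Q_12) = (Q_34) *)
    /\ (forall i j l m : 'I_4, uniq [:: i; j; l; m] ->
          minprime_over (p_ppmm i j l m) (single (QJ [set i; j])) /\
          ieq (Rgen (single (QJ [set i; j]))) (Rgen (single (QJ [set l; m])))) )
  /\
  (* ---------- N >= 5 ---------- *)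
  (forall N : nat, (5 <= N)%N ->
    (forall (p : Pol N -> Prop) (J J' : {set 'I_N}),
       internal J -> internal J' ->
       minprime_over p (single (QJ J)) -> minprime_over p (single (QJ J')) ->
       J' = J \/ J' = ~: J)
    /\ (forall J : {set 'I_N}, internal J -> (3 <= #|J|)%N -> (3 <= #|~: J|)%N ->
          Rprime (Rgen (single (QJ J))))
    /\ (forall i j : 'I_N, i != j ->
          (forall p : Pol N -> Prop,
             minprime_over p (single (QJ [set i; j])) <->
             (ieq p (p_plus i j) \/ ieq p (p_minus i j)))
          /\ ~ ieq (p_plus i j) (p_minus i j))).
Proof.
split; last first.
  move=> N N5; split; first exact: minprime_unique.
  split=> [J _ J3 Jc3|i j ij]; first exact: QJ_prime.
  split=> [p|e]; last by apply: (@pp_nsub N true i j _ ij) => [|x /e //]; exact: leq_trans N5.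
  rewrite (minprime_pair N5 ij p); split=> [[[] e]|[e|e]]; [by right | by left | by exists false | by exists true].
split; first exact: frakP4.
split; first by move=> e; apply: (@PP_nsub_PP true) => x /e.
split.
  move=> i j l m us; split=> e.
    by apply: (@PP_nsub_ppmm false _ _ _ _ us) => x /e.
  by apply: (@PP_nsub_ppmm true _ _ _ _ us) => x /e.
split.
  move=> i j l m i' j' l' m' us us'; split=> [e|e].
    by apply/(ppmm_sub us us') => x /e.
  by apply: isub_ieq; [apply/(ppmm_sub us us') | apply/(ppmm_sub us' us)].
split.
  move=> j; rewrite eq_sym => j0; have [l [m us]] := uniq4_extend j0.
  by split; apply/(minprime4 us); [exists (false, false) | exists (true, true)].
move=> i j l m us; split; first by apply/(minprime4 us); exists (false, true).
by rewrite -(compl2 us); exact: Rgen_QJ_compl.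
Qed.
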